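(* Let $n\ge1$. A real algebraic subset of $\mathbb C^n=\mathbb R^{2n}$ is of type A with respect to $\mathcal P_{n,n}$ if and only if it is of type C with respect to $\mathcal P_{n,n}$.
   Context: $\mathcal P_{n,n}=\mathbb C[X_1,\ldots,X_n,Y_1,\ldots,Y_n]$ is regarded as the complex $*$-algebra with the unique involution such that $X_j^*=Y_j$ for all $j=1,\ldots,n$. For $P\in\mathcal P_{n,n}$, let $\mathcal Z_P=\{z\in\mathbb C^n: P(z,\bar z)=0\}$ and let $(P)$ be the ideal of $\mathcal P_{n,n}$ generated by $P$. The real algebraic subsets of $\mathbb C^n=\mathbb R^{2n}$ are exactly the sets $V=\mathcal Z_P$ with $P\in\mathcal P_{n,n}$. For $V\subset\mathbb C^n$, let $\mathcal I(V)=\{R\in\mathcal P_{n,n}: R(z,\bar z)=0\text{ for all }z\in V\}$. A complex linear functional $\Lambda:\mathcal P_{n,n}\to\mathbb C$ is positive definite if $\Lambda(R^*R)\ge0$ for all $R\in\mathcal P_{n,n}$; for such $\Lambda$ put $\mathcal I_\Lambda=\{R\in\mathcal P_{n,n}:\Lambda(R^*R)=0\}$. $\Lambda$ is a moment functional if there is a positive Borel measure $\mu$ on $\mathbb C^n$ (with all functions $z\mapsto R(z,\bar z)$, $R\in\mathcal P_{n,n}$, absolutely integrable) such that $\Lambda(R)=\int_{\mathbb C^n}R(z,\bar z)\,d\mu(z)$ for all $R\in\mathcal P_{n,n}$. The real algebraic set $V=\mathcal Z_P$ is of type A (respectively, type C) with respect to $\mathcal P_{n,n}$ if every positive definite linear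 functional $\Lambda:\mathcal P_{n,n}\to\mathbb C$ for which $(P)\subset\ker\Lambda$ (respectively, $\mathcal I(V)=\mathcal I_\Lambda$) is a moment functional; type A does not depend on the choice of the polynomial $P$ with $V=\mathcal Z_P$. *)

(* Defs.v *)
From HB Require Import structures.
From mathcomp Require Import all_boot all_order all_algebra.
From mathcomp Require Import all_classical all_reals all_analysis.
From mathcomp Require Import complex.
(* The notations of mpoly clash with those of mathcomp-analysis. *)
From mathcomp Require Export -(notations) mpoly.

Set Implicit Arguments.
Unset Strict Implicit.
Unset Printing Implicit Defensive.

Import Order.TTheory GRing.Theory Num.Theory.
Import numFieldNormedType.Exports.

Local Open Scope classical_set_scope.
Local Open Scope ring_scope.
Local Open Scope complex_scope.

Section ComplexMomentProblem.
Context {R : realType} {n : nat}.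

(* C^n as row vectors. The copy R[i]^o of R[i] carries the usual (norm)
   topology, so that open sets below are those of the product topology. *)
Definition Cn : Type := 'rV[R[i]^o]_n.

Definition borelCn := g_sigma_algebraType (@open 'rV[R[i]^o]_n).

(* C[X_1, ..., X_n, Y_1, ..., Y_n], where X_j is the variable of index
   lshift n j and Y_j that of index rshift n j. *)
Local Notation Pnn := (mpoly (n + n) R[i]).

Definition swap_var (k : 'I_(n + n)) : 'I_(n + n) :=
  match fintype.split k with inl j => rshift n j | inr j => lshift n j end.

(* The conjugate-linear involution exchanging X_j and Y_j. *)
Definition star (Q : Pnn) : Pnn :=
  mmap (fun c : R[i] => mpolyC (n + n) c^*)
       (fun k => mpolyX R[i] (mnm1 (swap_var k))) Q.

Definition evalC (Q : Pnn) (z : Cn) : R[i] :=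
  meval (fun k => match fintype.split k with
                  | inl j => z ord0 j
                  | inr j => (z ord0 j)^*
                  end) Q.

Definition zero_set (P : Pnn) : set Cn := [set z | evalC P z = 0].

Definition principal_ideal (P : Pnn) : set Pnn :=
  [set Q | exists S : Pnn, Q = S * P].

Definition vanishing_ideal (V : set Cn) : set Pnn :=
  [set Q | forall z, V z -> evalC Q z = 0].

Definition kernel (L : {scalar Pnn}) : set Pnn := [set Q | L Q = 0].

(* The order of R[i] is partial: 0 <= c means that c is real and nonnegative. *)
Definition positive_definite (L : {scalar Pnn}) : Prop :=
  forall Q : Pnn, 0 <= L (star Q * Q).

Definition null_ideal (L : {scalar Pnn}) : set Pnn :=
  [set Q | L (star Q * Q) = 0].

Definition moment_functional (L : {scalar Pnn}) : Prop :=
  exists mu : {measure set borelCn -> \bar R},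
    forall Q : Pnn,
      [/\ mu.-integrable setT (fun z : borelCn => (complex.Re (evalC Q z))%:E),
          mu.-integrable setT (fun z : borelCn => (complex.Im (evalC Q z))%:E) &
          L Q = Rintegral mu setT (fun z : borelCn => complex.Re (evalC Q z))
             +i* Rintegral mu setT (fun z : borelCn => complex.Im (evalC Q z))].

(* The set zero_set P is of type A; the defining polynomial P is part of the
   data. *)
Definition type_A (P : Pnn) : Prop :=
  forall L : {scalar Pnn}, positive_definite L ->
    principal_ideal P `<=` kernel L -> moment_functional L.

Definition type_C (V : set Cn) : Prop :=
  forall L : {scalar Pnn}, positive_definite L ->
    vanishing_ideal V = null_ideal L -> moment_functional L.

End ComplexMomentProblem.

Notation Pnn R n := (mpoly (n + n) R[i]).

(* Main.v *)
(* If I(V) = I_L, then L vanishes on (P) by the Cauchy-Schwarz inequality, so that type A implies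
   type C. For the converse, let L be positive definite and zero on (P), and V = Z_P.

   Real Nullstellensatz: I(V) is contained in I_L. The real and imaginary parts of P lie in the real
   ideal I_L. If those of some S in I(V) did not, consider the countable ring of integer polynomials in
   the 2n real coordinates and in the finitely many real constants occurring in P and S: a maximal
   real ideal of it avoiding one of these parts of S is prime, and the real closure of its residue
   field has a point on which P vanishes and S does not. This point is transferred to the real
   numbers one coordinate at a time, by counting roots with prescribed signs (Tarski queries).

   Perturbation: for a dense sequence z_k in V, the functional
   Lambda(Q) = sum_k 2^-(k+1) exp(-|z_k|^2) Q(z_k) is positive definite with I_Lambda = I(V). Hence
   L + Lambda / (k + 1) has null ideal I(V), and is a moment functional when V is of type C.

   Limit: L is the pointwise limit of these moment functionals. Along an ultrafilter the measures of
   sets converge to a content, and the measure that it induces on open sets through compact sets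
   represents L; tightness comes from the moments of |z|^2. *)
Require Import Defs.
From HB Require Import structures.
From mathcomp Require Import all_boot all_order all_algebra.
From mathcomp Require Import finmap.
From mathcomp Require Import all_classical all_reals all_analysis.
From mathcomp Require Import measurable_realfun.
From mathcomp Require Import ring_quotient fraction.
From mathcomp Require Import closed_field polyrcf qe_rcf_th complex.
From mathcomp Require Import zify ring lra.

Set Implicit Arguments.
Unset Strict Implicit.
Unset Printing Implicit Defensive.

Import Order.TTheory GRing.Theory Num.Theory.
Import numFieldNormedType.Exports.
Import Pdiv.Ring.
Local Open Scope classical_set_scope.
Local Open Scope ring_scope.

(** * Real closure of a cone *)

(** Type C speaks only of functionals whose null ideal is exactly [I(V)]. A functional that vanishes
    on [(P)] may have a larger null ideal, and nothing is clear at first about the rest of [I(V)].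
    The Nullstellensatz settles the second point; a summand that is positive on [R^* R] for every
    [R] outside [I(V)] settles the first.

    Countability of the polynomial ring gives the residue field an algebraic closure [K]. A real
    closed field is found in it as [P - P], where [P] is maximal among all cones of [K]: the field
    grows together with its order, and no ordered base field is fixed.

    Real constants enter the terms as variables. A nonnegative real is a hermitian square, so the
    real closed field gives terms in the constants their true signs, and the transfer keeps these
    variables at their values.

    In the limit, masses converge along an ultrafilter only to a finitely additive content, which
    explains the regularization. Since polynomials are unbounded, no mass of their integrals may be
    lost at infinity; this rests on [f <= f^2 / c] where [f > c], the integrals of [f^2] converging
    as well. *)

Section Cones.
Variable K : fieldType.
Implicit Types P : set K.

(** Inverses and squares of differences are included so that [P - P] is a subfield whose squares lie
    in [P]. This subfield varies with the cone. *)
Record is_cone P : Prop := IsCone {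
  cone0 : P 0;
  cone1 : P 1;
  coneD : forall a b, P a -> P b -> P (a + b);
  coneM : forall a b, P a -> P b -> P (a * b);
  coneV : forall a, P a -> P a^-1;
  coneS : forall a b, P a -> P b -> P ((a - b) ^+ 2);
  coneN1 : ~ P (-1) }.

Definition span_cone P : {pred K} :=
  fun x => `[< exists a b, [/\ P a, P b & x = a - b] >].

Lemma maximal_cone P0 : is_cone P0 ->
  exists P, [/\ P0 `<=` P, is_cone P &
    forall P', is_cone P' -> P `<=` P' -> P' `<=` P].
Proof.
move=> cP0.
pose good X := X = set0 \/ (P0 `<=` X /\ is_cone X).
have [F Fgood Ftot|A [[A0|[P0A cA]] Amax]] := @Zorn_bigcup _ good.
- have [[X FX P0X]|noX] := pselect (exists2 X, F X & P0 `<=` X); last first.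
    left; apply/seteqP; split=> // x [X FX Xx]; exfalso.
    by case: (Fgood _ FX) => [X0|[? ?]]; [rewrite X0 in Xx | apply: noX; exists X].
  have cl (Y : set K) y : F Y -> Y y -> is_cone Y.
    by move=> FY Yy; case: (Fgood _ FY) => [Y0|[]//]; rewrite Y0 in Yy.
  have two (a b : K) : (\bigcup_(X in F) X) a -> (\bigcup_(X in F) X) b ->
      exists Y, [/\ F Y, Y a & Y b].
    move=> [Y FY Ya] [Z FZ Zb]; case: (Ftot _ _ FY FZ) => s.
      by exists Z; split=> //; exact: s.
    by exists Y; split=> //; exact: s.
  right; split; first by move=> x /P0X Xx; exists X.
  split.
  + by exists X => //; apply: P0X; exact: cone0.
  + by exists X => //; apply: P0X; exact: cone1.
  + move=> a b Ua Ub; have [Y [FY Ya Yb]] := two _ _ Ua Ub.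
    by exists Y => //; exact: (coneD (cl _ _ FY Ya)).
  + move=> a b Ua Ub; have [Y [FY Ya Yb]] := two _ _ Ua Ub.
    by exists Y => //; exact: (coneM (cl _ _ FY Ya)).
  + by move=> a [Y FY Ya]; exists Y => //; exact: (coneV (cl _ _ FY Ya)).
  + move=> a b Ua Ub; have [Y [FY Ya Yb]] := two _ _ Ua Ub.
    by exists Y => //; exact: (coneS (cl _ _ FY Ya)).
  + by move=> [Y FY Y1]; exact: (coneN1 (cl _ _ FY Y1)).
- exfalso; apply: (Amax P0); last by right; split.
  by rewrite A0; split=> // sub0; exact: (sub0 0 (cone0 cP0)).
- exists A; split=> // P' cP' AP' x P'x; apply: contrapT => nAx.
  apply: (Amax P'); last by right; split=> // y /P0A /AP'.
  by split=> // sub; exact/nAx/sub.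
Qed.

Section SpanCone.
Variables (P : set K) (cP : is_cone P).

Lemma cone_sub_span a : P a -> a \in span_cone P.
Proof. by move=> Pa; apply/asboolP; exists a, 0; rewrite subr0; split=> //; exact: (cone0 cP). Qed.

Lemma span_cone_sqr x : x \in span_cone P -> P (x ^+ 2).
Proof. by move=> /asboolP[a [b [Pa Pb ->]]]; exact: coneS. Qed.

Lemma span_cone_divring : divring_closed (span_cone P).
Proof.
have spM (x y : K) : x \in span_cone P -> y \in span_cone P -> x * y \in span_cone P.
  move=> /asboolP[a [b [Pa Pb ->]]] /asboolP[c [d [Pc Pd ->]]].
  apply/asboolP; exists (a * c + b * d), (a * d + b * c); split.
  - by apply: (coneD cP); apply: (coneM cP).
  - by apply: (coneD cP); apply: (coneM cP).
  - by ring.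
split.
- exact/cone_sub_span/(cone1 cP).
- move=> x y /asboolP[a [b [Pa Pb ->]]] /asboolP[c [d [Pc Pd ->]]].
  apply/asboolP; exists (a + d), (b + c); split; [exact: (coneD cP)..|].
  by ring.
- move=> x y Fx Fy; apply: (spM _ _) => //.
  have [->|y0] := eqVneq y 0; first by rewrite invr0; exact/cone_sub_span/(cone0 cP).
  rewrite (_ : y^-1 = y * (y ^+ 2)^-1); last by field.
  by apply: (spM _ _) => //; apply/cone_sub_span/(coneV cP)/span_cone_sqr.
Qed.

Lemma cone_anti x : P x -> P (- x) -> x = 0.
Proof.
move=> Px PNx; apply: contrapT => /eqP x0; apply: (coneN1 cP).
rewrite (_ : -1 = (- x) * x^-1); first exact: (coneM cP _ (coneV cP Px)).
by field.
Qed.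

Lemma span_cone_semi2 : (2 : K) != 0.
Proof.
apply/eqP => /eqP; rewrite (_ : 2 = 1 - (-1) :> K); last by rewrite opprK.
by rewrite subr_eq0 => /eqP E; apply: (coneN1 cP); rewrite -E; exact: (cone1 cP).
Qed.

End SpanCone.

(* The elements of the form [sum p_i g_i^2], with [p_i] in the cone and [g_i] in the field [G]. *)
Definition weighted_squares P (G : {pred K}) : set K :=
  fun x => exists s : seq (K * K),
    (forall u, u \in s -> P u.1 /\ u.2 \in G) /\ x = \sum_(u <- s) u.1 * u.2 ^+ 2.

(** The extension step of Artin and Schreier: the only obstruction to extending the order to [G] is
    that [-1] be a weighted sum of squares. Inverses come from [a^-1 = a (a^-1)^2]. *)
Lemma weighted_squares_cone P (G : divringClosed K) : is_cone P ->
  (forall a, P a -> a \in G) -> ~ weighted_squares P G (-1) ->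
  is_cone (weighted_squares P G).
Proof.
move=> cP PG N1; have mk p g : P p -> g \in G -> weighted_squares P G (p * g ^+ 2).
  move=> Pp Gg; exists [:: (p, g)]; rewrite big_seq1; split=> // u.
  by rewrite inE => /eqP ->.
have sub x : weighted_squares P G x -> x \in G.
  move=> [s [hs ->]]; rewrite big_seq; apply: rpred_sum => u us.
  by have [Pu Gu] := hs _ us; rewrite rpredM ?rpredX//; exact: PG.
have addw x y : weighted_squares P G x -> weighted_squares P G y ->
    weighted_squares P G (x + y).
  move=> [s [hs ->]] [t [ht ->]]; exists (s ++ t); rewrite big_cat; split=> // u.
  by rewrite mem_cat => /orP[/hs|/ht].
have zero : weighted_squares P G 0 by exists [::]; rewrite big_nil.
have mulw x y : weighted_squares P G x -> weighted_squares P G y ->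
    weighted_squares P G (x * y).
  move=> [s [hs ->]] [t [ht ->]]; rewrite mulr_suml big_seq.
  elim/big_ind: _ => // u us; rewrite mulr_sumr big_seq.
  elim/big_ind: _ => // v vt; have [Pu Gu] := hs _ us; have [Pv Gv] := ht _ vt.
  by rewrite mulrACA -exprMn; apply: (mk _ _); [exact: (coneM cP)|rewrite rpredM].
have sqw x : x \in G -> weighted_squares P G (x ^+ 2).
  by move=> Gx; rewrite -[_ ^+ 2]mul1r; apply: (mk _ _) => //; exact: (cone1 cP).
split=> //.
- by rewrite -[1](expr1n _ 2); apply: (sqw _); exact: rpred1.
- move=> a wa; have [->|a0] := eqVneq a 0; first by rewrite invr0.
  rewrite (_ : a^-1 = a * (a^-1) ^+ 2); last by field.
  by apply: (mulw _ _) => //; apply: (sqw _); rewrite rpredV; exact: sub.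
- by move=> a b wa wb; apply: (sqw _); rewrite rpredB//; exact: sub.
Qed.

End Cones.

Record max_cone (K : fieldType) := MaxCone {
  max_cone_set :> K -> Prop;
  max_cone_cone : is_cone max_cone_set;
  max_cone_max : forall P', is_cone P' -> (max_cone_set : set K) `<=` P' -> P' `<=` (max_cone_set : set K) }.

(** Adjoining [x] gives [C + C x], still inside the field [C - C]. If this is a cone, maximality
    puts [x] in [C]; otherwise [-1 = a + b x], and [- x = (1 + a) / b] lies in [C]. *)
Lemma max_cone_total (K : fieldType) (C : max_cone K) x :
  x \in span_cone C -> C x \/ C (- x).
Proof.
move=> Fx; have cC := max_cone_cone C.
have [Cx|nCx] := pselect (C x); [by left|right].
pose C' : set K := fun y => exists a b, [/\ C a, C b & y = a + b * x].
have C'0 a : C a -> C' a.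
  by move=> Ca; exists a, 0; rewrite mul0r addr0; split=> //; exact: (cone0 cC).
have C'x : C' x by exists 0, 1; rewrite mul1r add0r; split=> //; [exact: (cone0 cC)|exact: (cone1 cC)].
have C'sub y : C' y -> y \in span_cone C.
  move=> [a [b [Ca Cb ->]]].
  have [_ _ dv] := span_cone_divring cC.
  have [sp1 spB _] := span_cone_divring cC.
  have sp0 : 0 \in span_cone C by rewrite -(subrr 1); exact: spB.
  have spN z : z \in span_cone C -> - z \in span_cone C.
    by move=> zC; rewrite -sub0r; exact: spB.
  have spM u z : u \in span_cone C -> z \in span_cone C -> u * z \in span_cone C.
    move=> yC zC; rewrite -[z]invrK; apply: (dv) => //; rewrite -[_^-1]mul1r.
    by apply: (dv).
  rewrite -[b * x]opprK; apply: (spB); first exact: (cone_sub_span cC).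
  by apply: (spN); apply: (spM) => //; exact: (cone_sub_span cC).
have sqC y : C' y -> C (y ^+ 2) by move=> /C'sub; exact: span_cone_sqr.
have [C'N1|C'N1] := pselect (C' (-1)).
  have [a [b [Ca Cb E]]] := C'N1.
  have b0 : b != 0.
    apply/eqP => b0; move: E; rewrite b0 mul0r addr0 => E.
    by apply: (coneN1 cC); rewrite E.
  rewrite (_ : - x = (1 + a) * b^-1).
    apply: (coneM cC); last exact: (coneV cC).
    by apply: (coneD cC) => //; exact: (cone1 cC).
  apply: (mulIf b0); rewrite -mulrA mulVf // mulr1 mulNr mulrC.
  by rewrite -[b * x](addKr a) -E; ring.
exfalso; apply: nCx; apply: (max_cone_max (P' := C')) => //.
have C'M y z : C' y -> C' z -> C' (y * z).
  move=> [a [b [Ca Cb ->]]] [c [d [Cc Cd ->]]].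
  exists (a * c + b * d * x ^+ 2), (a * d + b * c); split.
  - apply: (coneD cC); first exact: (coneM cC).
    by apply: (coneM cC); [exact: (coneM cC)|exact: span_cone_sqr].
  - by apply: (coneD cC); exact: (coneM cC).
  - by ring.
split=> //.
- exact/C'0/(cone0 cC).
- exact/C'0/(cone1 cC).
- move=> y z [a [b [Ca Cb ->]]] [c [d [Cc Cd ->]]].
  by exists (a + c), (b + d); split; [exact: (coneD cC)..|ring].
- move=> y C'y; have [->|y0] := eqVneq y 0; first by rewrite invr0; exact/C'0/(cone0 cC).
  rewrite (_ : y^-1 = y * (y ^+ 2)^-1); last by field.
  by apply: (C'M) => //; apply/C'0/(coneV cC)/sqC.
- move=> y z /C'sub Fy /C'sub Fz; apply/C'0/(span_cone_sqr cC).
  by have [_ spB _] := span_cone_divring cC; exact: spB.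
Qed.

Section MaxConeField.
Variables (K : fieldType) (C : max_cone K).
Let cC := max_cone_cone C.

Definition mcfield_pred : {pred K} := span_cone C.

HB.instance Definition _ := GRing.isDivringClosed.Build K mcfield_pred (span_cone_divring cC).

Definition mcfield : Type := {x : K | x \in mcfield_pred}.
HB.instance Definition _ := SubChoice.on mcfield.
HB.instance Definition _ := [SubChoice_isSubIntegralDomain of mcfield by <:].
HB.instance Definition _ := [SubIntegralDomain_isSubField of mcfield by <:].

Definition mcle (x y : mcfield) := `[< C (val y - val x) >].
Definition mcnorm (x : mcfield) := if mcle 0 x then x else - x.

Lemma mcle0_add x y : mcle 0 x -> mcle 0 y -> mcle 0 (x + y).
Proof.
rewrite /mcle !rmorph0 !subr0 rmorphD => /asboolP ? /asboolP ?.
by apply/asboolP; exact: (coneD cC).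
Qed.

Lemma mcle0_mul x y : mcle 0 x -> mcle 0 y -> mcle 0 (x * y).
Proof.
rewrite /mcle !rmorph0 !subr0 rmorphM => /asboolP ? /asboolP ?.
by apply/asboolP; exact: (coneM cC).
Qed.

Lemma mcle0_anti x : mcle 0 x -> mcle x 0 -> x = 0.
Proof.
rewrite /mcle !rmorph0 !subr0 sub0r => /asboolP Cx /asboolP CNx.
by apply: val_inj; rewrite rmorph0; exact: (cone_anti cC).
Qed.

Lemma mcsub_ge0 x y : mcle 0 (y - x) = mcle x y.
Proof. by rewrite /mcle rmorph0 subr0 rmorphB. Qed.

Lemma mcle0_total x : mcle 0 x || mcle x 0.
Proof.
rewrite /mcle !rmorph0 !subr0 sub0r; apply/orP.
by case: (max_cone_total (valP x)) => ?; [left|right]; apply/asboolP.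
Qed.

Lemma mcnormN x : mcnorm (- x) = mcnorm x.
Proof.
have E : mcle 0 (- x) = mcle x 0 by rewrite /mcle rmorph0 rmorphN subr0 sub0r.
rewrite /mcnorm E opprK; have := mcle0_total x.
case: ifP; case: ifP => //= h1 h2 _.
by rewrite (mcle0_anti h1 h2) oppr0.
Qed.

Lemma mcge0_norm x : mcle 0 x -> mcnorm x = x.
Proof. by rewrite /mcnorm => ->. Qed.

HB.instance Definition _ := Num.IntegralDomain_isLeReal.Build mcfield
  mcle0_add mcle0_mul mcle0_anti mcsub_ge0 mcle0_total mcnormN mcge0_norm
  (fun x y => erefl).

Lemma mcfield_ge0 (x : mcfield) : (0 <= x) = `[< C (val x) >].
Proof. by rewrite -[LHS]/(mcle 0 x) /mcle rmorph0 subr0. Qed.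

Lemma mcfield_lift a : C a -> exists2 x : mcfield, val x = a & 0 <= x.
Proof.
move=> Ca; exists (exist _ a (cone_sub_span cC Ca)); first by [].
by rewrite mcfield_ge0; apply/asboolP.
Qed.

End MaxConeField.

(** Carries the closure proof as an argument, so that the structure attaches to a predicate built
    inside a proof. *)
Definition divring_pred (K : fieldType) (G : {pred K}) (_ : divring_closed G) : {pred K} := G.
HB.instance Definition _ (K : fieldType) (G : {pred K}) (HG : divring_closed G) :=
  GRing.isDivringClosed.Build K (divring_pred HG) HG.

Section RealClosed.
Variables (K : closedFieldType) (C : max_cone K).
Let cC := max_cone_cone C.
Local Notation F := (mcfield C).
Local Notation "p ^v" := (map_poly (val : F -> K) p) (at level 2, format "p ^v").

(* The element [-1] must be a weighted sum of squares in the proper extension [F(y)]. *)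
Lemma max_cone_irreducible (f : {poly F}) : irreducible_poly f -> (2 < size f)%N ->
  exists s : seq (F * {poly F}), (forall u, u \in s -> 0 <= u.1) /\
    f %| 1 + \sum_(u <- s) u.1 *: u.2 ^+ 2.
Proof.
move=> irf sf; have f0 : f != 0 by rewrite -size_poly_eq0 -lt0n (ltn_trans _ sf).
have /closed_rootP[y fy] : size f^v != 1%N by rewrite size_map_poly gtn_eqF// (ltn_trans _ sf).
have evM g h : (g * h)^v.[y] = g^v.[y] * h^v.[y] by rewrite rmorphM hornerM.
have evB g h : (g - h)^v.[y] = g^v.[y] - h^v.[y] by rewrite rmorphB hornerD hornerN.
have evD g h : (g + h)^v.[y] = g^v.[y] + h^v.[y] by rewrite rmorphD hornerD.
have ev1 : (1 : {poly F})^v.[y] = 1 by rewrite rmorph1 hornerC.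
have evf0 g : g^v.[y] = 0 -> f %| g.
  move=> gy; have [//|nfg] := boolP (f %| g).
  have := nfg; rewrite -irreducible_poly_coprime // => /Bezout_eq1_coprimepP[[u v] /= E].
  have : (u * f + v * g)^v.[y] = 1^v.[y] by rewrite E.
  rewrite evD !evM gy (eqP fy) !mulr0 addr0 ev1 => /eqP.
  by rewrite eq_sym oner_eq0.
pose G : {pred K} := fun z => `[< exists g : {poly F}, z = g^v.[y] >].
have Gdiv : divring_closed G.
  split.
  - by apply/asboolP; exists 1; rewrite ev1.
  - by move=> ? ? /asboolP[g ->] /asboolP[h ->]; apply/asboolP; exists (g - h); rewrite evB.
  - move=> ? ? /asboolP[g ->] /asboolP[h ->]; apply/asboolP.
    have [h0|h0] := eqVneq h^v.[y] 0.
      by exists 0; rewrite h0 invr0 mulr0 rmorph0 horner0.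
    have nfh : ~~ (f %| h).
      by apply: contra h0 => /dvdpP[q ->]; rewrite evM (eqP fy) mulr0.
    move: nfh; rewrite -irreducible_poly_coprime // => /Bezout_eq1_coprimepP[[u v] /= E].
    exists (g * v); rewrite evM; congr (_ * _); apply: (mulIf h0); rewrite mulVf//.
    have : (u * f + v * h)^v.[y] = 1^v.[y] by rewrite E.
    by rewrite evD !evM (eqP fy) !mulr0 add0r ev1.
have GC a : C a -> a \in divring_pred Gdiv.
  move=> Ca; apply/asboolP.
  have Fa : a \in mcfield_pred C by exact: (cone_sub_span cC).
  exists (Sub a Fa : F)%:P; by rewrite map_polyC hornerC.
have [[s [hs sE]]|N1] := pselect (weighted_squares C (divring_pred Gdiv) (-1)); last first.
  exfalso; have Yc := weighted_squares_cone cC GC N1.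
  have Gw z : z \in divring_pred Gdiv -> weighted_squares C (divring_pred Gdiv) (z ^+ 2).
    move=> Gz; exists [:: (1, z)]; rewrite big_seq1 mul1r; split=> // u.
    by rewrite inE => /eqP -> /=; split=> //; exact: (cone1 cC).
  have sub : (C : set K) `<=` weighted_squares C (divring_pred Gdiv).
    move=> a Ca; exists [:: (a, 1)]; rewrite big_seq1 expr1n mulr1; split=> // u.
    by rewrite inE => /eqP -> /=; rewrite rpred1.
  have sup := max_cone_max Yc sub.
  have Gy : y \in divring_pred Gdiv.
    by apply/asboolP; exists 'X; rewrite map_polyX hornerX.
  have c2 : (2 : K) != 0 := span_cone_semi2 cC.
  have Fy : y \in mcfield_pred C.
    (* By maximality the squares of [F(y)] already lie in [C], and [y] is a difference of two of
       them. So [y] lies in [F], against the degree of [f]. *)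
    apply/asboolP; exists (((y + 1) / 2) ^+ 2), (((y - 1) / 2) ^+ 2); split.
    - by apply/sup/Gw; rewrite rpred_div ?rpredD ?rpred1 ?rpred_nat.
    - by apply/sup/Gw; rewrite rpred_div ?rpredB ?rpred1 ?rpred_nat.
    - by field.
  have rf : root f (Sub y Fy : F).
    have := fy; rewrite -[y in root _ y]/(val (Sub y Fy : F)) /root horner_map => /eqP E.
    by apply/eqP; apply: val_inj; rewrite E rmorph0.
  have /irf : size ('X - (Sub y Fy : F)%:P) != 1%N by rewrite size_XsubC.
  move=> /(_ _)/eqp_size; rewrite dvdp_XsubCl => /(_ rf); rewrite size_XsubC => E.
  by move: sf; rewrite -E.
have {}hs u : exists v : F * {poly F}, u \in s -> [/\ 0 <= v.1, u.1 = val v.1 & u.2 = (v.2)^v.[y]].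
  have [us|] := boolP (u \in s); last by exists (0, 0).
  have [Cu /asboolP[g gE]] := hs _ us.
  by have [x xu x0] := mcfield_lift Cu; exists (x, g) => _; split.
have [w wP] := choice hs.
exists (map w s); split; first by move=> u /mapP[v /wP[? _ _] ->].
apply: (evf0); rewrite evD ev1 rmorph_sum big_map.
apply/eqP; rewrite addrC addr_eq0 sE; apply/eqP; rewrite [RHS]big_seq big_seq_cond.
rewrite horner_sum; apply: eq_big => [u|u]; first by rewrite andbT.
rewrite andbT => /wP[_ -> ->].
by rewrite -mul_polyC evM map_polyC hornerC rmorphXn horner_exp.
Qed.

End RealClosed.

Section SignChange.
Variable F : realFieldType.
Hypothesis irreducible_neg : forall f : {poly F}, irreducible_poly f -> (2 < size f)%N ->
  exists s : seq (F * {poly F}), (forall u, u \in s -> 0 <= u.1) /\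
    f %| 1 + \sum_(u <- s) u.1 *: u.2 ^+ 2.

(* If [f] is irreducible, then [1 + sum p g^2 = h f] with [h] of smaller degree; the left side is
   positive everywhere, so [h] changes sign where [f] does and has no root there. *)
Lemma sign_change_root n (f : {poly F}) (a b : F) : (size f <= n)%N -> a < b ->
  f.[a] * f.[b] < 0 -> exists2 x, a <= x <= b & root f x.
Proof.
elim: n f a b => [|n IHn] f a b.
  rewrite leqn0 size_poly_eq0 => /eqP -> _.
  by rewrite !horner0 mul0r ltxx.
move=> sf ab fab.
have s1 : (1 < size f)%N.
  rewrite ltnNge; apply/negP => /size1_polyC fE.
  by move: fab; rewrite fE !hornerC -expr2 ltNge sqr_ge0.
have [s2|s2] := leqP (size f) 2.
  have {s1 s2}sf2 : size f = 2 by apply/eqP; rewrite eqn_leq s2.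
  have [x rx] := poly2_root sf2.
  exists x => //.
  have /factor_theorem[q qE] := rx.
  have q0 : q != 0 by apply: contra_eq_neq sf2 => q0; rewrite qE q0 mul0r size_poly0.
  have qx : (size q <= 1)%N.
    by move: sf2; rewrite qE size_Mmonic ?monicXsubC// size_XsubC addn2 /= => -[->].
  move: fab; rewrite qE (size1_polyC qx) !hornerE.
  set c := q`_0 => fab.
  have {}fab : c ^+ 2 * ((a - x) * (b - x)) < 0.
    by apply: le_lt_trans fab; rewrite le_eqVlt; apply/orP; left; apply/eqP => /=; ring.
  have {}fab : (a - x) * (b - x) < 0.
    by rewrite ltNge; apply/negP => h; move: fab; rewrite ltNge mulr_ge0 ?sqr_ge0.
  apply/andP; split; rewrite leNgt; apply/negP => H; move: fab; rewrite ltNge => /negP; apply.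
    by rewrite mulr_ge0 ?subr_ge0 ?ltW// (lt_trans H).
  by rewrite mulr_le0 ?subr_le0 ?ltW// (lt_trans ab).
have [irf|] := pselect (irreducible_poly f).
  have [s [s_ge0 fs]] := irreducible_neg irf s2.
  (* Reduction modulo [f] bounds the degree of the sum by [2 (deg f - 1)], so that the cofactor of
     [f] has degree smaller than [f]. *)
  pose S := 1 + \sum_(u <- s) u.1 *: (u.2 %% f) ^+ 2.
  have /dvdpP[h hE] : f %| S.
    rewrite (_ : S = (1 + \sum_(u <- s) u.1 *: u.2 ^+ 2)
        - \sum_(u <- s) u.1 *: (u.2 ^+ 2 - (u.2 %% f) ^+ 2)); last first.
      rewrite /S -addrA -sumrB; congr (_ + _); apply: eq_bigr => u _.
      by rewrite -scalerBr subKr.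
    apply: dvdp_sub => //; apply: (big_ind (fun p => f %| p)) => //.
      by move=> p q; exact: dvdp_add.
    move=> u _; rewrite -mul_polyC; apply: dvdp_mull; rewrite subr_sqr; apply: dvdp_mulr.
    by rewrite {1}[u.2](divp_eq _ f) addrK dvdp_mull.
  have S_gt0 x : 0 < S.[x].
    rewrite hornerD hornerC horner_sum ltr_pwDl// big_seq sumr_ge0// => u us.
    by rewrite hornerZ horner_exp mulr_ge0 ?sqr_ge0 ?s_ge0.
  have f0 : f != 0 by rewrite -size_poly_gt0 (ltn_trans _ s1).
  have h0 : h != 0.
    by apply/eqP => h0; have := S_gt0 0; rewrite hE h0 mul0r horner0 ltxx.
  have hs : (size h < size f)%N.
    have : (size S <= (size f).-1.*2.-1)%N.
      apply: (leq_trans (size_polyD _ _)); rewrite geq_max size_poly1.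
      apply/andP; split; first by move: s2; case: (size f) => [|[|[|k]]]//=; rewrite doubleS.
      apply: (leq_trans (size_sum _ _ _)); apply/bigmax_leqP_seq => u _ _.
      apply: (leq_trans (size_scale_leq _ _)).
      apply: (leq_trans (size_poly_exp_leq _ _)).
      have : (size (u.2 %% f)%R <= (size f).-1)%N by rewrite -ltnS prednK ?ltn_modp// (ltn_trans _ s1).
      by move: s2 {s1}; move: (size _) (size _) => k l; rewrite -muln2; lia.
    by rewrite hE size_mul// -muln2; move: s2; move: (size f) (size h) => k l; lia.
  have [||x abx hx] := IHn h a b _ ab.
  - by rewrite -ltnS (leq_trans hs).
  - have := mulr_gt0 (S_gt0 a) (S_gt0 b); rewrite hE !hornerM.
    by move=> H; nra.
  - by have := S_gt0 x; rewrite hE hornerM (eqP hx) mul0r ltxx.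
move=> nirf.
have [q [q1 qf nqf]] : exists q : {poly F}, [/\ size q != 1%N, q %| f & ~~ (q %= f)].
  apply: contrapT => nex; apply: nirf; split=> // q q1 qf.
  by apply: contrapT => /negP nqf; apply: nex; exists q.
have /dvdpP[h hE] := qf.
have f0 : f != 0 by rewrite -size_poly_gt0 (ltn_trans _ s1).
have h0 : h != 0 by apply: contraNneq f0 => h0; rewrite hE h0 mul0r.
have q0 : q != 0 by apply: contraNneq f0 => q0; rewrite hE q0 mulr0.
have qs : (size q < size f)%N.
  by rewrite ltn_neqAle (dvdp_leq f0 qf) andbT dvdp_size_eqp.
have hs : (size h < size f)%N.
  rewrite hE size_mul//; move: q1 q0; rewrite -size_poly_gt0.
  by case: (size q) => [|[|k]]// _ _; rewrite !addnS /= ltnS leq_addr.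
(* Since [f = h q] changes sign between [a] and [b], one of its two factors does. *)
have [hab|hab] := ltP (h.[a] * h.[b]) 0.
  have [|x abx hx] := IHn h a b _ ab hab; first by rewrite -ltnS (leq_trans hs).
  by exists x => //; rewrite hE rootM hx.
have [||x abx qx] := IHn q a b _ ab.
- by rewrite -ltnS (leq_trans qs).
- by move: fab; rewrite hE !hornerM => H; nra.
- by exists x => //; rewrite hE rootM qx orbT.
Qed.

Lemma sign_change_real_closed : Num.real_closed_axiom F.
Proof.
move=> p a b ab /andP[pa pb].
have [pa0|pa0] := eqVneq p.[a] 0; first by exists a; rewrite ?lexx ?ab// /root pa0.
have [pb0|pb0] := eqVneq p.[b] 0; first by exists b; rewrite ?lexx ?ab// /root pb0.
apply: (@sign_change_root (size p)) => //.
  rewrite lt_neqAle ab andbT; apply/eqP => abE.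
  by move: pa0; rewrite eq_le pa abE pb.
by rewrite nmulr_rlt0 lt_neqAle ?pa ?pa0// eq_sym pb0 pb.
Qed.

End SignChange.

HB.instance Definition _ (K : closedFieldType) (C : max_cone K) :=
  Num.RealField_isClosed.Build (mcfield C)
    (sign_change_real_closed (@max_cone_irreducible K C)).

Theorem cone_real_closure (K : closedFieldType) (P0 : set K) : is_cone P0 ->
  exists (F : rcfType) (v : {rmorphism F -> K}),
    forall a, P0 a -> exists2 x : F, v x = a & 0 <= x.
Proof.
move=> /maximal_cone[P [P0P cP Pmax]].
pose C := MaxCone cP Pmax.
exists (mcfield C), (val : mcfield C -> K) => a /P0P Pa.
exact: (@mcfield_lift K C a Pa).
Qed.

(** * Transfer of sign conditions *)

(** Integer polynomials as syntax: the same term is evaluated in the star algebra, in a countable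
    ring, in two real closed fields and in univariate polynomials. Real constants are represented by
    variables. *)
Inductive rterm :=
  RVar of nat | ROne | ROpp of rterm | RAdd of rterm & rterm | RMul of rterm & rterm.

HB.instance Definition _ := gen_eqMixin rterm.

Fixpoint reval (A : nzRingType) (e : nat -> A) (t : rterm) : A :=
  match t with
  | RVar i => e i
  | ROne => 1
  | ROpp s => - reval e s
  | RAdd s1 s2 => reval e s1 + reval e s2
  | RMul s1 s2 => reval e s1 * reval e s2
  end.

Fixpoint rvars_lt (k : nat) (t : rterm) : bool :=
  match t with
  | RVar i => (i < k)%N
  | ROne => true
  | ROpp s => rvars_lt k s
  | RAdd s1 s2 | RMul s1 s2 => rvars_lt k s1 && rvars_lt k s2
  end.

Lemma reval_morph (A B : nzRingType) (f : {rmorphism A -> B}) (e : nat -> A) t :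
  f (reval e t) = reval (f \o e) t.
Proof.
elim: t => [i||s IH|s1 IH1 s2 IH2|s1 IH1 s2 IH2] //=; first exact: rmorph1.
- by rewrite rmorphN IH.
- by rewrite rmorphD IH1 IH2.
- by rewrite rmorphM IH1 IH2.
Qed.

Lemma eq_reval (A : nzRingType) k (e e' : nat -> A) t : rvars_lt k t ->
  (forall i, (i < k)%N -> e i = e' i) -> reval e t = reval e' t.
Proof.
move=> + H; elim: t => [i||s IH|s1 IH1 s2 IH2|s1 IH1 s2 IH2] //=.
- exact: H.
- by move=> /IH ->.
- by move=> /andP[/IH1 -> /IH2 ->].
- by move=> /andP[/IH1 -> /IH2 ->].
Qed.

(** The vector of Tarski queries is the vector of counts times a matrix that depends only on the
    number of polynomials and is invertible over the rationals. Equal queries therefore give equal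
    counts. *)
Lemma taq_constraints (F S : rcfType) (z : seq F) (z' : seq S) sq sq' :
  size sq' = size sq ->
  (forall sc, sc \in sg_tab (size sq) ->
    taq z' (poly_comb sq' sc) = taq z (poly_comb sq sc)) ->
  forall sc, sc \in sg_tab (size sq) -> constraints z' sq' sc = constraints z sq sc.
Proof.
move=> E H sc scin; have := tvec_cvec z' sq'; have := tvec_cvec z sq.
rewrite /tvec /cvec E; set n := size sq in scin *.
set M := \row_i _; set N := \row_i _; set M' := \row_i _; set N' := \row_i _.
have -> : M' = M.
  apply/rowP => i; rewrite !mxE.
  have [lt|ge] := ltnP i (size (sg_tab n)).
    by rewrite !(nth_map [::])// H// mem_nth.
  by rewrite !nth_default ?size_map// /taq !big1// => x _; rewrite horner0 sgz0.
move=> -> /(congr1 (map_mx (intr : int -> rat))); rewrite !map_mxM.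
move=> /(can_inj (mulmxK (ctmat_unit rat n))) NN'.
have iN : (index sc (sg_tab n) < 3 ^ n)%N by rewrite -size_sg_tab index_mem.
have := congr1 (fun A : 'rV_ _ => A 0 (Ordinal iN)) NN'.
by rewrite !mxE /= nth_index// => /intr_inj; rewrite !intz => -[].
Qed.

Lemma mem_sg_tab (s : seq int) : all (fun x => x \in [:: 1; -1; 0]) s -> s \in sg_tab (size s).
Proof.
elim: s => //= x s IH /andP[+ /IH ss]; rewrite !inE !mem_cat.
by move=> /or3P[] /eqP->; rewrite map_f ?orbT.
Qed.

Lemma constraints_gt0 (F : rcfType) (z : seq F) sq sc :
  (0 < constraints z sq sc)%N <->
  exists2 x, x \in z & forall i, (i < size sq)%N -> sgz (sq`_i).[x] = sc`_i.
Proof.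
rewrite /constraints lt0n sum_nat_seq_neq0; split.
  move=> /hasP[x xz /= h]; exists x => // i ilt; apply/eqP.
  move: h; rewrite -lt0n => /all_prodn_gt0 /(_ (Ordinal ilt)).
  by rewrite mem_index_enum lt0b => /(_ isT isT).
move=> [x xz h]; apply/hasP; exists x => //=.
by rewrite big1// => i _; rewrite h ?eqxx.
Qed.

(** * Stability of Tarski queries under a change of parameters *)

Section Tracking.
Variables (F S : rcfType) (u : nat -> F) (k : nat).

(* The sets containing all environments that give finitely many prescribed terms in the first [k]
   variables the same signs as [u] does. *)
Definition same_signs : set_system (nat -> S) := fun A =>
  exists2 l : seq rterm, all (rvars_lt k) l &
    forall v, (forall t, t \in l -> sgz (reval v t) = sgz (reval u t)) -> A v.

Global Instance same_signs_filter : Filter same_signs.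
Proof.
split.
- by exists [::].
- move=> A B [l wl Al] [m wm Bm]; exists (l ++ m); first by rewrite all_cat wl.
  by move=> v H; split; [apply: Al|apply: Bm] => t tl; apply: H; rewrite mem_cat tl ?orbT.
- by move=> A B AB [l wl Al]; exists l => // v /Al/AB.
Qed.

Lemma near_sgz_reval t : rvars_lt k t ->
  \forall v \near same_signs, sgz (reval v t) = sgz (reval u t).
Proof.
by move=> wt; exists [:: t] => [|v H] /=; [rewrite wt|apply: H; rewrite mem_head].
Qed.

(* [c' v] is the value at [v] of a fraction of terms whose value at [u] is [c]. *)
Definition tracks (c : F) (c' : (nat -> S) -> S) :=
  exists a b, [/\ rvars_lt k a, rvars_lt k b, reval u b != 0, c = reval u a / reval u b &
    \forall v \near same_signs, c' v = reval v a / reval v b].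

Lemma sgzV (R : realFieldType) (x : R) : sgz x^-1 = sgz x.
Proof.
case: (sgzP x) => x0; first by rewrite x0 invr0 sgz0.
  by rewrite gtr0_sgz ?invr_gt0.
by rewrite ltr0_sgz ?invr_lt0.
Qed.

Lemma near_neq0 t : rvars_lt k t -> reval u t != 0 ->
  \forall v \near same_signs, reval v t != 0.
Proof.
move=> wt t0; apply: filterS (near_sgz_reval wt) => v.
by apply: contra_eq_neq => ->; rewrite sgz0 eq_sym sgz_eq0.
Qed.

Lemma tracks_sgz c c' : tracks c c' -> \forall v \near same_signs, sgz (c' v) = sgz c.
Proof.
move=> [a [b [wa wb b0 -> H]]].
apply: filterS3 H (near_sgz_reval wa) (near_sgz_reval wb) => v -> av bv.
by rewrite !sgzM !sgzV av bv.
Qed.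

Lemma tracks_near c c1 c2 : tracks c c1 -> (\forall v \near same_signs, c2 v = c1 v) ->
  tracks c c2.
Proof.
move=> [a [b [wa wb b0 cE H]]] H2; exists a, b; split=> //.
by apply: filterS2 H H2 => v <- ->.
Qed.

Lemma tracks_reval t : rvars_lt k t -> tracks (reval u t) (fun v => reval v t).
Proof.
move=> wt; exists t, ROne; split; rewrite //= ?oner_neq0 ?divr1//.
by apply: nearW => v; rewrite divr1.
Qed.

Lemma tracks1 : tracks 1 (fun=> 1).
Proof. exact: (@tracks_reval ROne). Qed.

Lemma tracksN c c' : tracks c c' -> tracks (- c) (fun v => - c' v).
Proof.
move=> [a [b [wa wb b0 -> H]]]; exists (ROpp a), b; split; rewrite //= ?mulNr//.
by apply: filterS H => v ->; rewrite mulNr.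
Qed.

Lemma tracksM c d c' d' : tracks c c' -> tracks d d' -> tracks (c * d) (fun v => c' v * d' v).
Proof.
move=> [a [b [wa wb b0 -> H]]] [a2 [b2 [wa2 wb2 b20 -> H2]]].
exists (RMul a a2), (RMul b b2); split; rewrite /= ?wa ?wb ?mulf_neq0//.
  by rewrite invfM mulrACA.
by apply: filterS2 H H2 => v -> ->; rewrite invfM mulrACA.
Qed.

Lemma tracksD c d c' d' : tracks c c' -> tracks d d' -> tracks (c + d) (fun v => c' v + d' v).
Proof.
move=> [a [b [wa wb b0 -> H]]] [a2 [b2 [wa2 wb2 b20 -> H2]]].
exists (RAdd (RMul a b2) (RMul a2 b)), (RMul b b2).
split; rewrite /= ?wa ?wb ?wa2 ?wb2 ?mulf_neq0 ?addf_div//.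
apply: filterS3 (filterI H H2) (near_neq0 wb b0) (near_neq0 wb2 b20) => v.
by move=> [-> ->] bv b2v; rewrite addf_div.
Qed.

Lemma tracks0 : tracks 0 (fun=> 0).
Proof.
apply: (@tracks_near _ (fun=> 1 + - 1)); last by apply: nearW => v; rewrite subrr.
by rewrite -[0](subrr 1); apply: tracksD tracks1 (tracksN tracks1).
Qed.

Lemma tracksX c c' n : tracks c c' -> tracks (c ^+ n) (fun v => c' v ^+ n).
Proof.
move=> cc; elim: n => [|n IH]; first exact: tracks1.
rewrite exprS; apply: (tracks_near (tracksM cc IH)).
by apply: nearW => v; rewrite exprS.
Qed.

Lemma tracks_sum n (c : 'I_n -> F) c' : (forall i, tracks (c i) (c' i)) ->
  tracks (\sum_(i < n) c i) (fun v => \sum_(i < n) c' i v).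
Proof.
elim: n c c' => [|n IH] c c' H.
  rewrite big_ord0; apply: (tracks_near tracks0).
  by apply: nearW => v; rewrite big_ord0.
rewrite big_ord_recl; apply: (tracks_near (tracksD (H ord0) (IH _ _ (fun i => H _)))).
by apply: nearW => v; rewrite big_ord_recl.
Qed.

(** Equality of sizes makes all degree comparisons agree, so that algorithms on polynomials follow
    the same branches on both sides. *)
Definition ptracks (p : {poly F}) (p' : (nat -> S) -> {poly S}) :=
  (\forall v \near same_signs, size (p' v) = size p) /\
  forall i, tracks p`_i (fun v => (p' v)`_i).

Lemma eq_size_coef (R R' : nzRingType) n (p : {poly R}) (q : {poly R'}) :
  (size p <= n)%N -> (size q <= n)%N ->
  (forall i, (i < n)%N -> (p`_i == 0) = (q`_i == 0)) -> size p = size q.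
Proof.
move=> pn qn H.
have key (A B : nzRingType) (f : {poly A}) (g : {poly B}) : (size f <= n)%N ->
    (forall i, (i < n)%N -> (f`_i == 0) = (g`_i == 0)) -> (size f <= size g)%N.
  move=> fn fg; apply/leq_sizeP => j gj; have [jn|nj] := ltnP j n.
    by apply/eqP; rewrite fg// (leq_sizeP _ _ (leqnn (size g))).
  by rewrite nth_default// (leq_trans fn).
by apply/eqP; rewrite eqn_leq !key// => i /H.
Qed.

(** Whether a coefficient vanishes is a matter of its sign, and finitely many signs are controlled
    at once; a common bound on the sizes therefore forces their equality. *)
Lemma ptracks_mk (p : {poly F}) (p' : (nat -> S) -> {poly S}) n :
  (\forall v \near same_signs, (size (p' v) <= n)%N) ->
  (forall i, tracks p`_i (fun v => (p' v)`_i)) -> ptracks p p'.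
Proof.
move=> pn H; split=> //; pose m := maxn n (size p).
have : \forall v \near same_signs, forall i : 'I_m, sgz (p' v)`_i = sgz p`_i.
  by apply: filter_forall => i; exact: tracks_sgz.
apply: filterS2 pn => v pn Hv.
apply: (@eq_size_coef _ _ m) => [||i im]; rewrite ?leq_max ?pn ?leqnn ?orbT//.
by rewrite -sgz_eq0 (Hv (Ordinal im)) sgz_eq0.
Qed.

Lemma ptracks_near p p1 p2 : ptracks p p1 -> (\forall v \near same_signs, p2 v = p1 v) ->
  ptracks p p2.
Proof.
move=> [ps H] H2; split; first by apply: filterS2 ps H2 => v <- ->.
by move=> i; apply: (tracks_near (H i)); apply: filterS H2 => v ->.
Qed.

Lemma ptracks_lead p p' : ptracks p p' -> tracks (lead_coef p) (fun v => lead_coef (p' v)).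
Proof.
move=> [ps H]; apply: (tracks_near (H (size p).-1)).
by apply: filterS ps => v; rewrite lead_coefE => ->.
Qed.

Lemma ptracksC c c' : tracks c c' -> ptracks c%:P (fun v => (c' v)%:P).
Proof.
move=> H; apply: (@ptracks_mk _ _ 1%N).
  by apply: nearW => v; exact: size_polyC_leq1.
move=> i; rewrite coefC; case: (i =P 0%N) => [->|/eqP/negPf i0].
  by apply: (tracks_near H); apply: nearW => v; rewrite coefC.
by apply: (tracks_near tracks0); apply: nearW => v; rewrite coefC i0.
Qed.

Lemma ptracksXn n : ptracks 'X^n (fun=> 'X^n).
Proof.
apply: (@ptracks_mk _ _ n.+1); first by apply: nearW => v; rewrite size_polyXn.
move=> i; rewrite coefXn; case: (i =P n) => [->|/eqP/negPf i0].
  by apply: (tracks_near tracks1); apply: nearW => v; rewrite coefXn eqxx.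
by apply: (tracks_near tracks0); apply: nearW => v; rewrite coefXn i0.
Qed.

Lemma ptracksD p q p' q' : ptracks p p' -> ptracks q q' -> ptracks (p + q) (fun v => p' v + q' v).
Proof.
move=> [ps pc] [qs qc]; apply: (@ptracks_mk _ _ (maxn (size p) (size q))).
  by apply: filterS2 ps qs => v <- <-; exact: size_polyD.
move=> i; rewrite coefD; apply: (tracks_near (tracksD (pc i) (qc i))).
by apply: nearW => v; rewrite coefD.
Qed.

Lemma ptracksN p p' : ptracks p p' -> ptracks (- p) (fun v => - p' v).
Proof.
move=> [ps pc]; apply: (@ptracks_mk _ _ (size p)).
  by apply: filterS ps => v <-; rewrite size_polyN.
move=> i; rewrite coefN; apply: (tracks_near (tracksN (pc i))).
by apply: nearW => v; rewrite coefN.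
Qed.

Lemma ptracksM p q p' q' : ptracks p p' -> ptracks q q' -> ptracks (p * q) (fun v => p' v * q' v).
Proof.
move=> [ps pc] [qs qc]; apply: (@ptracks_mk _ _ (size p + size q).-1).
  by apply: filterS2 ps qs => v <- <-; exact: size_polyMleq.
move=> i; rewrite coefM.
apply: (tracks_near (tracks_sum (fun j : 'I_i.+1 => tracksM (pc j) (qc (i - j)%N)))).
by apply: nearW => v; rewrite coefM.
Qed.

Lemma ptracksZ c p c' p' : tracks c c' -> ptracks p p' -> ptracks (c *: p) (fun v => c' v *: p' v).
Proof.
move=> cc pp; rewrite -mul_polyC; apply: (ptracks_near (ptracksM (ptracksC cc) pp)).
by apply: nearW => v; rewrite mul_polyC.
Qed.

Lemma ptracks1 : ptracks 1 (fun=> 1).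
Proof. exact: (ptracksC tracks1). Qed.

Lemma ptracksX p p' n : ptracks p p' -> ptracks (p ^+ n) (fun v => p' v ^+ n).
Proof.
move=> cc; elim: n => [|n IH]; first exact: ptracks1.
rewrite exprS; apply: (ptracks_near (ptracksM cc IH)).
by apply: nearW => v; rewrite exprS.
Qed.

Lemma ptracks_deriv p p' : ptracks p p' -> ptracks p^`() (fun v => (p' v)^`()).
Proof.
move=> [ps pc]; apply: (@ptracks_mk _ _ (size p)).
  apply: filterS ps => v <-; have [->|p0] := eqVneq (p' v) 0; first by rewrite deriv0.
  exact/ltnW/lt_size_deriv.
move=> i; rewrite coef_deriv -mulr_natr.
have natP n : tracks n%:R (fun=> n%:R).
  elim: n => [|n IH]; first exact: tracks0.
  by rewrite -addn1 natrD; apply: (tracks_near (tracksD IH tracks1)); apply: nearW => v; rewrite natrD.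
apply: (tracks_near (tracksM (pc i.+1) (natP i.+1))).
by apply: nearW => v; rewrite coef_deriv mulr_natr.
Qed.

Lemma ptracks_prod (I : Type) (s : seq I) (p : I -> {poly F}) p' :
  (forall i, ptracks (p i) (p' i)) ->
  ptracks (\prod_(i <- s) p i) (fun v => \prod_(i <- s) p' i v).
Proof.
move=> H; elim: s => [|i s IH].
  by rewrite big_nil; apply: (ptracks_near ptracks1); apply: nearW => v; rewrite big_nil.
rewrite big_cons; apply: (ptracks_near (ptracksM (H i) IH)).
by apply: nearW => v; rewrite big_cons.
Qed.

(** Each step of the pseudo-division branches on a comparison of sizes, and tracked polynomials have
    equal sizes. The quotients [qq] and [qq'] are unrelated: [next_mod] uses the remainder and the
    exponent [rscalp]. *)
Lemma ptracks_redivp_rec n q q' m r (qq : {poly F}) r' (qq' : (nat -> S) -> {poly S}) :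
  ptracks q q' -> ptracks r r' ->
  (\forall v \near same_signs, (redivp_rec (q' v) m (qq' v) (r' v) n).1.1 =
     (redivp_rec q m qq r n).1.1) /\
  ptracks (redivp_rec q m qq r n).2 (fun v => (redivp_rec (q' v) m (qq' v) (r' v) n).2).
Proof.
move=> Hq; have [qs _] := Hq.
pose st (A : rcfType) (q r : {poly A}) := r * (lead_coef q)%:P - lead_coef r *: 'X^(size r - size q) * q.
have stP r1 r1' : ptracks r1 r1' -> ptracks (st _ q r1) (fun v => st _ (q' v) (r1' v)).
  move=> Hr; have [rs _] := Hr; apply: (ptracks_near (ptracksD (ptracksM Hr (ptracksC (ptracks_lead Hq)))
    (ptracksN (ptracksM (ptracksZ (ptracks_lead Hr) (ptracksXn (size r1 - size q))) Hq)))).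
  by apply: filterS2 qs rs => v; rewrite /st => -> ->.
elim: n m r qq r' qq' => [|n IH] m r qq r' qq' Hr; have [rs _] := Hr.
  have [lt|le] := ltnP (size r) (size q).
    have H : \forall v \near same_signs, redivp_rec (q' v) m (qq' v) (r' v) 0 = (m, qq' v, r' v).
      by apply: filterS2 qs rs => v; rewrite /= => -> ->; rewrite lt.
    have E : redivp_rec q m qq r 0 = (m, qq, r) by rewrite /= lt.
    rewrite E; split; first by apply: filterS H => v ->.
    by apply: (ptracks_near Hr); apply: filterS H => v ->.
  have H : \forall v \near same_signs, (redivp_rec (q' v) m (qq' v) (r' v) 0).1.1 = m.+1 /\
       (redivp_rec (q' v) m (qq' v) (r' v) 0).2 = st _ (q' v) (r' v).
    by apply: filterS2 qs rs => v; rewrite /st /= => -> ->; rewrite ltnNge le.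
  have [E1 E2] : (redivp_rec q m qq r 0).1.1 = m.+1 /\ (redivp_rec q m qq r 0).2 = st _ q r.
    by rewrite /= ltnNge le.
  rewrite E1 E2; split; first by apply: filterS H => v [].
  by apply: (ptracks_near (stP _ _ Hr)); apply: filterS H => v [].
have [lt|le] := ltnP (size r) (size q).
  have H : \forall v \near same_signs, redivp_rec (q' v) m (qq' v) (r' v) n.+1 = (m, qq' v, r' v).
    by apply: filterS2 qs rs => v; rewrite /= => -> ->; rewrite lt.
  have E : redivp_rec q m qq r n.+1 = (m, qq, r) by rewrite /= lt.
  rewrite E; split; first by apply: filterS H => v ->.
  by apply: (ptracks_near Hr); apply: filterS H => v ->.
pose qqs (A : rcfType) (q qq r : {poly A}) := qq * (lead_coef q)%:P + lead_coef r *: 'X^(size r - size q).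
have H : \forall v \near same_signs, redivp_rec (q' v) m (qq' v) (r' v) n.+1 =
     redivp_rec (q' v) m.+1 (qqs _ (q' v) (qq' v) (r' v)) (st _ (q' v) (r' v)) n.
  by apply: filterS2 qs rs => v; rewrite /st /qqs /= => -> ->; rewrite ltnNge le.
have := IH m.+1 (st _ q r) (qqs _ q qq r) _ (fun v => qqs _ (q' v) (qq' v) (r' v)) (stP _ _ Hr).
have -> : redivp_rec q m qq r n.+1 = redivp_rec q m.+1 (qqs _ q qq r) (st _ q r) n.
  by rewrite /= ltnNge le.
move=> [H1 H2]; split; first by apply: filterS2 H1 H => v <- ->.
by apply: (ptracks_near H2); apply: filterS H => v ->.
Qed.

Lemma ptracks_redivp p q p' q' : ptracks p p' -> ptracks q q' ->
  (\forall v \near same_signs, rscalp (p' v) (q' v) = rscalp p q) /\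
  ptracks (rmodp p q) (fun v => rmodp (p' v) (q' v)).
Proof.
move=> Hp Hq; have [ps _] := Hp; have [qs _] := Hq.
rewrite /rscalp /rmodp !unlock /redivp_expanded_def.
have E : \forall v \near same_signs, (q' v == 0) = (q == 0).
  by apply: filterS qs => v qs'; rewrite -!size_poly_eq0 qs'.
have [q0|q0] := boolP (q == 0).
  split; first by apply: filterS E => v ->; rewrite q0.
  by apply: (ptracks_near Hp); apply: filterS E => v ->; rewrite q0.
have [H1 H2] := @ptracks_redivp_rec (size p) q q' 0 p 0 p' (fun=> 0) Hq Hp; split.
  by apply: filterS3 H1 E ps => v <- -> ->; rewrite (negPf q0).
by apply: (ptracks_near H2); apply: filterS2 E ps => v -> ->; rewrite (negPf q0).
Qed.

Lemma ptracks_next_mod p q p' q' : ptracks p p' -> ptracks q q' ->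
  ptracks (next_mod p q) (fun v => next_mod (p' v) (q' v)).
Proof.
move=> Hp Hq; have [sc Hr] := ptracks_redivp Hp Hq.
have := ptracksZ (tracksN (tracksX (rscalp p q) (ptracks_lead Hq))) Hr.
move=> H; apply: (ptracks_near H).
by apply: filterS sc => v; rewrite /next_mod => ->.
Qed.

(** The signs at both infinities are given by the sign of the leading coefficient and the parity of
    the degree. *)
Lemma near_crossR p p' : ptracks p p' ->
  \forall v \near same_signs, crossR (p' v) = crossR p.
Proof.
move=> Hp; have [ps _] := Hp; apply: filterS2 ps (tracks_sgz (ptracks_lead Hp)) => v ps lp.
have E (A : rcfType) (x y : A) : variation x y = sgz y * (sgz x * sgz y < 0).
  by rewrite /variation -sgzM sgz_lt0.
rewrite /crossR !E /sgp_pinfty /sgp_minfty !sgz_sgr ps.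
by rewrite !sgzM !sgzX !sgzN !sgz1 lp.
Qed.

(** Induction along the signed remainder sequence: each step contributes the [crossR] of the product
    of two consecutive terms, and the size of the second term decreases. *)
Lemma near_changes_mods p q p' q' : ptracks p p' -> ptracks q q' ->
  \forall v \near same_signs, changes_mods (p' v) (q' v) = changes_mods p q.
Proof.
have [n] := ubnP (size q); elim: n p q p' q' => // n IH p q p' q' + Hp Hq.
rewrite ltnS => qn; have [q0|q0] := eqVneq q 0.
  have [qs _] := Hq; apply: filterS qs => v; rewrite q0 size_poly0 => /eqP.
  by rewrite size_poly_eq0 => /eqP ->; rewrite !changes_modsp0.
have lt : (size (next_mod p q) < n)%N.
  apply: leq_trans qn; rewrite /next_mod size_scale ?ltn_rmodp//.
  by rewrite oppr_eq0 expf_neq0// lead_coef_eq0.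
apply: filterS2 (near_crossR (ptracksM Hp Hq)) (IH _ _ _ _ lt Hq (ptracks_next_mod Hp Hq)) => v.
by rewrite [LHS in _ -> _ -> LHS = _]changes_mods_rec [RHS in _ -> _ -> _ = RHS]changes_mods_rec => -> ->.
Qed.

Lemma near_taqR p q p' q' : ptracks p p' -> ptracks q q' ->
  \forall v \near same_signs, taq (rootsR (p' v)) (q' v) = taq (rootsR p) q.
Proof.
move=> Hp Hq; apply: filterS (near_changes_mods Hp (ptracksM (ptracks_deriv Hp) Hq)) => v.
by rewrite !taq_taqR.
Qed.

Section OneVariable.
Variables (I : eqType) (l : seq I) (P : I -> {poly F}) (P' : I -> (nat -> S) -> {poly S}).
Hypothesis PP' : forall i, ptracks (P i) (P' i).

(** The number of roots of [b] at which the [P i] have the same signs as at [x] is positive, and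
    finitely many Tarski queries determine it. *)
Lemma near_signs_at_root b b' x : ptracks b b' -> b != 0 -> root b x ->
  \forall v \near same_signs, exists y, forall i, i \in l -> sgz (P' i v).[y] = sgz (P i).[x].
Proof.
move=> Hb b0 bx; pose sc := [seq sgz (P i).[x] | i <- l].
have scin : sc \in sg_tab (size (map P l)).
  rewrite size_map -(size_map (fun i => sgz (P i).[x])); apply: mem_sg_tab.
  by apply/allP => _ /mapP[i _ ->]; case: sgzP.
have taqs c : \forall v \near same_signs,
    taq (rootsR (b' v)) (poly_comb [seq P' i v | i <- l] c) = taq (rootsR b) (poly_comb (map P l) c).
  have H (A : rcfType) (Q : I -> {poly A}) : poly_comb (map Q l) c =
      \prod_(i < size l) nth 0 (map Q l) i ^+ comb_exp c`_i.
    by rewrite /poly_comb size_map.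
  apply: filterS (near_taqR (q := poly_comb (map P l) c) 
    (q' := fun v => poly_comb [seq P' i v | i <- l] c) Hb _).
    by [].
  rewrite H.
  have := @ptracks_prod 'I_(size l) (index_enum _) (fun i => nth 0 (map P l) i ^+ comb_exp c`_i)
    (fun i v => nth 0 [seq P' j v | j <- l] i ^+ comb_exp c`_i) _.
  move=> HH; apply: (ptracks_near (HH _)); last by apply: nearW => v; rewrite H.
  move=> i; apply: ptracksX.
  have x0 : I by case: (l) i => [[]|//].
  rewrite (nth_map x0)//; apply: (ptracks_near (PP' (nth x0 l i))).
  by apply: nearW => v; rewrite (nth_map x0).
have : \forall v \near same_signs, forall i : 'I_(size (sg_tab (size l))),
    let c := nth [::] (sg_tab (size l)) i in
    taq (rootsR (b' v)) (poly_comb [seq P' i v | i <- l] c) = taq (rootsR b) (poly_comb (map P l) c).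
  by apply: filter_forall => i; exact: taqs.
apply: filterS => v H.
have E : size [seq P' i v | i <- l] = size (map P l) by rewrite !size_map.
have /(_ _ sc scin) := @taq_constraints _ _ (rootsR b) (rootsR (b' v)) (map P l) _ E.
have xb : x \in rootsR b by rewrite -roots_on_rootsR.
move=> cE.
have : (0 < constraints (rootsR (b' v)) [seq P' i v | i <- l] sc)%N.
  rewrite cE; last first.
    move=> c cin; rewrite -(nth_index [::] cin).
    have ilt : (index c (sg_tab (size l)) < size (sg_tab (size l)))%N.
      by rewrite index_mem -(size_map P).
    have := H (Ordinal ilt); rewrite /= -[in X in X -> _](size_map P) .
    by [].
  apply/constraints_gt0; exists x => // i ilt; rewrite size_map in ilt.
  have x0 : I by case: (l) ilt => [|//].
  by rewrite !(nth_map x0).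
move=> /constraints_gt0[y _ yP]; exists y => i il.
have := yP (index i l); rewrite size_map index_mem => /(_ il).
by rewrite !(nth_map i) ?index_mem// !nth_index.
Qed.

(** If [x] is a root of a nonzero [P i], the previous lemma applies with [b = P i]. Otherwise every
    nonzero [P i] has a strict sign at [x], and multiplication by these signs leaves a system of
    strict positivity conditions. *)
Lemma near_signs x : 
  \forall v \near same_signs, exists y, forall i, i \in l -> sgz (P' i v).[y] = sgz (P i).[x].
Proof.
have [/hasP[i il /andP[Pi0 Pix]]|] := boolP (has (fun i => (P i != 0) && root (P i) x) l).
  exact: near_signs_at_root (PP' i) Pi0 Pix.
rewrite -all_predC => /allP nroot.
have near_all (J : eqType) (m : seq J) (A : J -> (nat -> S) -> Prop) :
    (forall j, j \in m -> \forall v \near same_signs, A j v) ->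
    \forall v \near same_signs, forall j, j \in m -> A j v.
  elim: m => [|j m IH] H; first exact: nearW.
  apply: filterS2 (H j (mem_head _ _)) (IH _) => [v Aj Am i|i im].
    by rewrite inE => /orP[/eqP ->|/Am].
  by apply: H; rewrite inE im orbT.
have zeros : \forall v \near same_signs, forall j, j \in l -> P j = 0 -> P' j v = 0.
  apply: near_all => j _; have [ps _] := PP' j.
  apply: filterS ps => v /= ps Pi0; apply/eqP; rewrite -size_poly_eq0 ps Pi0.
  by rewrite size_poly0.
pose l1 := [seq i <- l | P i != 0].
pose c i := (P i).[x].
have c0 i : i \in l1 -> c i != 0.
  by rewrite mem_filter => /andP[Pi0 /nroot] /=; rewrite negb_and Pi0.
pose q i := (sgz (c i))%:~R *: P i.
pose q' i v := (sgz (c i))%:~R *: P' i v.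
have qq' i : ptracks (q i) (q' i).
  apply: ptracksZ (PP' i); case: sgzP => _; [exact: tracks0|exact: tracks1|].
  exact: tracksN tracks1.
have ends (A : rcfType) (Q : I -> {poly A}) y : (forall j, j \in l -> P j = 0 -> Q j = 0) ->
    \big[andb/true]_(p <- [seq (sgz (c i))%:~R *: Q i | i <- l1]) (0 < p.[y]) ->
    forall i, i \in l -> sgz (Q i).[y] = sgz (P i).[x].
  move=> Q0 + i il; have [Pi0 _|Pi0] := eqVneq (P i) 0.
    by rewrite Q0// Pi0 !horner0 !sgz0.
  have il1 : i \in l1 by rewrite mem_filter Pi0.
  rewrite big_all => /allP /(_ _ (map_f _ il1)); rewrite hornerZ -/(c i).
  have c0i := c0 _ il1; case: sgzP => [cE|_|_]; first by rewrite -/(c i) cE eqxx in c0i.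
    by rewrite mulr1z mul1r => /gtr0_sgz.
  by rewrite mulrN1z mulN1r oppr_gt0 => /ltr0_sgz.
have qx : exists y, \big[andb/true]_(p <- map q l1) (0 < p.[y]).
  exists x; rewrite big_all; apply/allP => _ /mapP[i il1 ->].
  rewrite /q hornerZ -/(c i) -sgrEz -normrEsg normr_gt0; exact: c0.
have fromS : (\forall v \near same_signs,
    exists y, \big[andb/true]_(p <- [seq q' i v | i <- l1]) (0 < p.[y])) ->
    \forall v \near same_signs, exists y, forall i, i \in l -> sgz (P' i v).[y] = sgz (P i).[x].
  by apply: filterS2 zeros => v z0 [y yP]; exists y; exact: (ends _ (fun i => P' i v)).
have case1 : \big[andb/true]_(p <- map q l1) (0 < lead_coef p) ->
    \forall v \near same_signs, exists y, forall i, i \in l -> sgz (P' i v).[y] = sgz (P i).[x].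
  rewrite big_all => /allP H; apply: fromS.
  have : \forall v \near same_signs, forall i, i \in l1 -> sgz (lead_coef (q' i v)) = sgz (lead_coef (q i)).
    by apply: near_all => i _; exact: tracks_sgz (ptracks_lead (qq' i)).
  apply: filterS => v Hv; apply/bounding_polyP; constructor 1.
  rewrite big_all; apply/allP => _ /mapP[i il1 ->].
  by rewrite -sgz_gt0 Hv// sgz_gt0; apply: H; exact: map_f.
(* A solvable system of conditions [p > 0] has a solution near plus infinity, near minus infinity,
   or at a root of the derivative of the product, by Rolle between two roots. *)
have [||[x0 /andP[bx0 x0P]]] := (bounding_polyP (map q l1)).2 qx.
- exact: case1.
- rewrite big_all => /allP H; apply: fromS.
  have : \forall v \near same_signs, forall i, i \in l1 ->
      sgz (lead_coef (q' i v)) = sgz (lead_coef (q i)) /\ size (q' i v) = size (q i).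
    apply: near_all => i _; have [qs _] := qq' i.
    by apply: filterS2 (tracks_sgz (ptracks_lead (qq' i))) qs => v; split.
  apply: filterS => v Hv; apply/bounding_polyP; constructor 2.
  rewrite big_all; apply/allP => _ /mapP[i il1 ->].
  have [lE sE] := Hv _ il1; have := H _ (map_f q il1).
  by rewrite -sgz_gt0 sgzM -lE -sE !sgzX !sgzN !sgz1 => h; rewrite -sgz_gt0 sgzM sgzX sgzN sgz1.
have [b0|b0] := eqVneq (bounding_poly (map q l1)) 0; last first.
  have bb' : ptracks (bounding_poly (map q l1)) (fun v => bounding_poly [seq q' i v | i <- l1]).
    rewrite /bounding_poly big_map; apply: (ptracks_near (ptracks_deriv (ptracks_prod l1 qq'))).
    by apply: nearW => v; rewrite big_map.
  apply: filterS (near_signs_at_root bb' b0 bx0) => v [y yP].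
  exists y => i il; rewrite yP//.
  exact: (ends _ P).
(* If the derivative of the product is zero, the product is constant and so is each factor;
   positivity at [x0] is then positivity of the leading coefficients. *)
apply: case1; rewrite big_all; apply/allP => p pin.
move: x0P; rewrite big_all => /allP x0P.
have pr0 : \prod_(p <- map q l1) p != 0.
  rewrite prodf_seq_neq0; apply/allP => r /x0P; apply: contraTneq => ->.
  by rewrite horner0 ltxx.
have := b0; rewrite /bounding_poly => /eqP; rewrite -derivn1 -polyorder.derivn_poly0 => ple.
have : size (\prod_(p <- map q l1) p) == 1%N.
  by rewrite eqn_leq ple size_poly_gt0.
move=> /size_prod_eq1 /(_ _ pin) ps; have := x0P _ pin.
have /size1_polyC -> : (size p <= 1)%N by rewrite ps.
by rewrite hornerC lead_coefC.
Qed.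

End OneVariable.

(* A term as a polynomial in the variable of index [k], the other variables being evaluated. *)
Definition rpoly (A : nzRingType) (e : nat -> A) (t : rterm) : {poly A} :=
  reval (fun i => if i == k then 'X else (e i)%:P) t.

Definition renv_upd (A : Type) (e : nat -> A) (y : A) : nat -> A :=
  fun i => if i == k then y else e i.

Lemma horner_rpoly (A : comNzRingType) (e : nat -> A) t y :
  (rpoly e t).[y] = reval (renv_upd e y) t.
Proof.
rewrite -[LHS]/(horner_eval y _) (reval_morph (horner_eval y)).
congr (reval _ t); apply/funext => i; rewrite /= /renv_upd /horner_eval.
by case: eqP => _; rewrite ?hornerX ?hornerC.
Qed.

Lemma ptracks_rpoly t : rvars_lt k.+1 t -> ptracks (rpoly u t) (fun v => rpoly v t).
Proof.
rewrite /rpoly; elim: t => [i||s IH|s1 IH1 s2 IH2|s1 IH1 s2 IH2] /=.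
- rewrite ltnS leq_eqVlt; case: eqP => [_ _|_ /= ik]; first exact: (ptracksXn 1).
  by apply: ptracksC; exact: (@tracks_reval (RVar i)).
- by move=> _; exact: ptracks1.
- by move=> /IH; exact: ptracksN.
- by move=> /andP[/IH1 H1 /IH2 H2]; exact: ptracksD.
- by move=> /andP[/IH1 H1 /IH2 H2]; exact: ptracksM.
Qed.

Lemma near_extend l : all (rvars_lt k.+1) l ->
  \forall v \near same_signs, exists y, forall t, t \in l ->
    sgz (reval (renv_upd v y) t) = sgz (reval u t).
Proof.
(* [near_signs] wants every index to be tracked, so terms outside the allowed variables are replaced
   by a constant. *)
move=> /allP wl; pose t0 t := if rvars_lt k.+1 t then t else ROne.
have t0P t : rvars_lt k.+1 (t0 t) by rewrite /t0; case: ifP.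
have := @near_signs _ l (rpoly u \o t0) (fun t v => rpoly v (t0 t))
  (fun t => ptracks_rpoly (t0P t)) (u k).
apply: filterS => v [y yP]; exists y => t tl; have := yP _ tl.
rewrite /t0 /= wl// !horner_rpoly => ->; congr (sgz (reval _ t)).
by apply/funext => i; rewrite /renv_upd; case: eqP => [->|].
Qed.

End Tracking.

(** Elimination of one variable at a time: the induction hypothesis reduces [l] to finitely many
    terms [l2] in [k + 1] variables, and [near_extend] finds the variable of index [k]. *)
Lemma near_extends (F S : rcfType) (u : nat -> F) m : forall k l, all (rvars_lt (k + m)) l ->
  \forall v \near same_signs (S := S) u k, exists w : nat -> S,
    (forall i, (i < k)%N -> w i = v i) /\
    forall t, t \in l -> sgz (reval w t) = sgz (reval u t).
Proof.
elim: m => [|m IH] k l wl.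
  rewrite addn0 in wl; exists l => // v H; by exists v.
rewrite addnS -addSn in wl; have [l2 wl2 H2] := IH _ _ wl.
apply: filterS (near_extend S u wl2) => v [y yP].
have [w [wv wP]] := H2 _ yP; exists w; split=> // i ik.
by rewrite (wv _ (ltnW ik)) /renv_upd (ltn_eqF ik).
Qed.

(* Tarski's transfer principle, for systems of sign conditions with parameters. *)
Theorem sign_conditions_transfer (F S : rcfType) (u : nat -> F) (c : nat -> S) k m l :
  (forall t, rvars_lt k t -> sgz (reval c t) = sgz (reval u t)) ->
  all (rvars_lt (k + m)) l ->
  exists w : nat -> S, (forall i, (i < k)%N -> w i = c i) /\
    forall t, t \in l -> sgz (reval w t) = sgz (reval u t).
Proof.
move=> cu /(near_extends S u)[l2 /allP wl2 H]; apply: H => t /wl2; exact: cu.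
Qed.

(** * Maximal real ideals *)

Section PrimeQuotientField.
Variables (B : countComNzRingType) (J : {pred B}).
Hypotheses (J_ideal : idealr_closed J) (J_prime : prime_idealr_closed J).

Definition pideal : {pred B} := J.
HB.instance Definition _ := isIdealr.Build B pideal J_ideal.
HB.instance Definition _ := isPrimeIdealrClosed.Build B pideal J_prime.

Definition pquot : Type := {ideal_quot pideal}.
HB.instance Definition _ := GRing.ComNzRing.on pquot.

(** Inverses are chosen classically, to give the residue ring the integral domain structure on which
    [{fraction _}] is built. *)
Definition pquot_unit : {pred pquot} := fun x => `[< exists y, y * x == 1 >].
Definition pquot_inv (x : pquot) : pquot :=
  if pselect (exists y, y * x == 1) is left ex then xchoose ex else x.

Lemma pquot_mulVx : {in pquot_unit, left_inverse 1 pquot_inv *%R}.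
Proof.
move=> x /asboolP ux; rewrite /pquot_inv; case: pselect => // ex.
exact/eqP/(xchooseP ex).
Qed.

Lemma pquot_unitPl (x y : pquot) : y * x = 1 -> pquot_unit x.
Proof. by move=> yx; apply/asboolP; exists y; rewrite yx. Qed.

Lemma pquot_invr_out : {in [predC pquot_unit], pquot_inv =1 id}.
Proof. by move=> x /asboolP nu; rewrite /pquot_inv; case: pselect. Qed.

HB.instance Definition _ := GRing.ComNzRing_hasMulInverse.Build pquot
  pquot_mulVx pquot_unitPl pquot_invr_out.
HB.instance Definition _ := GRing.ComUnitRing_isIntegral.Build pquot
  (@Quotient.rquot_IdomainAxiom B pideal).

Definition pfield : Type := {fraction pquot}.
HB.instance Definition _ := GRing.Field.on pfield.

(** A fraction is coded by representatives in [B] of its numerator and denominator. This makes the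
    field countable, as [countable_algebraic_closure] requires. *)
Definition pfield_code (x : pfield) : B * B :=
  let r := frac (repr (x : {fraction pquot})) in
  (repr (r.1 : {ideal_quot pideal}), repr (r.2 : {ideal_quot pideal})).
Definition pfield_decode (c : B * B) : pfield :=
  \pi_({fraction pquot})%qT
    (Ratio (\pi_({ideal_quot pideal})%qT c.1 : pquot) (\pi_({ideal_quot pideal})%qT c.2)).

Lemma pfield_codeK : cancel pfield_code pfield_decode.
Proof.
move=> x; rewrite /pfield_decode /pfield_code /= !reprK.
rewrite -[RHS](reprK x); congr (\pi_({fraction pquot})%qT _).
case: (repr x) => -[n d] /= d0; rewrite /Ratio /insubd insubT.
exact: val_inj.
Qed.

HB.instance Definition _ := CanIsCountable pfield_codeK.

Definition pfield_inj : B -> pfield := fun b => tofrac (\pi_({ideal_quot pideal})%qT b : pquot).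

Lemma pfield_inj_zmod : zmod_morphism pfield_inj.
Proof.
move=> x y; rewrite /pfield_inj.
by rewrite (rmorphB (\pi_({ideal_quot pideal})%qT)) -(rmorphB (@tofrac pquot)).
Qed.

Lemma pfield_inj_monoid : monoid_morphism pfield_inj.
Proof.
rewrite /pfield_inj; split=> [|x y].
  by rewrite (rmorph1 (\pi_({ideal_quot pideal})%qT)) (rmorph1 (@tofrac pquot)).
by rewrite (rmorphM (\pi_({ideal_quot pideal})%qT)) -(rmorphM (@tofrac pquot)).
Qed.

HB.instance Definition _ := GRing.isZmodMorphism.Build B pfield pfield_inj pfield_inj_zmod.
HB.instance Definition _ := GRing.isMonoidMorphism.Build B pfield pfield_inj pfield_inj_monoid.

Lemma pfield_inj_eq0 b : (pfield_inj b == 0) = (b \in J).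
Proof.
rewrite /pfield_inj tofrac_eq0 -(rmorph0 (\pi_({ideal_quot pideal})%qT)).
by rewrite -[LHS]Quotient.idealrBE subr0.
Qed.

End PrimeQuotientField.

Lemma prime_quotient_closed_field (B : countComNzRingType) (J : {pred B}) :
  idealr_closed J -> prime_idealr_closed J ->
  exists (K : closedFieldType) (f : {rmorphism B -> K}), forall b, (f b == 0) = (b \in J).
Proof.
move=> J_ideal J_prime.
have [K [g _]] := countable_algebraic_closure (pfield J_ideal J_prime).
exists K, (g \o @pfield_inj _ _ J_ideal J_prime) => b.
by rewrite /= fmorph_eq0 pfield_inj_eq0.
Qed.

(* A set of "positive" elements, as for instance the sums of squares. *)
Record is_preorder (B : comNzRingType) (T : set B) : Prop := IsPreorder {
  preorderD : forall a b, T a -> T b -> T (a + b);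
  preorderM : forall a b, T a -> T b -> T (a * b);
  preorder_sqr : forall a, T (a ^+ 2) }.

(** When [T] is the set of sums of squares, these are the usual real ideals. *)
Record is_real_ideal (B : comNzRingType) (T J : set B) : Prop := IsRealIdeal {
  real_ideal0 : J 0;
  real_idealD : forall a b, J a -> J b -> J (a + b);
  real_idealM : forall a b, J b -> J (a * b);
  real_idealP : forall a s, T s -> J (a ^+ 2 + s) -> J a }.

(** Primality comes from the colon ideals [J : c], which are again real. If [a b] is in [J] and
    neither factor is, then [J : b] contains [a], so by maximality it contains [q]; next [J : q]
    contains [b], so it contains [q]. Thus [q^2], hence [q], would be in [J]. *)
Lemma maximal_real_ideal (B : comNzRingType) (T J0 : set B) (q : B) :
  is_preorder T -> is_real_ideal T J0 -> ~ J0 q ->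
  exists J, [/\ J0 `<=` J, is_real_ideal T J, ~ J q & forall a b, J (a * b) -> J a \/ J b].
Proof.
move=> Tpre J0real J0q.
pose good X := X = set0 \/ [/\ J0 `<=` X, is_real_ideal T X & ~ X q].
have [F Fgood Ftot|J [[JE|[J0J Jreal Jq]] Jmax]] := @Zorn_bigcup _ good.
- have [[X FX J0X]|noX] := pselect (exists2 X, F X & J0 `<=` X); last first.
    left; apply/seteqP; split=> // x [X FX Xx]; exfalso.
    by case: (Fgood _ FX) => [X0|[? ? ?]]; [rewrite X0 in Xx | apply: noX; exists X].
  have cl (Y : set B) y : F Y -> Y y -> is_real_ideal T Y /\ ~ Y q.
    by move=> FY Yy; case: (Fgood _ FY) => [Y0|[]//]; rewrite Y0 in Yy.
  right; split; first by move=> x /J0X Xx; exists X.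
  + split.
    * by exists X => //; apply/J0X/(real_ideal0 J0real).
    * move=> a b [Y FY Ya] [Z FZ Zb]; case: (Ftot _ _ FY FZ) => s.
        by exists Z => //; apply: (real_idealD (cl _ _ FZ Zb).1) => //; exact: s.
      by exists Y => //; apply: (real_idealD (cl _ _ FY Ya).1) => //; exact: s.
    * by move=> a b [Y FY Yb]; exists Y => //; exact: (real_idealM (cl _ _ FY Yb).1).
    * by move=> a s Ts [Y FY Ya]; exists Y => //; exact: (real_idealP (cl _ _ FY Ya).1 Ts).
  + by move=> [Y FY Yq]; case: (cl _ _ FY Yq).
- exfalso; apply: (Jmax J0); last by right; split.
  by rewrite JE; split=> // sub0; exact: (sub0 0 (real_ideal0 J0real)).
- exists J; split=> // a b Jab.
  have colon c : (exists2 d, ~ J d & J (d * c)) -> J (q * c).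
    move=> [d Jd Jdc]; apply: contrapT => Jqc.
    apply: (Jmax [set x | J (x * c)]).
      split; first by move=> x Jx /=; rewrite mulrC; exact: (real_idealM Jreal).
      by move=> /(_ d Jdc).
    right; split=> //.
      by move=> x /J0J Jx /=; rewrite mulrC; exact: (real_idealM Jreal).
    split=> /=.
    + by rewrite mul0r; exact: (real_ideal0 Jreal).
    + by move=> x y Jx Jy; rewrite mulrDl; exact: (real_idealD Jreal).
    + by move=> x y Jy; rewrite -mulrA; exact: (real_idealM Jreal).
    + move=> x s Ts Jxs; apply: (real_idealP Jreal (s := s * c ^+ 2)).
        by apply: (preorderM Tpre) => //; exact: (preorder_sqr Tpre).
      rewrite (_ : _ + _ = c * ((x ^+ 2 + s) * c)); last by ring.
      exact: (real_idealM Jreal).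
  have [Ja|Ja] := pselect (J a); [by left|right].
  apply: contrapT => Jb; apply: Jq.
  have Jqb : J (q * b) by apply: colon; exists a.
  have Jqq : J (q * q) by apply: colon; exists b => //; rewrite mulrC.
  apply: (real_idealP Jreal (s := 0)); last by rewrite addr0 expr2.
  by rewrite -[0](expr0n _ 2); exact: (preorder_sqr Tpre).
Qed.

(** In the algebraic closure of the residue field of a maximal [J], the quotients [s / b^2] with [s]
    in [T] and [b] outside [J] form a cone: [-1 = s / b^2] would put [b^2 + s], hence [b], in
    [J]. *)
Lemma real_ideal_real_closed (B : countComNzRingType) (T J0 : set B) (q : B) :
  is_preorder T -> is_real_ideal T J0 -> ~ J0 q ->
  exists (F : rcfType) (f : {rmorphism B -> F}),
    [/\ forall b, J0 b -> f b = 0, f q != 0 & forall b, T b -> 0 <= f b].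
Proof.
move=> Tpre /(maximal_real_ideal Tpre)/[apply]-[J [J0J Jreal Jq Jprime]].
pose Jp : {pred B} := fun x => `[< J x >].
have J1 : ~ J 1 by move=> J1; apply: Jq; rewrite -[q]mulr1; exact: (real_idealM Jreal).
have Jid : idealr_closed Jp.
  split; [by apply/asboolP; exact: (real_ideal0 Jreal)|by apply/asboolP|].
  move=> a u v /asboolP Ju /asboolP Jv; apply/asboolP.
  by apply: (real_idealD Jreal) => //; exact: (real_idealM Jreal).
have Jpr : prime_idealr_closed Jp.
  by move=> a b /asboolP /Jprime[] ?; apply/orP; [left|right]; apply/asboolP.
have [K [g g0]] := prime_quotient_closed_field Jid Jpr.
have gJ b : J b <-> g b = 0.
  by split=> [Jb|/eqP]; [apply/eqP|]; rewrite g0; [apply/asboolP|move/asboolP].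
pose P0 : set K := fun x => exists s b, [/\ T s, ~ J b & x = g s / g b ^+ 2].
have T0 : T 0 by rewrite -[0](expr0n _ 2); exact: (preorder_sqr Tpre).
have T1 : T 1 by rewrite -[1](expr1n _ 2); exact: (preorder_sqr Tpre).
have nz b : ~ J b -> g b != 0 by move=> Jb; apply/eqP => /gJ.
have JM b c : ~ J b -> ~ J c -> ~ J (b * c) by move=> nb nc /Jprime[].
have sqP t b : ~ J b -> P0 ((g t / g b) ^+ 2).
  move=> Jb; exists (t ^+ 2), b; split=> //; first exact: (preorder_sqr Tpre).
  by rewrite rmorphXn expr_div_n.
have cP0 : is_cone P0.
  split.
  - by exists 0, 1; rewrite rmorph0 mul0r.
  - by exists 1, 1; rewrite rmorph1 expr1n divr1.
  - move=> _ _ [s [b [Ts Jb ->]]] [t [c [Tt Jc ->]]].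
    exists (s * c ^+ 2 + t * b ^+ 2), (b * c); split; [|exact: JM|].
      by apply: (preorderD Tpre); apply: (preorderM Tpre) => //; exact: (preorder_sqr Tpre).
    have b0 := nz _ Jb; have c0 := nz _ Jc.
    by rewrite rmorphD !rmorphM; field; rewrite b0 ?c0 ?s0.
  - move=> _ _ [s [b [Ts Jb ->]]] [t [c [Tt Jc ->]]].
    exists (s * t), (b * c); split; [exact: (preorderM Tpre)|exact: JM|].
    have b0 := nz _ Jb; have c0 := nz _ Jc.
    by rewrite !rmorphM; field; rewrite b0 ?c0 ?s0.
  - move=> _ [s [b [Ts Jb ->]]]; have b0 := nz _ Jb.
    have [/gJ gs|Js] := pselect (J s).
      by exists 0, 1; rewrite gs rmorph0 !mul0r invr0.
    exists (s * b ^+ 2), s; split=> //.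
      by apply: (preorderM Tpre) => //; exact: (preorder_sqr Tpre).
    by rewrite rmorphM rmorphXn; have s0 := nz _ Js; field; rewrite b0 ?c0 ?s0.
  - move=> _ _ [s [b [Ts Jb ->]]] [t [c [Tt Jc ->]]].
    rewrite (_ : _ - _ = g (s * c ^+ 2 - t * b ^+ 2) / g (b ^+ 2 * c ^+ 2)).
      by apply: (sqP); apply: (JM); rewrite expr2; exact: (JM).
    have b0 := nz _ Jb; have c0 := nz _ Jc.
    by rewrite rmorphB !rmorphM; field; rewrite b0 ?c0 ?s0.
  - move=> [s [b [Ts Jb E]]]; have b0 := nz _ Jb.
    apply: Jb; apply: (real_idealP Jreal Ts); apply/gJ.
    rewrite rmorphD rmorphXn; apply/eqP; rewrite addrC addr_eq0; apply/eqP.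
    by rewrite -mulN1r E mulrVK// unitfE expf_neq0.
have [F [v vP]] := cone_real_closure cP0.
have two : (4 : K) != 0.
  by rewrite (_ : 4 = 2 ^+ 2 :> K) ?expf_neq0 ?(span_cone_semi2 cP0)//; ring.
(* Only the cone is known to come from [F]; the identity [4 b = (b + 1)^2 - (b - 1)^2] brings the
   image of all of [B] into it. *)
have lift b : exists x : F, v x = g b.
  have h t : P0 (g t ^+ 2) by have := @sqP t 1 J1; rewrite rmorph1 divr1.
  have [x vx _] := vP _ (h (b + 1)); have [y vy _] := vP _ (h (b - 1)).
  exists ((x - y) / 4); rewrite fmorph_div rmorphB vx vy rmorph_nat.
  by rewrite rmorphD rmorphB rmorph1; field.
have [f fP] := choice lift.
have vI : injective v := fmorph_inj v.
have fz : zmod_morphism f by move=> x y; apply: vI; rewrite rmorphB !fP rmorphB.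
have fm : monoid_morphism f.
  by split=> [|x y]; apply: vI; rewrite ?rmorph1 ?rmorphM !fP ?rmorph1 ?rmorphM.
pose fr : {rmorphism B -> F} := HB.pack f (GRing.isZmodMorphism.Build _ _ f fz)
  (GRing.isMonoidMorphism.Build _ _ f fm).
exists F, fr; split.
- by move=> b /J0J/gJ gb; apply: vI; rewrite /= fP gb rmorph0.
- by rewrite -(fmorph_eq0 v) /= fP; exact: nz.
- move=> b Tb; have [|x vx x0] := vP (g b).
    by exists b, 1; rewrite rmorph1 expr1n divr1.
  by rewrite (_ : fr b = x)//; apply: vI; rewrite /= fP.
Qed.

(** * Limits of moment functionals *)

Section RegularizedContent.
Context {R : realType} {T : ptopologicalType}.
Hypotheses (T_regular : @regular_space T) (T_hausdorff : hausdorff_space T).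
Local Notation borel := (g_sigma_algebraType (@open T)).

Variable m : set T -> R.
Hypothesis m_ge0 : forall A, 0 <= m A.
Hypothesis m0 : m set0 = 0.
Hypothesis mU : forall A B : set borel, measurable A -> measurable B -> A `&` B = set0 ->
  m (A `|` B) = m A + m B.

Lemma borel_open (A : set T) : open A -> measurable (A : set borel).
Proof. by move=> oA; exact: sub_sigma_algebra. Qed.

Lemma borel_closed (A : set T) : closed A -> measurable (A : set borel).
Proof. by move=> cA; rewrite -[A]setCK; apply: measurableC; apply: borel_open; exact: closed_openC. Qed.

Lemma borel_compact (A : set T) : compact A -> measurable (A : set borel).
Proof. by move=> /(compact_closed T_hausdorff); exact: borel_closed. Qed.

Lemma content_le (A B : set borel) : measurable A -> measurable B -> A `<=` B -> m A <= m B.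
Proof.
move=> mA mB AB; have -> : B = A `|` (B `\` A) by rewrite setDUK.
rewrite mU ?lerDl ?m_ge0//; first exact: measurableD.
by rewrite setIDA setIC -setIDA setDv setI0.
Qed.

Lemma content_leU (A B : set borel) : measurable A -> measurable B -> m (A `|` B) <= m A + m B.
Proof.
move=> mA mB; have -> : A `|` B = A `|` (B `\` A) by rewrite setUDr setDv setD0.
rewrite mU//; last first.
- by rewrite setIDA setIC -setIDA setDv setI0.
- exact: measurableD.
rewrite lerD2l; apply: content_le; [exact: measurableD|by []|exact: subDsetl].
Qed.

Lemma content_le_bigsetU (I : Type) (s : seq I) (F : I -> set borel) :
  (forall i, measurable (F i)) -> m (\big[setU/set0]_(i <- s) F i) <= \sum_(i <- s) m (F i).
Proof.
move=> mF; elim: s => [|i s IH]; first by rewrite !big_nil m0.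
rewrite !big_cons (le_trans (content_leU _ _))//; first exact: bigsetU_measurable.
by rewrite lerD2l.
Qed.

(** Compact sets from inside for open sets, then open sets from outside for all sets: the classical
    passage from a content to a regular measure. *)
Definition inner_content (A : set T) : \bar R :=
  ereal_sup [set (m K)%:E | K in [set K | compact K /\ K `<=` A]].

Definition outer_content (A : set T) : \bar R :=
  ereal_inf [set inner_content O | O in [set O | open O /\ A `<=` O]].

Local Open Scope ereal_scope.

Lemma inner_content_ub (A K : set T) : compact K -> K `<=` A -> (m K)%:E <= inner_content A.
Proof. by move=> cK KA; apply: ereal_sup_ubound; exists K. Qed.

Lemma inner_content_ge0 A : 0 <= inner_content A.
Proof. by rewrite -[0]/(0%R%:E) -m0 inner_content_ub//; exact: compact0. Qed.

Lemma inner_content_le (A B : set T) : A `<=` B -> inner_content A <= inner_content B.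
Proof.
move=> AB; apply: ge_ereal_sup => _ [K [cK KA] <-].
by apply: inner_content_ub => //; exact: subset_trans AB.
Qed.

Lemma inner_content_open (O : set T) : open O -> inner_content O <= (m O)%:E.
Proof.
move=> oO; apply: ge_ereal_sup => _ [K [cK KO] <-]; rewrite lee_fin.
by apply: content_le => //; [exact: borel_compact|exact: borel_open].
Qed.

(** By regularity, each point of a compact [K] in the union has a neighbourhood whose closure stays
    in one [F i]. A finite subcover cuts [K] into compact pieces [C i] of [F i], for which finite
    subadditivity of [m] suffices. *)
Lemma inner_content_bigcup (F : (set T)^nat) : (forall i, open (F i)) ->
  inner_content (\bigcup_i F i) <= \sum_(i <oo) inner_content (F i).
Proof.
move=> oF; apply: ge_ereal_sup => _ [K [cK KF] <-].
have nb x : exists iU : nat * set T, K x -> [/\ open iU.2, iU.2 x & closure iU.2 `<=` F iU.1].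
  have [Kx|nKx] := pselect (K x); last by exists (0%N, set0).
  have [i _ Fix] := KF _ Kx.
  have [B nB BF] : filter_from (nbhs x) closure (F i).
    by apply: T_regular; apply: open_nbhs_nbhs; split.
  move: nB; rewrite nbhsE => -[U [oU Ux] UB].
  exists (i, U) => _; split=> //=.
  by apply: subset_trans BF; exact: closure_subset.
have [g gP] := choice nb.
have : cover_compact K by rewrite -compact_cover.
move=> /(_ T K (fun x => (g x).2)) []; first by move=> x /gP[].
  by move=> x Kx; exists x => //; have [] := gP _ Kx.
move=> D DK Kcov.
pose C i := K `&` \bigcup_(x in [set x | x \in D /\ (g x).1 = i]) closure (g x).2.
have finD (i : nat) : finite_set [set x | x \in D /\ (g x).1 = i].
  by apply: (sub_finite_set _ (finite_fset D)) => x [].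
have cC i : compact (C i).
  by apply: compact_closedI => //; apply: closed_bigcup => // x _; exact: closed_closure.
have CF i : C i `<=` F i.
  move=> y [_ [x [xD <-] xy]]; have Kx : K x by move: (DK _ xD); rewrite inE.
  by have [_ _] := gP _ Kx; exact.
pose N := (\max_(x <- D) (g x).1).+1.
have KC : K `<=` \big[setU/set0]_(i < N) C i.
  move=> y Ky; have [x xD gy] := Kcov _ Ky.
  have xN : ((g x).1 < N)%N by rewrite ltnS; apply: leq_bigmax_seq.
  rewrite -bigcup_mkord; exists (g x).1 => //=; split=> //; exists x => //.
  exact: subset_closure.
have mC i : measurable (C i : set borel) by exact: borel_compact.
apply: (@le_trans _ _ (\sum_(i < N) inner_content (F i))).
  apply: (@le_trans _ _ (\sum_(i < N) (m (C i))%:E)); last first.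
    by apply: lee_sum => i _; exact: inner_content_ub.
  rewrite sumEFin lee_fin (le_trans _ (content_le_bigsetU _ _))//.
  apply: content_le => //; [exact: borel_compact|exact: bigsetU_measurable].
rewrite -(big_mkord xpredT (fun i => inner_content (F i))).
by apply: nneseries_lim_ge => i _ _; exact: inner_content_ge0.
Qed.

Lemma outer_content_open (O : set T) : open O -> outer_content O = inner_content O.
Proof.
move=> oO; apply/eqP; rewrite eq_le; apply/andP; split.
  by apply: ereal_inf_lbound; exists O => //; split.
by apply: le_ereal_inf_tmp => _ [U [oU OU] <-]; exact: inner_content_le.
Qed.

Lemma outer_content0 : outer_content set0 = 0.
Proof.
rewrite outer_content_open; last exact: open0.
apply/eqP; rewrite eq_le inner_content_ge0 andbT.
by apply: (le_trans (inner_content_open open0)); rewrite m0.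
Qed.

Lemma outer_content_ge0 A : 0 <= outer_content A.
Proof. by apply: le_ereal_inf_tmp => _ [U _ <-]; exact: inner_content_ge0. Qed.

Lemma outer_content_le : {homo outer_content : A B / A `<=` B >-> A <= B}.
Proof.
move=> A B AB; apply: ereal_inf_le_tmp => _ [U [oU BO] <-].
by exists U => //; split=> //; exact: subset_trans BO.
Qed.

Lemma outer_content_fin A : outer_content A \is a fin_num.
Proof.
rewrite ge0_fin_numE ?outer_content_ge0//.
apply: (@le_lt_trans _ _ (m setT)%:E); last exact: ltry.
apply: (@le_trans _ _ (outer_content setT)); first exact: outer_content_le.
by rewrite outer_content_open; [apply: inner_content_open|]; exact: openT.
Qed.

Lemma outer_content_approx A (e : R) : (0 < e)%R ->
  exists O, [/\ open O, A `<=` O & inner_content O <= outer_content A + e%:E].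
Proof.
move=> e0; have [_ [U [oU AO] <-] h] := lb_ereal_inf_adherent e0 (outer_content_fin A).
by exists U; split=> //; exact: ltW.
Qed.

Lemma inner_content_approx O (e : R) : (0 < e)%R -> open O ->
  exists K, [/\ compact K, K `<=` O & inner_content O <= (m K)%:E + e%:E].
Proof.
move=> e0 oO; have fO : inner_content O \is a fin_num.
  by rewrite -outer_content_open//; exact: outer_content_fin.
have [_ [K [cK KO] <-] h] := ub_ereal_sup_adherent e0 fO.
by exists K; split=> //; rewrite -leeBlDr//; exact: ltW.
Qed.

Lemma outer_content_sigma_subadditive : sigma_subadditive outer_content.
Proof.
move=> F; apply/lee_addgt0Pr => e e0.
have e2 i : (0 < e / (2 ^ i.+1)%:R)%R by rewrite divr_gt0// ltr0n expn_gt0.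
have [V VP] := choice (fun i => outer_content_approx (F i) (e2 i)).
have oV i : open (V i) by have [] := VP i.
apply: (@le_trans _ _ (inner_content (\bigcup_i V i))).
  apply: ereal_inf_lbound; exists (\bigcup_i V i) => //; split.
    by apply: bigcup_open => i _.
  by move=> x [i _ Fx]; exists i => //; have [_ + _] := VP i; apply.
apply: (le_trans (inner_content_bigcup oV)).
apply: le_trans (epsilon_trick xpredT _ _); [|by move=> n; exact: outer_content_ge0|exact: ltW].
apply: lee_nneseries => i _ *; first exact: inner_content_ge0.
by have [_ _] := VP i.
Qed.

HB.instance Definition _ := isOuterMeasure.Build R T outer_content
  outer_content0 outer_content_ge0 outer_content_le outer_content_sigma_subadditive.

(** Up to [e / 3] each, choose an open [G] around [X], a compact [K] in [G] and [O], then a compact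
    [L] in the open set [G \ K], which contains [X \ O]. As [K] and [L] are disjoint, additivity of
    [m] bounds [m K + m L] by the content of [G]. *)
Lemma caratheodory_open (O : set T) : open O -> caratheodory_measurable outer_content O.
Proof.
move=> oO; apply: le_caratheodory_measurable => X.
apply/lee_addgt0Pr => e e0; have e3 : (0 < e / 3)%R by lra.
have [G [oG XG hG]] := outer_content_approx X e3.
have [K [cK KGO hK]] := inner_content_approx e3 (openI oG oO).
have oGK : open (G `\` K).
  by rewrite setDE; apply: openI => //; apply: closed_openC; exact: (compact_closed T_hausdorff).
have [L [cL LGK hL]] := inner_content_approx e3 oGK.
have h1 : outer_content (X `&` O) <= (m K)%:E + (e / 3)%:E.
  apply: le_trans hK; apply: ereal_inf_lbound; exists (G `&` O) => //.
  by split; [exact: openI|exact: setSI].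
have h2 : outer_content (X `&` ~` O) <= (m L)%:E + (e / 3)%:E.
  apply: le_trans hL; apply: ereal_inf_lbound; exists (G `\` K) => //.
  by split=> // x [Xx nOx]; split; [exact: XG|move=> /KGO[]].
have h3 : (m K)%:E + (m L)%:E <= outer_content X + (e / 3)%:E.
  apply: le_trans hG; rewrite -EFinD -mU; [|exact: borel_compact|exact: borel_compact|].
    apply: inner_content_ub; first exact: compactU.
    by move=> x [/KGO[]|/LGK[]].
  by apply/seteqP; split=> // x [Kx /LGK[]].
apply: (le_trans (leeD h1 h2)).
rewrite addeACA (le_trans (leeD2r _ h3))// -addeA leeD2l//.
by rewrite -!EFinD lee_fin; lra.
Qed.

Lemma caratheodory_borel (A : set borel) : measurable A -> caratheodory_measurable outer_content A.
Proof.
suff sub : (measurable : set (set borel)) `<=` caratheodory_measurable (outer_content : set T -> \bar R).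
  exact: sub.
apply: smallest_sub; last by move=> O oO; exact: caratheodory_open.
split.
- exact: caratheodory_measurable_set0.
- by move=> B mB; rewrite setTD; exact: caratheodory_measurable_setC.
- by move=> F mF; exact: caratheodory_measurable_bigcup.
Qed.

Definition regularization (A : set borel) : \bar R := outer_content A.

Lemma regularization_sigma_additive : semi_sigma_additive regularization.
Proof.
move=> F mF tF mUF; apply: (@caratheodory_measure_sigma_additive R T outer_content F) => //.
  by move=> i; exact: caratheodory_borel.
exact: caratheodory_borel.
Qed.

HB.instance Definition _ := isMeasure.Build _ borel R regularization
  outer_content0 outer_content_ge0 regularization_sigma_additive.

Definition regularized_measure : {measure set borel -> \bar R} := regularization.

Lemma regularization_open (O : set T) : open O -> regularized_measure O <= (m O)%:E.
Proof.
move=> oO; rewrite /regularized_measure /= /regularization outer_content_open//.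
exact: inner_content_open.
Qed.

(** A compact subset of [C] lies in every open set around [C], so its content is a lower bound;
    tightness allows [C] to be replaced by its intersection with a compact set. *)
Lemma regularization_closed (C : set T) : closed C ->
  (forall e : R, (0 < e)%R -> exists2 K, compact K & (m (~` K) < e)%R) ->
  (m C)%:E <= regularized_measure C.
Proof.
move=> cC tight; apply/lee_addgt0Pr => e e0; have [K cK Ke] := tight _ e0.
rewrite -leeBlDr//; apply: le_ereal_inf_tmp => _ [U [oU CO] <-].
rewrite leeBlDr//.
apply: (@le_trans _ _ ((m (C `&` K))%:E + e%:E)); last first.
  rewrite leeD2r//; apply: inner_content_ub; first by rewrite setIC; exact: compact_closedI.
  by move=> x [/CO].
have mC := borel_closed cC; have mK := borel_compact cK.
rewrite -EFinD lee_fin -{1}(setIT C) -(setUCr K) setIUr.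
rewrite (le_trans (content_leU _ _)) ?lerD2l//;
  [exact: measurableI|by apply: measurableI => //; exact: measurableC|].
apply: le_trans (ltW Ke); apply: content_le => //; first by apply: measurableI => //; exact: measurableC.
exact: measurableC.
Qed.

End RegularizedContent.

Section LayerSums.
Context {d} {T : measurableType d} {R : realType} (mu : {measure set T -> \bar R}).

(** When [A i] is the superlevel set of [f >= 0] at height [(i + 1) e], this approximates
    [min(f, n e)] from below within [e]. *)
Definition layer_sum (e : R) (n : nat) (A : nat -> set T) (x : T) : R :=
  \sum_(i < n) e * \1_(A i) x.

Lemma measurable_layer_sum e n A : (forall i, measurable (A i)) ->
  measurable_fun setT (layer_sum e n A).
Proof.
move=> mA; rewrite /layer_sum; apply: measurable_sum => i.
by apply: measurable_funM => //; exact: measurable_indic.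
Qed.

Lemma layer_sum_ge0 e n A x : 0 <= e -> 0 <= layer_sum e n A x.
Proof. by move=> e0; apply: sumr_ge0 => i _; rewrite mulr_ge0// indicE ler0n. Qed.

Lemma integral_layer_sum e n A : 0 <= e -> (forall i, measurable (A i)) ->
  (\int[mu]_x (layer_sum e n A x)%:E = \sum_(i < n) e%:E * mu (A i))%E.
Proof.
move=> e0 mA; rewrite /layer_sum; under eq_integral do rewrite -sumEFin.
rewrite ge0_integral_sum//.
- apply: eq_bigr => i _; under eq_integral do rewrite EFinM.
  rewrite ge0_integralZl_EFin ?integral_indic ?setIT//; exact/measurable_EFinP/measurable_indic.
- by move=> i; apply/measurable_EFinP/measurable_funM => //; exact: measurable_indic.
- by move=> i x _; rewrite lee_fin mulr_ge0// indicE ler0n.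
Qed.

Lemma layer_sum_full e n A x : (forall i, (i < n)%N -> A i x) -> layer_sum e n A x = e *+ n.
Proof.
move=> Ax; rewrite /layer_sum (eq_bigr (fun=> e)); first by rewrite sumr_const card_ord.
by move=> i _; rewrite indicE mem_set ?mulr1//; exact: Ax.
Qed.

Lemma layer_sum_le e n A (f : T -> R) x : 0 <= e -> 0 <= f x ->
  (forall i, A i x -> i.+1%:R * e <= f x) -> layer_sum e n A x <= f x.
Proof.
move=> e0 f0 Af; have le_full k : layer_sum e k A x <= e *+ k.
  have -> : e *+ k = \sum_(i < k) e by rewrite sumr_const card_ord.
  apply: ler_sum => i _.
  by rewrite ler_piMr// indicE lern1 leq_b1.
elim: n => [|n IH]; first by rewrite /layer_sum big_ord0.
rewrite /layer_sum big_ord_recr /= -/(layer_sum e n A x) indicE.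
have [Ax|nAx] := pselect (A n x); last by rewrite memNset// mulr0 addr0.
rewrite mem_set//; move: (Af _ Ax).
by apply: le_trans; rewrite mulr1 -addn1 natrD mulrDl mul1r lerD2r mulr_natl.
Qed.

Lemma min_le_layer_sum e n A (f : T -> R) x : 0 <= e -> 0 <= f x ->
  (forall i, i.+1%:R * e < f x -> A i x) -> Num.min (f x) (n%:R * e) <= e + layer_sum e n A x.
Proof.
move=> e0 f0 fA; elim: n => [|n IH].
  by rewrite mul0r ge_min; apply/orP; right; rewrite addr_ge0 ?layer_sum_ge0.
have [fn|nf] := leP (f x) (n%:R * e).
  rewrite (min_idPl fn) in IH; rewrite ge_min (le_trans IH)// lerD2l.
  by rewrite [leRHS]big_ord_recr /= lerDl mulr_ge0// indicE ler0n.
rewrite ge_min (_ : layer_sum _ _ _ _ = e *+ n + e * \1_(A n) x).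
  by apply/orP; right; rewrite -addn1 natrD mulrDl mul1r mulr_natl addrC lerD2l lerDl mulr_ge0// indicE ler0n.
rewrite /layer_sum big_ord_recr /= -/(layer_sum e n A x) layer_sum_full// => i ilt.
by apply: fA; apply: le_lt_trans nf; rewrite ler_wpM2r// ler_nat.
Qed.

End LayerSums.

(** * Limits of measures whose integrals converge on an algebra of continuous functions *)

Section UltraLimit.
Context {R : realType} {T : ptopologicalType}.
Hypotheses (T_regular : @regular_space T) (T_hausdorff : hausdorff_space T).
Local Notation borel := (g_sigma_algebraType (@open T)).
Variable alg : set (T -> R).
Hypothesis alg_continuous : forall f, alg f -> continuous f.
Hypothesis algD : forall f g, alg f -> alg g -> alg (fun x => f x + g x).
Hypothesis algM : forall f g, alg f -> alg g -> alg (fun x => f x * g x).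
Hypothesis alg_cst : forall c, alg (fun=> c).
Hypothesis alg_proper : exists2 g, alg g & forall r, compact [set x | g x <= r].
Variables (mu : nat -> {measure set borel -> \bar R}) (ell : (T -> R) -> R).
Hypothesis mu_int : forall k f, alg f -> (mu k).-integrable setT (EFin \o (f : borel -> R)).
Hypothesis mu_ell : forall f, alg f -> Rintegral (mu k) setT (f : borel -> R) @[k --> \oo] --> ell f.

Lemma borel_continuous (f : T -> R) : continuous f -> measurable_fun setT (f : borel -> R).
Proof.
move=> /continuousP cf; apply: (measurability _ (RGenOpens.measurableE R)).
move=> _ [_ [a [b ->] <-]]; rewrite setTI.
by apply: borel_open; apply: cf; exact: interval_open.
Qed.

Lemma alg_measurable f : alg f -> measurable_fun setT (f : borel -> R).
Proof. by move=> /alg_continuous; exact: borel_continuous. Qed.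

Lemma integral_fin k f : alg f ->
  (\int[mu k]_x (f x)%:E)%E = (Rintegral (mu k) setT (f : borel -> R))%:E.
Proof. by move=> af; rewrite /Rintegral fineK//; apply: integrable_fin_num => //; exact: mu_int. Qed.

Lemma mass_fin k (A : set borel) : measurable A -> mu k A \is a fin_num.
Proof.
move=> mA; rewrite ge0_fin_numE//; apply: (@le_lt_trans _ _ (mu k setT)).
  by apply: le_measure; rewrite ?inE.
have := integral_fin k (alg_cst 1); rewrite integral_cst// mul1e => ->.
exact: ltry.
Qed.

Lemma mass_bounded : exists M, forall k (A : set borel), measurable A -> 0 <= fine (mu k A) <= M.
Proof.
have /cvg_seq_bounded := cvgP _ (mu_ell (alg_cst 1)).
move=> /pinfty_ex_gt0[M _ HM]; exists M => k A mA; rewrite fine_ge0//=.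
apply: (@le_trans _ _ (fine (mu k setT))).
  by rewrite fine_le ?mass_fin//; apply: le_measure; rewrite ?inE.
apply: le_trans (HM k I); apply: le_trans (ler_norm _).
by rewrite /Rintegral integral_cst// mul1e.
Qed.

Lemma exists_div_le (a e : R) : 0 < e -> exists p0, forall p, (p0 <= p)%N -> a / p.+1%:R <= e.
Proof.
move=> e0; have x0 : 0 <= `|a| / e by rewrite divr_ge0// ltW.
exists (Num.bound (`|a| / e)) => p hp; rewrite ler_pdivrMr//.
apply: (le_trans (ler_norm _)); rewrite -ler_pdivrMl// mulrC.
by apply: (le_trans (ltW (archi_boundP x0))); rewrite ler_nat ltnW.
Qed.

Section WithUltrafilter.
Variable U : set_system nat.
Hypotheses (U_ultra : UltraFilter U) (U_oo : \oo `<=` U).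

(** The masses stay in a compact interval, where a cluster point along an ultrafilter is a limit.
    Nonmeasurable sets get an arbitrary nonnegative value. *)
Lemma ultra_limit_exists : exists m : set T -> R, (forall A, 0 <= m A) /\
  forall A : set borel, measurable A -> fine (mu k A) @[k --> U] --> m A.
Proof.
have [M HM] := mass_bounded.
have lim (A : set T) : exists a : R, 0 <= a /\ (measurable (A : set borel) -> fine (mu k A) @[k --> U] --> a).
  have [mA|nmA] := pselect (measurable (A : set borel)); last by exists 0.
  pose x k := fine (mu k A).
  have xM : (x @ U) `[0, M]%classic by apply: nearW => k; rewrite /= in_itv /= HM.
  have [a [+ ca]] := @segment_compact R 0 M _ (fmap_proper_filter x _) xM.
  rewrite /= in_itv /= => /andP[a0 _]; exists a; split=> // _ W Wa.
  have [//|UW] := in_ultra_setVsetC (x @^-1` W) U_ultra.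
  have UW' : (x @ U) (~` W) by [].
  by have [b [nWb Wb]] := ca _ _ UW' Wa.
have [m mP] := choice lim.
by exists m; split=> A; have [] := mP A.
Qed.

Variable m : set T -> R.
Hypothesis m_ge0 : forall A, 0 <= m A.
Hypothesis m_lim : forall A : set borel, measurable A -> fine (mu k A) @[k --> U] --> m A.

Let U_proper : ProperFilter U := @ultra_proper _ _ U_ultra.

Lemma ultra_limit0 : m set0 = 0.
Proof.
apply: (@cvg_unique _ (@Rhausdorff R) _ _ _ _ (m_lim measurable0)).
rewrite (_ : (fun k => _) = fun=> 0); first exact: cvg_cst.
by apply/funext => k; rewrite measure0.
Qed.

Lemma ultra_limitU (A B : set borel) : measurable A -> measurable B -> A `&` B = set0 ->
  m (A `|` B) = m A + m B.
Proof.
move=> mA mB AB; apply: (@cvg_unique _ (@Rhausdorff R) _ _ _ _ (m_lim (measurableU _ _ mA mB))).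
rewrite (_ : (fun k => _) = (fun k => fine (mu k A) + fine (mu k B))).
  by apply: cvgD; exact: m_lim.
by apply/funext => k; rewrite measureU// fineD ?mass_fin.
Qed.

Lemma ultra_ell f : alg f -> Rintegral (mu k) setT (f : borel -> R) @[k --> U] --> ell f.
Proof. by move=> af; apply: cvg_trans (mu_ell af); move=> W; exact: U_oo. Qed.

Lemma ultra_limitZ c (A : set borel) : measurable A -> c * fine (mu k A) @[k --> U] --> c * m A.
Proof. by move=> mA; apply: cvgM; [exact: cvg_cst|exact: m_lim]. Qed.

Lemma ultra_ellZ c f : alg f ->
  c * Rintegral (mu k) setT (f : borel -> R) @[k --> U] --> c * ell f.
Proof. by move=> af; apply: cvgM; [exact: cvg_cst|exact: ultra_ell]. Qed.

Lemma alg_gt_open f c : alg f -> open [set x | c < f x].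
Proof.
move=> /alg_continuous cf; apply: (@open_comp _ _ f [set y | c < y]); last exact: open_gt.
by move=> x _; exact: cf.
Qed.

Lemma alg_ge_closed f c : alg f -> closed [set x | c <= f x].
Proof.
move=> /alg_continuous cf; apply: (@closed_comp _ _ f [set y | c <= y]); last exact: closed_ge.
by move=> x _; exact: cf.
Qed.

Lemma ultra_limit_tight e : 0 < e -> exists2 K, compact K & m (~` K) < e.
Proof.
move=> e0; have [g ag gK] := alg_proper.
have agg := algM ag ag; pose C := ell (fun x => g x * g x).
have C0 : 0 <= C.
  apply: (ler_cvg_to (cvg_cst 0) (ultra_ell agg)); apply: nearW => k.
  by apply: Rintegral_ge0 => // x _; rewrite -expr2 sqr_ge0.
(* Markov's inequality for [g^2]: [r >= 1] gives [r <= g <= g^2] where [g > r], and [r e > C]. *)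
pose r := (C + 1) / e + 1.
have r1 : 1 <= r by rewrite lerDr divr_ge0 ?(ltW e0)// addr_ge0.
exists [set x | g x <= r]; first exact: gK.
have mK : measurable (~` [set x | g x <= r] : set borel).
  by apply: measurableC; apply: borel_compact => //; exact: gK.
have : r * m (~` [set x | g x <= r]) <= C.
  apply: (ler_cvg_to (@ultra_limitZ r _ mK) (ultra_ell agg)); apply: nearW => k.
  rewrite -lee_fin EFinM fineK ?mass_fin// -integral_fin//.
  rewrite -[X in mu k X]setIT -integral_indic//.
  rewrite -ge0_integralZl_EFin ?(le_trans _ r1)//; last exact/measurable_EFinP/measurable_indic.
  apply: ge0_le_integral => //.
  - by move=> x _; rewrite -EFinM lee_fin mulr_ge0 ?(le_trans _ r1)// indicE ler0n.
  - by apply: measurable_funeM; exact/measurable_EFinP/measurable_indic.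
  - by apply/measurable_EFinP; exact: (alg_measurable agg).
  - move=> x _; rewrite -EFinM lee_fin indicE.
    case: (pselect ((~` [set x | g x <= r]) x)) => [/[dup] h|h]; last first.
      by rewrite memNset// mulr0 -expr2 sqr_ge0.
    rewrite mem_set//= mulr1 => /negP; rewrite -ltNge => rg.
    apply: (le_trans (ltW rg)).
    by rewrite ler_peMr// ?(le_trans r1) ?(ltW rg)// (le_trans _ (ltW rg))// (le_trans _ r1).
move=> h; rewrite -(@ltr_pM2l _ r) ?(lt_le_trans _ r1)//; apply: (le_lt_trans h).
rewrite mulrDl mul1r divfK ?gt_eqF//.
lra.
Qed.

Local Notation lambda :=
  (regularized_measure T_regular T_hausdorff m_ge0 ultra_limit0 ultra_limitU).

Lemma measurable_gt f c : alg f -> measurable ([set x | c < f x] : set borel).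
Proof. by move=> af; apply: borel_open; exact: alg_gt_open. Qed.

Lemma measurable_ge f c : alg f -> measurable ([set x | c <= f x] : set borel).
Proof. by move=> af; apply: borel_closed; exact: alg_ge_closed. Qed.

Lemma fine_layer_sum k e n (A : nat -> set borel) : (forall i, measurable (A i)) ->
  (\sum_(i < n) e%:E * mu k (A i))%E = (\sum_(i < n) e * fine (mu k (A i)))%:E.
Proof.
by move=> mA; rewrite -sumEFin; apply: eq_bigr => i _; rewrite EFinM fineK// mass_fin.
Qed.

Lemma ultra_layer_sum e n (A : nat -> set borel) : (forall i, measurable (A i)) ->
  \sum_(i < n) e * fine (mu k (A i)) @[k --> U] --> \sum_(i < n) e * m (A i).
Proof.
move=> mA; elim: n => [|n IH].
  rewrite big_ord0 (_ : (fun k => _) = fun=> 0); first exact: cvg_cst.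
  by apply/funext => k; rewrite big_ord0.
rewrite big_ord_recr /=; under eq_fun do rewrite big_ord_recr /=.
by apply: cvgD; [exact: IH|exact: ultra_limitZ].
Qed.

(** The truncation at [p + 1] is cut into [(p + 1)^2] layers of height [1 / (p + 1)] over open
    superlevel sets, on which the regularized measure is at most [m]. Rounding costs [1 / (p + 1)]
    times the total mass. *)
Lemma integral_min_le f p : alg f -> (forall x, 0 <= f x) ->
  (\int[lambda]_x (Num.min (f x) p.+1%:R)%:E <= (ell f + m setT / p.+1%:R)%:E)%E.
Proof.
move=> af f0; pose e : R := p.+1%:R^-1; pose n := (p.+1 * p.+1)%N.
have e0 : 0 <= e by rewrite invr_ge0.
pose A i : set borel := [set x | i.+1%:R * e < f x].
have mA i : measurable (A i) by exact: measurable_gt.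
have ne : n%:R * e = p.+1%:R by rewrite natrM -mulrA divff// mulr1.
apply: (@le_trans _ _ (\int[lambda]_x (e%:E + (layer_sum e n A x)%:E)))%E.
  apply: ge0_le_integral => //.
  - by move=> x _; rewrite lee_fin le_min f0 /=.
  - by apply/measurable_EFinP/measurable_minr => //; exact: alg_measurable.
  - apply/measurable_EFinP/measurable_funD => //; exact: measurable_layer_sum.
  - by move=> x _; rewrite -EFinD lee_fin -ne; exact: min_le_layer_sum.
rewrite ge0_integralD//; last 2 first.
- by move=> x _; rewrite lee_fin layer_sum_ge0.
- exact/measurable_EFinP/measurable_layer_sum.
rewrite integral_cst// integral_layer_sum//.
apply: (@le_trans _ _ (e%:E * (m setT)%:E + \sum_(i < n) e%:E * (m (A i))%:E)%E).
  apply: leeD.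
    by apply: lee_wpmul2l => //; apply: regularization_open; exact: openT.
  apply: lee_sum => i _; apply: lee_wpmul2l => //; apply: regularization_open.
  exact: alg_gt_open.
under eq_bigr do rewrite -EFinM.
rewrite sumEFin -EFinM -EFinD lee_fin addrC mulrC lerD2r.
apply: (ler_cvg_to (@ultra_layer_sum e n _ mA) (ultra_ell af)); apply: nearW => k.
rewrite -lee_fin -fine_layer_sum// -integral_layer_sum// -integral_fin//.
apply: ge0_le_integral => //.
- by move=> x _; rewrite lee_fin layer_sum_ge0.
- exact/measurable_EFinP/measurable_layer_sum.
- by apply/measurable_EFinP; exact: alg_measurable.
- by move=> x _; rewrite lee_fin; apply: layer_sum_le => // i; exact: ltW.
Qed.

Lemma integral_limit_le f : alg f -> (forall x, 0 <= f x) ->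
  (\int[lambda]_x (f x)%:E <= (ell f)%:E)%E.
Proof.
move=> af f0.
pose h p x := (Num.min (f x) p.+1%:R)%:E.
have hlim x : limn (h^~ x) = (f x)%:E.
  apply: lim_near_cst => //; near=> p; rewrite /h; congr EFin; apply/min_idPl.
  apply: (@le_trans _ _ p%:R); last by rewrite ler_nat.
  by near: p; exact: nbhs_infty_ger.
under eq_integral do rewrite -hlim.
rewrite monotone_convergence//.
- apply/lee_addgt0Pr => e e0; have [p0 hp0] := exists_div_le (m setT) e0.
  apply: lime_le.
    apply: ereal_nondecreasing_is_cvgn => p q pq; apply: ge0_le_integral => //.
    + by move=> x _; rewrite lee_fin le_min f0 /=.
    + by apply/measurable_EFinP/measurable_minr => //; exact: alg_measurable.
    + by apply/measurable_EFinP/measurable_minr => //; exact: alg_measurable.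
    + by move=> x _; rewrite lee_fin le_min !ge_min lexx ler_nat ltnS pq orbT.
  near=> p; apply: (le_trans (integral_min_le p af f0)); rewrite -EFinD lee_fin lerD2l.
  by apply: hp0; near: p; exact: nbhs_infty_ge.
- by move=> p; apply/measurable_EFinP/measurable_minr => //; exact: alg_measurable.
- by move=> p x _; rewrite lee_fin le_min f0 /=.
- by move=> x _ p q pq; rewrite lee_fin le_min !ge_min lexx ler_nat ltnS pq orbT.
Unshelve. all: by end_near. Qed.

(** Closed superlevel sets are used here, because on them [m] is at most the regularized measure.
    Where [f > p + 1] the layers miss part of [f], which is controlled by [f <= f^2 / (p + 1)] and
    the limit [C] of the integrals of [f^2]. *)
Lemma integral_limit_ge f : alg f -> (forall x, 0 <= f x) ->
  ((ell f)%:E <= \int[lambda]_x (f x)%:E)%E.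
Proof.
move=> af f0; have aff := algM af af.
pose C := ell (fun x => f x * f x).
suff H p : ((ell f)%:E <= \int[lambda]_x (f x)%:E + ((m setT + C) / p.+1%:R)%:E)%E.
  apply/lee_addgt0Pr => e e0; have [p hp] := exists_div_le (m setT + C) e0.
  by apply: (le_trans (H p)); rewrite leeD2l// lee_fin hp.
pose e : R := p.+1%:R^-1; pose n := (p.+1 * p.+1)%N.
have e0 : 0 <= e by rewrite invr_ge0.
pose A i : set borel := [set x | i.+1%:R * e <= f x].
have mA i : measurable (A i) by exact: measurable_ge.
have ne : n%:R * e = p.+1%:R by rewrite natrM -mulrA divff// mulr1.
apply: (@le_trans _ _ (\sum_(i < n) e%:E * (m (A i))%:E + ((m setT + C) / p.+1%:R)%:E)%E); last first.
  rewrite leeD2r//.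
  apply: (@le_trans _ _ (\sum_(i < n) e%:E * lambda (A i))%E).
    apply: lee_sum => i _; apply: lee_wpmul2l => //; apply: regularization_closed.
      exact: alg_ge_closed.
    exact: ultra_limit_tight.
  rewrite -integral_layer_sum//; apply: ge0_le_integral => //.
  - by move=> x _; rewrite lee_fin layer_sum_ge0.
  - exact/measurable_EFinP/measurable_layer_sum.
  - by apply/measurable_EFinP; exact: alg_measurable.
  - by move=> x _; rewrite lee_fin; apply: layer_sum_le.
under eq_bigr do rewrite -EFinM.
rewrite sumEFin -EFinD lee_fin mulrDl addrCA ![_ / p.+1%:R]mulrC -/e.
have cv : e * fine (mu k setT) + (\sum_(i < n) e * fine (mu k (A i)) +
    e * Rintegral (mu k) setT (fun x : borel => f x * f x)) @[k --> U] -->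
    e * m setT + (\sum_(i < n) e * m (A i) + e * C).
  apply: cvgD; first exact: ultra_limitZ.
  by apply: cvgD; [exact: ultra_layer_sum|exact: ultra_ellZ].
apply: (ler_cvg_to (ultra_ell af) cv); apply: nearW => k /=.
rewrite -lee_fin -integral_fin// EFinD [X in (_ + X)%E]EFinD !EFinM.
rewrite -fine_layer_sum// -integral_layer_sum// -(integral_fin k aff) fineK ?mass_fin//.
have mff : measurable_fun setT (fun x : borel => (f x * f x)%:E).
  by apply/measurable_EFinP; exact: (alg_measurable aff).
have mL : measurable_fun setT (fun x : borel => (layer_sum e n A x)%:E).
  by apply/measurable_EFinP; exact: measurable_layer_sum.
rewrite -integral_cst// -ge0_integralZl_EFin//; last first.
  by move=> x _; rewrite lee_fin -expr2 sqr_ge0.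
rewrite -ge0_integralD//; last 3 first.
- by move=> x _; rewrite lee_fin layer_sum_ge0.
- by move=> x _; rewrite -EFinM lee_fin mulr_ge0// -expr2 sqr_ge0.
- exact: measurable_funeM.
rewrite -ge0_integralD//; last 2 first.
- by move=> x _; rewrite -EFinM -EFinD lee_fin addr_ge0 ?layer_sum_ge0// mulr_ge0// -expr2 sqr_ge0.
- by apply: emeasurable_funD => //; exact: measurable_funeM.
apply: ge0_le_integral => //.
- by move=> x _; rewrite lee_fin.
- by apply/measurable_EFinP; exact: alg_measurable.
- by apply: emeasurable_funD => //; apply: emeasurable_funD => //; exact: measurable_funeM.
- move=> x _; rewrite -EFinM -!EFinD lee_fin addrA.
  have [fp|pf] := leP (f x) p.+1%:R.
    rewrite -[leLHS]addr0 lerD ?mulr_ge0// -?expr2 ?sqr_ge0// -{1}(min_idPl fp) -ne.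
    by apply: min_le_layer_sum => // i; exact: ltW.
  rewrite -[leLHS]add0r lerD ?addr_ge0 ?layer_sum_ge0// mulrA -[leLHS]mul1r ler_wpM2r//.
  by rewrite -(@mulVf _ p.+1%:R)// ler_wpM2l// ltW.
Qed.

End WithUltrafilter.

Theorem moment_limit : exists la : {measure set borel -> \bar R}, forall f, alg f ->
  la.-integrable setT (EFin \o (f : borel -> R)) /\ Rintegral la setT (f : borel -> R) = ell f.
Proof.
have [U [U_ultra U_oo]] := @ultraFilterLemma nat \oo _.
have [m [m_ge0 m_lim]] := ultra_limit_exists U_ultra.
exists (regularized_measure T_regular T_hausdorff m_ge0 (ultra_limit0 U_ultra m_lim)
  (ultra_limitU U_ultra m_lim)).
set la := regularized_measure _ _ _ _ _.
have pos f : alg f -> (forall x, 0 <= f x) -> (\int[la]_x (f x)%:E = (ell f)%:E)%E.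
  move=> af f0; apply/eqP; rewrite eq_le; apply/andP; split.
    exact: integral_limit_le.
  exact: integral_limit_ge.
have posI f : alg f -> (forall x, 0 <= f x) -> la.-integrable setT (EFin \o (f : borel -> R)).
  move=> af f0; apply/integrableP; split.
    by apply/measurable_EFinP; exact: alg_measurable.
  rewrite (eq_integral (fun x : borel => (f x)%:E)); first by rewrite pos// ltry.
  by move=> x _; rewrite /= ger0_norm.
have posR f : alg f -> (forall x, 0 <= f x) -> Rintegral la setT (f : borel -> R) = ell f.
  by move=> af f0; rewrite /Rintegral pos.
(* Positive and negative parts leave the algebra; [f = a^2 - b^2] is a difference of nonnegative
   functions that stays in it. *)
move=> f af; pose a x := (f x + 1) / 2; pose b x := (f x + -1) / 2.
have aa : alg a by apply: algM => //; exact: algD.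
have ab : alg b by apply: algM => //; exact: algD.
have a2 := algM aa aa; have b2 := algM ab ab.
have a20 x : 0 <= a x * a x by rewrite -expr2 sqr_ge0.
have b20 x : 0 <= b x * b x by rewrite -expr2 sqr_ge0.
have fE : f = (fun x => a x * a x - b x * b x).
  by apply/funext => x; rewrite /a /b; field.
have fE' : EFin \o (f : borel -> R) = (fun x => (a x * a x)%:E - (b x * b x)%:E)%E.
  by rewrite {1}fE.
split; first by rewrite fE'; apply: integrableB => //; exact: posI.
rewrite [in LHS]fE RintegralB//; [|exact: posI|exact: posI].
rewrite !posR//; apply: (@cvg_unique _ (@Rhausdorff R) (Rintegral (mu k) setT (f : borel -> R) @[k --> \oo])).
  rewrite (_ : (fun k => _) = (fun k => Rintegral (mu k) setT (fun x : borel => a x * a x) -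
      Rintegral (mu k) setT (fun x : borel => b x * b x))).
    by apply: cvgB; exact: mu_ell.
  by apply/funext => k; rewrite [in LHS]fE RintegralB//; exact: mu_int.
exact: mu_ell.
Qed.

End UltraLimit.

Fixpoint rnat (n : nat) : rterm := if n is m.+1 then RAdd (rnat m) ROne else RAdd ROne (ROpp ROne).

Lemma reval_rnat (A : nzRingType) (e : nat -> A) n : reval e (rnat n) = n%:R.
Proof. by elim: n => [|n IH] /=; rewrite ?subrr// IH natr1. Qed.

Lemma rvars_lt_rnat k n : rvars_lt k (rnat n).
Proof. by elim: n => //= n ->. Qed.

(* The constants of the terms are the first [k] variables, with values [c]. *)
Theorem real_point (R : realType) (B : countComNzRingType) (T J : set B) (b : nat -> B)
    (c : nat -> R) k m (l : seq rterm) (q : rterm) :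
  is_preorder T -> is_real_ideal T J ->
  (forall t, rvars_lt k t -> 0 <= reval c t -> T (reval b t)) ->
  all (rvars_lt (k + m)) l -> rvars_lt (k + m) q ->
  (forall t, t \in l -> J (reval b t)) -> ~ J (reval b q) ->
  exists w : nat -> R, [/\ forall i, (i < k)%N -> w i = c i,
    forall t, t \in l -> reval w t = 0 & reval w q != 0].
Proof.
move=> Tpre Jreal cT wl wq Jl Jq.
have [F [f [fJ fq fT]]] := real_ideal_real_closed Tpre Jreal Jq.
pose u := f \o b.
have uE t : reval u t = f (reval b t) by rewrite (reval_morph f).
have ge0 t : rvars_lt k t -> 0 <= reval c t -> 0 <= reval u t.
  by move=> wt ct; rewrite uE; apply: fT; exact: cT.
(* For [N] large, the term [N t^2 - 1] is nonnegative at [c] by the Archimedean property, hence at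
   [u], where [t] cannot vanish. *)
have neq0 t : rvars_lt k t -> reval c t != 0 -> reval u t != 0.
  move=> wt ct; apply/eqP => ut.
  have [N cN] : exists N : nat, 1 <= N%:R * (reval c t) ^+ 2.
    exists (Num.bound ((reval c t) ^- 2)); rewrite -ler_pdivrMr ?exprn_even_gt0// mul1r ltW//.
    by apply: archi_boundP; rewrite invr_ge0 sqr_ge0.
  have : 0 <= reval u (RAdd (RMul (rnat N) (RMul t t)) (ROpp ROne)).
    by apply: (ge0) => /=; [rewrite rvars_lt_rnat wt|rewrite reval_rnat -expr2 subr_ge0].
  by rewrite /= ut !mulr0 sub0r oppr_ge0 ler10.
have sgE t : rvars_lt k t -> sgz (reval c t) = sgz (reval u t).
  move=> wt; case: (sgzP (reval c t)) => [ct|ct|ct].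
  - apply/esym/eqP; rewrite sgz_eq0 eq_le -oppr_ge0.
    rewrite ge0 ?ct// andbT.
    by apply: (ge0 (ROpp t)); rewrite //= ct oppr0.
  - by apply/esym/gtr0_sgz; rewrite lt0r neq0 ?gt_eqF//= ge0// ltW.
  - apply/esym/ltr0_sgz; rewrite -oppr_gt0 lt0r oppr_eq0 neq0 ?lt_eqF//=.
    by apply: (ge0 (ROpp t)) => //=; rewrite oppr_ge0 ltW.
have [|w [wc wP]] := @sign_conditions_transfer F R u c k m (q :: l) sgE.
  by rewrite /= wq wl.
exists w; split=> // [t tl|].
  apply/eqP; rewrite -sgz_eq0 wP ?inE ?tl ?orbT// uE fJ ?sgz0//.
  exact: Jl.
by rewrite -sgz_eq0 wP ?mem_head// uE sgz_eq0.
Qed.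

(** * Positive functionals *)

Section CountablePolynomials.
Variable m : nat.

Definition zpoly : Type := mpoly m int.
HB.instance Definition _ := GRing.ComNzRing.on zpoly.

Definition zpoly_code (p : zpoly) : seq (multinom m * int) :=
  [seq (i, mcoeff i p) | i <- msupp p].

Definition zpoly_decode (s : seq (multinom m * int)) : zpoly :=
  \sum_(x <- s) x.2 *: mpolyX int x.1.

Lemma zpoly_codeK : cancel zpoly_code zpoly_decode.
Proof. by move=> p; rewrite /zpoly_decode big_map; exact/esym/mpolyE. Qed.

HB.instance Definition _ := CanIsCountable zpoly_codeK.

End CountablePolynomials.

Lemma rvars_ltW k l t : rvars_lt k t -> (k <= l)%N -> rvars_lt l t.
Proof.
move=> + kl; elim: t => //= [i ik|s1 IH1 s2 IH2|s1 IH1 s2 IH2]; first exact: leq_trans kl.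
  by move=> /andP[/IH1 -> /IH2 ->].
by move=> /andP[/IH1 -> /IH2 ->].
Qed.

Section PositiveFunctional.
Context {R : realType} {A : comAlgType R[i]}.
Variables (sg : A -> A) (L : {scalar A}).
Hypotheses (sgD : {morph sg : a b / a + b}) (sgM : {morph sg : a b / a * b}).
Hypotheses (sgK : involutive sg) (sgZ : forall (c : R[i]) a, sg (c *: a) = Num.conj c *: sg a).
Hypothesis L_pos : forall a, 0 <= L (sg a * a).
Local Open Scope complex_scope.

(* The case of the Cauchy-Schwarz inequality where one factor is null. *)
Lemma positive_null_mul b a : L (sg a * a) = 0 -> L (b * a) = 0.
Proof.
move=> La; rewrite -(sgK b); move: {b}(sg b) => b.
have H (c : R[i]) : 0 <= L (sg b * b) + (c * L (sg b * a) + Num.conj c * L (sg a * b)).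
  have := L_pos (b + c *: a).
  rewrite sgD sgZ mulrDl !mulrDr -!scalerAl -!scalerAr !raddfD /= !linearZ /=.
  by rewrite La !mulr0 addr0 -addrA.
have b0 := L_pos b; move: H b0.
move: (L (sg b * b)) (L (sg b * a)) (L (sg a * b)) => [ar ai] [xr xi] [yr yi] H.
rewrite lecE /= => /andP[/eqP ai0 ar0].
have H1 (r : R) : 0 <= ar + r * (xr + yr) /\ 0 = r * (xi + yi).
  have := H r%:C; rewrite lecE /= => /andP[/eqP h1 h2].
  by split; [move: h2|move: h1; rewrite ai0]; nra.
have H2 (r : R) : 0 <= ar + r * (yi - xi) /\ 0 = r * (xr - yr).
  have := H (0 +i* r); rewrite lecE /= => /andP[/eqP h1 h2].
  by split; [move: h2|move: h1; rewrite ai0]; nra.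
(* An affine function bounded below on the whole line is constant; [r = - (ar + 1) / s] would give
   the value [-1]. *)
have lin (s : R) : (forall r, 0 <= ar + r * s) -> s = 0.
  move=> h; apply/eqP; apply/negPn/negP => s0.
  have := h (- (ar + 1) / s); rewrite divfK// opprD addrA subrr sub0r.
  by rewrite oppr_ge0 ler10.
have e1 := lin _ (fun r => (H1 r).1); have e2 := lin _ (fun r => (H2 r).1).
have [_ e3] := H1 1; have [_ e4] := H2 1; rewrite !mul1r in e3 e4.
by apply/eqP; rewrite eq_complex /=; apply/andP; split; apply/eqP; lra.
Qed.

Section RealIdeal.
Context {B : comNzRingType} (eta : {rmorphism B -> A}).
Hypothesis eta_fixed : forall b, sg (eta b) = eta b.

(** Squares are taken in [A], not in [B]: a variable of [B] that stands for a nonnegative real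
    constant is then in the preorder, although it has no square root in [B]. *)
Definition hermitian_squares : set B :=
  [set s | exists r : seq A, eta s = \sum_(a <- r) sg a * a].

Definition null_part : set B := [set b | L (eta b * eta b) = 0].

Lemma hermitian_squares_preorder : is_preorder hermitian_squares.
Proof.
split=> [s t [r rE] [r' r'E]|s t [r rE] [r' r'E]|b].
- by exists (r ++ r'); rewrite big_cat rmorphD /= rE r'E.
- exists (allpairs (fun a b => a * b) r r'); rewrite rmorphM rE r'E big_allpairs_dep mulr_suml.
  apply: eq_bigr => a _; rewrite mulr_sumr; apply: eq_bigr => a' _.
  by rewrite sgM mulrACA.
- by exists [:: eta b]; rewrite big_seq1 eta_fixed -rmorphM expr2.
Qed.

Lemma null_part_mul b a : null_part b -> L (a * eta b) = 0.
Proof. by move=> Lb; apply: positive_null_mul; rewrite eta_fixed. Qed.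

(** Cauchy-Schwarz against [1] turns membership of [b^2 + s] into [L (b^2 + s) = 0]; both summands
    have nonnegative value, so [L (b^2) = 0]. *)
Lemma null_part_real : is_real_ideal hermitian_squares null_part.
Proof.
split=> [|a b Ja Jb|a b Jb|b s [r rE] Jb]; rewrite /null_part /=.
- by rewrite rmorph0 mul0r raddf0.
- by rewrite [in X in _ * X]rmorphD mulrDr raddfD /= !null_part_mul// addr0.
- by rewrite [in X in _ * X]rmorphM mulrA null_part_mul.
have := null_part_mul 1 Jb; rewrite mul1r rmorphD rE raddfD raddf_sum /=.
have h0 : 0 <= \sum_(a <- r) L (sg a * a) by apply: sumr_ge0 => i _; exact: L_pos.
have h1 : 0 <= L (eta (b ^+ 2)) by rewrite expr2 rmorphM -{1}eta_fixed.
move/eqP; rewrite paddr_eq0// => /andP[/eqP + _].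
by rewrite expr2 rmorphM.
Qed.

End RealIdeal.

Section Evaluation.
Variables (N : nat) (v : nat -> A).
Hypothesis sgv : forall i, sg (v i) = v i.

(** The spare variable makes the index type inhabited, so that [inord] is available for every
    [N]. *)
Definition zpoly_eval : zpoly N.+1 -> A := mmap (intmul (1 : A)) (fun i => v i).
HB.instance Definition _ := GRing.RMorphism.on zpoly_eval.

Definition zvar (i : nat) : zpoly N.+1 := mpolyX int (mnm1 (inord i)).

Lemma zpoly_eval_reval t : rvars_lt N t -> zpoly_eval (reval zvar t) = reval v t.
Proof.
move=> ht; rewrite reval_morph; apply: (eq_reval ht) => i il.
by rewrite /= /zpoly_eval mmapX mmap1U inordK// ltnS ltnW.
Qed.

Lemma fixed_sum (I : Type) (r : seq I) (F : I -> A) :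
  (forall i, sg (F i) = F i) -> sg (\sum_(i <- r) F i) = \sum_(i <- r) F i.
Proof.
move=> sgF; apply: (big_ind (fun a => sg a = a)) => // [|a b ea eb].
  by have := sgZ 0 0; rewrite !scale0r rmorph0 scale0r.
by rewrite sgD ea eb.
Qed.

Lemma fixed1 : sg 1 = 1.
Proof. by have := sgM (sg 1) 1; rewrite mulr1 sgK mul1r. Qed.

Lemma fixedN a : sg (- a) = - sg a.
Proof. by rewrite -scaleN1r sgZ rmorphN1 scaleN1r. Qed.

Lemma fixed_int (z : int) : sg (intmul (1 : A) z) = intmul (1 : A) z.
Proof.
have fn m : sg (m%:R : A) = m%:R.
  elim: m => [|m IH]; first by have := sgZ 0 0; rewrite !scale0r rmorph0 scale0r.
  by rewrite mulrSr sgD IH fixed1.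
by case: z => m; [exact: fn | rewrite NegzE mulrNz fixedN; congr (- _); exact: fn].
Qed.

Lemma zpoly_eval_fixed b : sg (zpoly_eval b) = zpoly_eval b.
Proof.
rewrite /zpoly_eval /mmap; apply: fixed_sum => m.
rewrite sgM fixed_int; congr (_ * _); apply: (big_ind (fun a => sg a = a)) => [|a a' ea ea'|i _].
- exact: fixed1.
- by rewrite sgM ea ea'.
elim: (m i) => [|d IH]; first by rewrite expr0 fixed1.
by rewrite exprS sgM IH sgv.
Qed.

End Evaluation.

(* The constants of the terms are the first [k] variables, with values [c]. *)
Theorem positive_functional_point (v : nat -> A) (c : nat -> R) k m (l : seq rterm) (q : rterm) :
  (forall i, sg (v i) = v i) ->
  (forall t, rvars_lt k t -> 0 <= reval c t -> exists r : seq A, reval v t = \sum_(a <- r) sg a * a) ->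
  all (rvars_lt (k + m)) l -> rvars_lt (k + m) q ->
  (forall t, t \in l -> L (reval v t * reval v t) = 0) -> L (reval v q * reval v q) <> 0 ->
  exists w : nat -> R, [/\ forall i, (i < k)%N -> w i = c i,
    forall t, t \in l -> reval w t = 0 & reval w q != 0].
Proof.
move=> vfix cT hl hq Jl Jq.
have efix := @zpoly_eval_fixed (k + m) _ vfix.
apply: (real_point (hermitian_squares_preorder efix) (null_part_real efix) _ hl hq (b := @zvar (k + m))).
- move=> t ht ct; have [r rE] := cT t ht ct; exists r.
  by rewrite [LHS]zpoly_eval_reval// (rvars_ltW ht)// leq_addr.
- move=> t tl; rewrite /null_part /= zpoly_eval_reval ?Jl//.
  exact: (allP hl).
- by rewrite /null_part /= zpoly_eval_reval.
Qed.

End PositiveFunctional.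

(** * Polynomials in the coordinates and their conjugates *)

Section StarAlgebra.
Context {R : realType} {n : nat}.
Local Notation C := R[i].
Local Notation P := (Pnn R n).
Implicit Types (Q S : P) (z : @Cn R n).
Local Open Scope complex_scope.

Lemma Pnn_ind (S : P -> Prop) : (forall c, S (mpolyC (n + n) c)) ->
  (forall k, S (mpolyX C (mnm1 k))) -> (forall p q, S p -> S q -> S (p + q)) ->
  (forall p q, S p -> S q -> S (p * q)) -> forall p, S p.
Proof.
move=> SC SX SD SM p; rewrite (mpolyE p).
have S0 : S 0 by rewrite -(mpolyC0 (n + n) C); exact: SC.
elim/big_ind: _ => // m _; rewrite -mul_mpolyC; apply: (SM) => //.
rewrite mpolyXE_id; elim/big_ind: _ => [|x y|i _]; [|exact: SM|].
  by rewrite -(mpolyC1 (n + n) C); exact: SC.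
elim: (m i) => [|k IH]; first by rewrite expr0 -(mpolyC1 (n + n) C); exact: SC.
by rewrite exprS; exact: SM.
Qed.

(** Presents the coefficient map as a composite of ring morphisms, so that the morphism lemmas on
    [mmap] apply. *)
Lemma starE Q : star Q = mmap (@mpolyC (n + n) C \o (@conjc R))
  (fun k => mpolyX C (mnm1 (swap_var k))) Q.
Proof. by []. Qed.

Lemma starD Q S : star (Q + S) = star Q + star S.
Proof. by rewrite !starE rmorphD. Qed.

Lemma starM Q S : star (Q * S) = star Q * star S.
Proof. by rewrite !starE rmorphM. Qed.

Lemma starC (c : C) : star (mpolyC (n + n) c) = mpolyC (n + n) c^*.
Proof. by rewrite starE mmapC. Qed.

Lemma starX k : star (mpolyX C (mnm1 k)) = mpolyX C (mnm1 (swap_var k)) :> P.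
Proof. by rewrite starE mmapX mmap1U. Qed.

Lemma swap_varK (k : 'I_(n + n)) : swap_var (swap_var k) = k.
Proof.
rewrite /swap_var; case: (splitP k) => j jE; apply/val_inj.
  by rewrite (unsplitK (inr j)).
by rewrite (unsplitK (inl j)).
Qed.

Lemma starK : involutive (@star R n).
Proof.
elim/Pnn_ind => [c|k|p q Hp Hq|p q Hp Hq].
- by rewrite !starC conjCK.
- by rewrite !starX swap_varK.
- by rewrite !starD; congr (_ + _).
- by rewrite !starM; congr (_ * _).
Qed.

Lemma evalCD Q S z : evalC (Q + S) z = evalC Q z + evalC S z.
Proof. by rewrite /evalC mevalD. Qed.

Lemma evalCM Q S z : evalC (Q * S) z = evalC Q z * evalC S z.
Proof. by rewrite /evalC mevalM. Qed.

Lemma evalC_cst (c : C) z : evalC (mpolyC (n + n) c) z = c.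
Proof. by rewrite /evalC mevalC. Qed.

Lemma evalC_star Q z : evalC (star Q) z = (evalC Q z)^*.
Proof.
elim/Pnn_ind: Q => [c|k|p q Hp Hq|p q Hp Hq].
- by rewrite starC !evalC_cst.
- rewrite starX /evalC !mevalXU /swap_var; case: (fintype.split k) => j.
    by rewrite (unsplitK (inr j)).
  by rewrite (unsplitK (inl j)); exact/esym/conjcK.
- by rewrite starD !evalCD rmorphD; congr (_ + _).
- by rewrite starM !evalCM rmorphM; congr (_ * _).
Qed.

Lemma starZ (c : C) Q : star (c *: Q) = Num.conj c *: star Q.
Proof. by rewrite -!mul_mpolyC starM starC. Qed.

Lemma null_ideal_mul (L : {scalar P}) Q S : positive_definite L -> null_ideal L Q -> L (S * Q) = 0.
Proof. by move=> Lpos LQ; exact: (positive_null_mul starD starK starZ Lpos S LQ). Qed.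

Lemma type_A_type_C Q : type_A Q -> type_C (zero_set Q).
Proof.
move=> QA L Lpos VL; apply: QA => // _ [S ->].
by apply: null_ideal_mul => //; rewrite -VL => z.
Qed.

End StarAlgebra.

Section ImaginaryUnit.
Variables (A : comNzRingType) (k : nat) (e : nat -> A) (u : A).
Hypothesis u_sqr : u * u = -1.

Definition complex_rep (q : A) := exists t1 t2,
  [/\ rvars_lt k t1, rvars_lt k t2 & q = reval e t1 + u * reval e t2].

Lemma complex_repD p q : complex_rep p -> complex_rep q -> complex_rep (p + q).
Proof.
move=> [t1 [t2 [h1 h2 ->]]] [s1 [s2 [h3 h4 ->]]].
exists (RAdd t1 s1), (RAdd t2 s2); split; rewrite /= ?h1 ?h2//.
by rewrite mulrDr addrACA.
Qed.

Lemma complex_repM p q : complex_rep p -> complex_rep q -> complex_rep (p * q).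
Proof.
move=> [t1 [t2 [h1 h2 ->]]] [s1 [s2 [h3 h4 ->]]].
exists (RAdd (RMul t1 s1) (ROpp (RMul t2 s2))), (RAdd (RMul t1 s2) (RMul t2 s1)).
split; rewrite /= ?h1 ?h2 ?h3 ?h4//.
by rewrite -mulN1r -u_sqr; ring.
Qed.

End ImaginaryUnit.

Section RealCoordinates.
Context {R : realType} {n : nat}.
Local Notation C := R[i].
Local Notation P := (Pnn R n).
Implicit Types (Q S : P) (z : @Cn R n) (cs : seq R).
Local Open Scope complex_scope.

Definition Xvar (j : 'I_n) : P := mpolyX C (mnm1 (lshift n j)).
Definition Yvar (j : 'I_n) : P := mpolyX C (mnm1 (rshift n j)).
Definition Icst : P := mpolyC (n + n) 'i%C.
Definition half_cst : P := mpolyC (n + n) 2^-1.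
Definition re_coord j : P := half_cst * (Xvar j + Yvar j).
Definition im_coord j : P := half_cst * Icst * (Yvar j - Xvar j).

Lemma Icst_sqr : Icst * Icst = -1.
Proof. by rewrite -mpolyCM -expr2 sqr_i mpolyCN mpolyC1. Qed.

Lemma half_cst2 : half_cst * 2%:R = 1.
Proof. by rewrite -(mpolyC_nat (n + n) C) -mpolyCM mulVf ?mpolyC1// pnatr_eq0. Qed.

Lemma starN Q : star (- Q) = - star Q.
Proof. by rewrite -mulN1r -(mpolyC1 (n + n) C) -mpolyCN starM starC rmorphN1 mpolyCN mulN1r. Qed.

Lemma star_Icst : star Icst = - Icst.
Proof. by rewrite starC -mpolyCN; congr mpolyC; apply/eqP; rewrite eq_complex /= oppr0 !eqxx. Qed.

Lemma star_half_cst : star half_cst = half_cst.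
Proof. by rewrite starC fmorphV rmorph_nat. Qed.

Lemma star_Xvar j : star (Xvar j) = Yvar j.
Proof. by rewrite starX /swap_var (unsplitK (inl j)). Qed.

Lemma star_Yvar j : star (Yvar j) = Xvar j.
Proof. by rewrite -star_Xvar starK. Qed.

Lemma star_re_coord j : star (re_coord j) = re_coord j.
Proof. by rewrite starM starD star_Xvar star_Yvar star_half_cst addrC. Qed.

Lemma star_im_coord j : star (im_coord j) = im_coord j.
Proof.
rewrite starM starD starN starM star_Xvar star_Yvar star_half_cst star_Icst.
by rewrite mulrN mulNr -mulrN opprB.
Qed.

Lemma Xvar_coord j : Xvar j = re_coord j + Icst * im_coord j.
Proof.
rewrite /im_coord [half_cst * _]mulrC !mulrA Icst_sqr mulN1r mulNr -mulrBr opprB addrACA.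
by rewrite subrr addr0 -mulr2n -mulr_natr mulrCA half_cst2 mulr1.
Qed.

Lemma Yvar_coord j : Yvar j = re_coord j - Icst * im_coord j.
Proof.
by rewrite -star_Xvar Xvar_coord starD starM star_Icst star_re_coord star_im_coord mulNr.
Qed.

Lemma coord_split k : (exists j, k = lshift n j :> 'I_(n + n)) \/ exists j, k = rshift n j.
Proof.
by case: (splitP k) => j jk; [left|right]; exists j; exact/val_inj.
Qed.

(* The constants [cs] come first, then the real and the imaginary parts of the coordinates. *)
Definition coord_env cs (i : nat) : P :=
  if (i < size cs)%N then mpolyC (n + n) (cs`_i)%:C
  else if insub (i - size cs)%N is Some k then
    match @fintype.split n n k with inl j => re_coord j | inr j => im_coord j end
  else 0.

Lemma coord_env_re cs (j : 'I_n) : coord_env cs (size cs + j) = re_coord j.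
Proof.
rewrite /coord_env ltnNge leq_addr /= addKn insubT ?ltn_addr// => jn.
by rewrite (_ : Sub _ _ = unsplit (inl j)) ?unsplitK//; exact: val_inj.
Qed.

Lemma coord_env_im cs (j : 'I_n) : coord_env cs (size cs + (n + j)) = im_coord j.
Proof.
rewrite /coord_env ltnNge leq_addr /= addKn insubT ?ltn_add2l// => jn.
by rewrite (_ : Sub _ _ = unsplit (inr j)) ?unsplitK//; exact: val_inj.
Qed.

Lemma star_coord_env cs i : star (coord_env cs i) = coord_env cs i.
Proof.
rewrite /coord_env; case: ifP => _; first by rewrite starC; congr mpolyC; exact: conjc_real.
case: insubP => [k _ _|_]; first by case: (fintype.split k) => j; rewrite (star_re_coord, star_im_coord).
by rewrite -(mpolyC0 (n + n) C) starC rmorph0.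
Qed.

(** Any list that contains [cs0] is allowed, since the terms of a sum or product, and later two
    different polynomials, must share one list of constants. *)
Lemma complex_repE Q : exists cs0 : seq R, forall cs, {subset cs0 <= cs} ->
  complex_rep (size cs + (n + n)) (coord_env cs) Icst Q.
Proof.
elim/(@Pnn_ind R n): Q => [c|k|p q [s1 h1] [s2 h2]|p q [s1 h1] [s2 h2]].
- exists [:: complex.Re c; complex.Im c] => cs sub.
  have m1 : complex.Re c \in cs by apply: sub; rewrite inE eqxx.
  have m2 : complex.Im c \in cs by apply: sub; rewrite !inE eqxx orbT.
  exists (RVar (index (complex.Re c) cs)), (RVar (index (complex.Im c) cs)).
  split; rewrite /= ?ltn_addr ?index_mem//.
  rewrite /coord_env !index_mem m1 m2 !nth_index// -mpolyCM -mpolyCD.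
  by congr mpolyC; apply/eqP; rewrite eq_complex /= !(mul0r, mulr0, mul1r, subr0, addr0, add0r) !eqxx.
- exists [::] => cs _.
  have [[j ->]|[j ->]] := coord_split k.
    exists (RVar (size cs + j)), (RVar (size cs + (n + j))).
    split; rewrite /= ?ltn_add2l ?ltn_addr ?ltn_add2l//.
    by rewrite coord_env_re coord_env_im -Xvar_coord.
  exists (RVar (size cs + j)), (ROpp (RVar (size cs + (n + j)))).
  split; rewrite /= ?ltn_add2l ?ltn_addr ?ltn_add2l//.
  by rewrite coord_env_re coord_env_im mulrN -Yvar_coord.
- exists (s1 ++ s2) => cs sub; apply: complex_repD.
    by apply: h1 => x xs; apply: sub; rewrite mem_cat xs.
  by apply: h2 => x xs; apply: sub; rewrite mem_cat xs orbT.
- exists (s1 ++ s2) => cs sub; apply: (complex_repM Icst_sqr).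
    by apply: h1 => x xs; apply: sub; rewrite mem_cat xs.
  by apply: h2 => x xs; apply: sub; rewrite mem_cat xs orbT.
Qed.

Lemma star_reval cs t : star (reval (coord_env cs) t) = reval (coord_env cs) t.
Proof.
elim: t => [i||s IH|s1 IH1 s2 IH2|s1 IH1 s2 IH2] /=.
- exact: star_coord_env.
- by rewrite -(mpolyC1 (n + n) C) starC rmorph1.
- by rewrite starN; congr (- _).
- by rewrite starD; congr (_ + _).
- by rewrite starM; congr (_ * _).
Qed.

Lemma imaginary_unit_norm (A : comNzRingType) (u p q : A) : u * u = -1 ->
  (p - u * q) * (p + u * q) = p * p + q * q.
Proof.
move=> uu; have -> : p * p + q * q = p * p - (u * u) * (q * q) by rewrite uu mulN1r opprK.
by ring.
Qed.

Lemma star_mul_rep (p q : P) : star p = p -> star q = q ->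
  star (p + Icst * q) * (p + Icst * q) = p * p + q * q.
Proof.
move=> sp sq; rewrite -(imaginary_unit_norm p q Icst_sqr); congr (_ * _).
by rewrite starD starM star_Icst sq mulNr; congr (_ + _).
Qed.

Definition point_of cs (w : nat -> R) : @Cn R n :=
  \row_j ((w (size cs + j)%N) +i* (w (size cs + (n + j))%N)).

Lemma evalC_re_coord j z : evalC (re_coord j) z = (complex.Re (z ord0 j))%:C.
Proof.
rewrite evalCM evalCD !evalC_cst /evalC !mevalXU (unsplitK (inl j)) (unsplitK (inr j)).
by rewrite mulrC; exact/esym/ReJ_add.
Qed.

Lemma evalCN Q z : evalC (- Q) z = - evalC Q z.
Proof. by rewrite /evalC mevalN. Qed.

Lemma evalC_im_coord j z : evalC (im_coord j) z = (complex.Im (z ord0 j))%:C.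
Proof.
rewrite !evalCM evalCD evalCN !evalC_cst /evalC !mevalXU (unsplitK (inl j)) (unsplitK (inr j)).
by rewrite mulrC mulrA; exact/esym/ImJ_sub.
Qed.

Lemma evalC_coord_env cs w i : (forall i, (i < size cs)%N -> w i = cs`_i) ->
  (i < size cs + (n + n))%N -> evalC (coord_env cs i) (point_of cs w) = (w i)%:C.
Proof.
move=> wc; have [ics _|ics il] := ltnP i (size cs).
  by rewrite /coord_env ics evalC_cst wc.
have iE : (i - size cs < n + n)%N by rewrite ltn_subLR.
have -> : i = (size cs + Ordinal iE)%N by rewrite /= subnKC.
have [[j ->]|[j ->]] := coord_split (Ordinal iE).
  by rewrite coord_env_re evalC_re_coord mxE.
by rewrite coord_env_im evalC_im_coord mxE.
Qed.

Lemma evalC1 z : evalC 1 z = 1.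
Proof. by rewrite /evalC meval1. Qed.

Lemma evalC_reval cs w t : (forall i, (i < size cs)%N -> w i = cs`_i) ->
  rvars_lt (size cs + (n + n)) t ->
  evalC (reval (coord_env cs) t) (point_of cs w) = (reval w t)%:C.
Proof.
move=> wc; elim: t => [i||s IH|s1 IH1 s2 IH2|s1 IH1 s2 IH2] /=.
- exact: evalC_coord_env.
- by rewrite evalC1.
- by rewrite evalCN rmorphN => /IH ->.
- by rewrite evalCD rmorphD => /andP[/IH1 -> /IH2 ->].
- by rewrite evalCM rmorphM => /andP[/IH1 -> /IH2 ->].
Qed.

Lemma reval_cst cs t : rvars_lt (size cs) t ->
  reval (coord_env cs) t = mpolyC (n + n) (reval (nth 0 cs) t)%:C.
Proof.
elim: t => [i||s IH|s1 IH1 s2 IH2|s1 IH1 s2 IH2] /=.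
- by rewrite /coord_env => ->.
- by rewrite mpolyC1.
- by rewrite rmorphN mpolyCN => /IH ->.
- by rewrite rmorphD mpolyCD => /andP[/IH1 -> /IH2 ->].
- by rewrite rmorphM mpolyCM => /andP[/IH1 -> /IH2 ->].
Qed.

Theorem vanishing_ideal_null (L : {scalar P}) Q : positive_definite L ->
  principal_ideal Q `<=` Defs.kernel L -> vanishing_ideal (zero_set Q) `<=` null_ideal L.
Proof.
move=> Lpos LQ S VS; rewrite /null_ideal /=; apply/eqP/negPn/negP => /eqP LS.
have [c1 /(_ (c1 ++ _)) Qrep] := complex_repE Q.
have [c2 /(_ (c1 ++ c2)) Srep] := complex_repE S.
have [|t1 [t2 [h1 h2 QE]]] := Qrep c2; first by move=> x xs; rewrite mem_cat xs.
have [|s1 [s2 [h3 h4 SE]]] := Srep; first by move=> x xs; rewrite mem_cat xs orbT.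
move: (c1 ++ c2) h1 h2 QE h3 h4 SE {Qrep Srep} => cs h1 h2 QE h3 h4 SE.
pose N t := L (reval (coord_env cs) t * reval (coord_env cs) t).
have N0 t : 0 <= N t by have := Lpos (reval (coord_env cs) t); rewrite star_reval.
have LQE : N t1 + N t2 = 0.
  have /LQ : principal_ideal Q (star Q * Q) by exists (star Q).
  by rewrite /Defs.kernel /= {1 2}QE star_mul_rep ?star_reval// raddfD.
have /eqP := LQE; rewrite paddr_eq0// => /andP[/eqP N1 /eqP N2].
have : exists2 q, q \in [:: s1; s2] & N q <> 0.
  apply: contrapT => /forall2NP Ns; apply: LS.
  rewrite SE star_mul_rep ?star_reval// raddfD /=.
  have e q : q \in [:: s1; s2] -> N q = 0 by move=> qs; case: (Ns q) => // /contrapT.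
  by rewrite [X in X + _]e ?[X in _ + X]e ?addr0// !inE eqxx ?orbT.
move=> [q qs Nq].
have hq : rvars_lt (size cs + (n + n)) q by move: qs; rewrite !inE => /orP[] /eqP ->.
have [|||||w [wc w0 wq]] := @positive_functional_point R P star L starD starM starK starZ Lpos
  (coord_env cs) (nth 0 cs) (size cs) (n + n) [:: t1; t2] q (star_coord_env cs).
(* A term in the constants evaluates to a constant polynomial; if its value is nonnegative, it is
   the hermitian square of its real square root. *)
- move=> t ht ct; exists [:: mpolyC (n + n) (Num.sqrt (reval (nth 0 cs) t))%:C].
  rewrite big_seq1 starC reval_cst// -mpolyCM; congr mpolyC.
  rewrite (_ : Num.conj _ = (Num.sqrt (reval (nth 0 cs) t))%:C); last exact: conjc_real.
  by rewrite -rmorphM -expr2 sqr_sqrtr.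
- by rewrite /= h1 h2.
- exact: hq.
- by move=> t; rewrite !inE => /orP[] /eqP ->.
- exact: Nq.
have vQ : zero_set Q (point_of cs w).
  by rewrite /zero_set /= QE evalCD evalCM !evalC_reval// !w0 ?inE ?eqxx ?orbT// mulr0 addr0.
have := VS _ vQ; rewrite SE evalCD evalCM evalC_cst !evalC_reval// => /eqP.
rewrite eq_complex /= !(mul0r, mul1r, mulr0, subr0, addr0, add0r) => /andP[a b].
by move: qs wq; rewrite !inE => /orP[] /eqP ->; [rewrite a | rewrite b].
Qed.

End RealCoordinates.

(** * The topology of complex space *)

Section ComplexTopology.
Context {R : realType}.
Local Notation C := R[i].

Lemma normc_re_le (c : C) : `|complex.Re c|%:C%C <= `|c|.
Proof. by case: c => a b; rewrite normc_def lecR /= -sqrtr_sqr ler_wsqrtr// lerDl sqr_ge0. Qed.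

Lemma normc_im_le (c : C) : `|complex.Im c|%:C%C <= `|c|.
Proof. by case: c => a b; rewrite normc_def lecR /= -sqrtr_sqr ler_wsqrtr// lerDr sqr_ge0. Qed.

Lemma normc_le (c : C) : `|c| <= (`|complex.Re c| + `|complex.Im c|)%:C%C.
Proof.
case: c => a b; rewrite [X in `|X|]complexE rmorphD; apply: (le_trans (ler_normD _ _)).
rewrite normrM /=; apply: lerD; first by rewrite normc_def /= expr0n addr0 sqrtr_sqr.
by rewrite !normc_def /= expr0n /= add0r expr1n sqrtr1 mul1r addr0 sqrtr_sqr.
Qed.

Lemma Re_mul (a b : C) :
  complex.Re (a * b) = complex.Re a * complex.Re b - complex.Im a * complex.Im b.
Proof. by case: a; case: b. Qed.

Lemma Im_mul (a b : C) :
  complex.Im (a * b) = complex.Re a * complex.Im b + complex.Im a * complex.Re b.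
Proof. by case: a; case: b. Qed.

Lemma Re_conj (a : C) : complex.Re (conjc a) = complex.Re a.
Proof. by case: a. Qed.

Lemma Im_conj (a : C) : complex.Im (conjc a) = - complex.Im a.
Proof. by case: a. Qed.

Lemma eq_continuous (T U : topologicalType) (f g : T -> U) : f =1 g -> continuous f -> continuous g.
Proof. by move=> /funext ->. Qed.

Lemma nbhs_dist_lt (V : normedModType C) (c : V) (e : C) (S : V -> Prop) : 0 < e ->
  (forall d, `|c - d| < e -> S d) -> \forall d \near c, S d.
Proof. by move=> e0 H; apply/nbhs_ballP; exists e => // d; rewrite -ball_normE => /H. Qed.

Lemma continuous_re : continuous (fun c : C^o => complex.Re c).
Proof.
move=> c; have FF := @nbhs_filter C^o c.
apply/cvgrPdist_lt => e e0; apply: (@nbhs_dist_lt C^o c e%:C%C).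
  by rewrite ltcR.
by move=> d; rewrite -ltcR -raddfB; apply: le_lt_trans; exact: normc_re_le.
Qed.

Lemma continuous_im : continuous (fun c : C^o => complex.Im c).
Proof.
move=> c; have FF := @nbhs_filter C^o c.
apply/cvgrPdist_lt => e e0; apply: (@nbhs_dist_lt C^o c e%:C%C).
  by rewrite ltcR.
by move=> d; rewrite -ltcR -raddfB; apply: le_lt_trans; exact: normc_im_le.
Qed.

Lemma continuous_complex : continuous (fun x : R * R => (x.1 +i* x.2)%C : C^o).
Proof.
(* Radii in [C^o] are complex numbers; positivity forces the imaginary part [e'] to vanish. *)
move=> [a b]; apply/cvgrPdist_lt => -[e e'] e0.
have e'0 : e' = 0 by move: e0; rewrite ltcE /= => /andP[/eqP].
move: e0; rewrite e'0 ltcR => e0; near=> x.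
have : `|a - x.1| + `|b - x.2| < e.
  rewrite (splitr e); apply: ltrD; near: x.
    by apply: (@cvgr_dist_lt _ R^o); [exact: cvg_fst|lra].
  by apply: (@cvgr_dist_lt _ R^o); [exact: cvg_snd|lra].
by rewrite -ltcR; apply: le_lt_trans; exact: (normc_le ((a +i* b) - (x.1 +i* x.2))%C).
Unshelve. all: by end_near. Qed.

Lemma compact_square (r : R) :
  compact [set c : C^o | `|complex.Re c| <= r /\ `|complex.Im c| <= r].
Proof.
have -> : [set c : C^o | `|complex.Re c| <= r /\ `|complex.Im c| <= r] =
    (fun x : R * R => (x.1 +i* x.2)%C : C^o) @` (`[- r, r] `*` `[- r, r]).
  apply/seteqP; split=> [[a b] /= [ha hb]|_ [[a b] /= [ha hb] <-]].
    by exists (a, b) => //=; rewrite !in_itv /= -!ler_norml.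
  by move: ha hb; rewrite !in_itv /= -!ler_norml.
apply: continuous_compact; last by apply: compact_setX; exact: segment_compact.
exact/continuous_subspaceT/continuous_complex.
Qed.

End ComplexTopology.

Section AffineSpace.
Context {R : realType} {n : nat}.
Local Notation C := R[i].
Local Notation P := (Pnn R n).
Implicit Types (Q S : P) (z : @Cn R n).
Local Notation Cn := (@Cn R n).

Lemma continuous_coordinate j : continuous (fun z : 'rV[C^o]_n => z ord0 j).
Proof. exact: coord_continuous. Qed.

Lemma Cn_hausdorff : hausdorff_space 'rV[C^o]_n.
Proof.
move=> p q pq; apply/rowP => j; apply: (@norm_hausdorff _ C^o).
move=> A B pA qB.
have [z [Az Bz]] := pq _ _ (@continuous_coordinate j p A pA) (@continuous_coordinate j q B qB).
by exists (z ord0 j).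
Qed.

Lemma continuous_evalC_re_im Q :
  continuous (fun z : 'rV[C^o]_n => complex.Re (evalC Q z)) /\
  continuous (fun z : 'rV[C^o]_n => complex.Im (evalC Q z)).
Proof.
elim/(@Pnn_ind R n): Q => [c|k|p q [p1 p2] [q1 q2]|p q [p1 p2] [q1 q2]].
- split; [apply: (eq_continuous (f := fun=> complex.Re c)) => [z|]
          |apply: (eq_continuous (f := fun=> complex.Im c)) => [z|]].
  + by rewrite evalC_cst.
  + exact: cst_continuous.
  + by rewrite evalC_cst.
  + exact: cst_continuous.
- have re j : continuous (fun z : 'rV[C^o]_n => complex.Re (z ord0 j)).
    by move=> z; apply: continuous_comp; [exact: continuous_coordinate|exact: continuous_re].
  have im j : continuous (fun z : 'rV[C^o]_n => complex.Im (z ord0 j)).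
    by move=> z; apply: continuous_comp; [exact: continuous_coordinate|exact: continuous_im].
  have [[j ->]|[j ->]] := coord_split k; split.
  - by apply: (eq_continuous _ (re j)) => z; rewrite /evalC mevalXU (unsplitK (inl j)).
  - by apply: (eq_continuous _ (im j)) => z; rewrite /evalC mevalXU (unsplitK (inl j)).
  - by apply: (eq_continuous _ (re j)) => z; rewrite /evalC mevalXU (unsplitK (inr j)) Re_conj.
  - apply: (eq_continuous (f := fun z : 'rV[C^o]_n => - complex.Im (z ord0 j))) => z.
      by rewrite /evalC mevalXU (unsplitK (inr j)) Im_conj.
    exact: cvgN (im j z).
- split.
    apply: (eq_continuous (f := fun z : 'rV[C^o]_n => complex.Re (evalC p z) + complex.Re (evalC q z))) => z.
      by rewrite evalCD raddfD.
    exact: (cvgD (p1 z) (q1 z)).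
  apply: (eq_continuous (f := fun z : 'rV[C^o]_n => complex.Im (evalC p z) + complex.Im (evalC q z))) => z.
    by rewrite evalCD raddfD.
  exact: (cvgD (p2 z) (q2 z)).
- split.
    apply: (eq_continuous (f := fun z : 'rV[C^o]_n => complex.Re (evalC p z) * complex.Re (evalC q z) -
        complex.Im (evalC p z) * complex.Im (evalC q z))) => z.
      by rewrite evalCM Re_mul.
    exact: (cvgB (cvgM (p1 z) (q1 z)) (cvgM (p2 z) (q2 z))).
  apply: (eq_continuous (f := fun z : 'rV[C^o]_n => complex.Re (evalC p z) * complex.Im (evalC q z) +
      complex.Im (evalC p z) * complex.Re (evalC q z))) => z.
    by rewrite evalCM Im_mul.
  exact: (cvgD (cvgM (p1 z) (q2 z)) (cvgM (p2 z) (q1 z))).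
Qed.

Definition sqnorm z : R := \sum_j (complex.Re (z ord0 j) ^+ 2 + complex.Im (z ord0 j) ^+ 2).
Definition sqnorm_poly : P := \sum_j (Xvar j * Yvar j).

Lemma sqnorm_ge0 z : 0 <= sqnorm z.
Proof. by apply: sumr_ge0 => j _; rewrite addr_ge0 ?sqr_ge0. Qed.

Lemma sqnorm_coord z j : complex.Re (z ord0 j) ^+ 2 + complex.Im (z ord0 j) ^+ 2 <= sqnorm z.
Proof.
rewrite /sqnorm (bigD1 j)//= lerDl; apply: sumr_ge0 => i _.
by rewrite addr_ge0 ?sqr_ge0.
Qed.

Lemma evalC_sqnorm_poly z : complex.Re (evalC sqnorm_poly z) = sqnorm z.
Proof.
rewrite /sqnorm_poly (big_morph (fun Q => complex.Re (evalC Q z)) (op1 := +%R) (id1 := 0)).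
- apply: eq_bigr => j _; rewrite evalCM /evalC !mevalXU (unsplitK (inl j)) (unsplitK (inr j)).
  by rewrite Re_mul Re_conj Im_conj mulrN opprK.
- by move=> Q S; rewrite evalCD raddfD.
- by rewrite /evalC meval0.
Qed.

(** A closed subset of a product of compact squares: [a^2 <= |r|] implies [|a| <= 1 + |r|]. *)
Lemma compact_sublevel r :
  compact [set z : 'rV[C^o]_n | complex.Re (evalC sqnorm_poly z) <= r].
Proof.
apply: (@subclosed_compact _ _ [set z : 'rV[C^o]_n | forall j, [set c : C^o |
    `|complex.Re c| <= 1 + `|r| /\ `|complex.Im c| <= 1 + `|r|] (z ord0 j)]).
- apply: (@closed_comp _ _ (fun z : 'rV[C^o]_n => complex.Re (evalC sqnorm_poly z)) [set x | x <= r]).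
    by move=> z _; exact: (continuous_evalC_re_im sqnorm_poly).1.
  exact: closed_le.
- exact: (@rV_compact C^o n (fun=> _) (fun=> @compact_square R (1 + `|r|))).
move=> z /=; rewrite evalC_sqnorm_poly => zr j; have := sqnorm_coord z j.
have := ler_norm r; move: (`|r|) (normr_ge0 r) => s s0 rs h.
by split; rewrite ler_norml; apply/andP; split; nra.
Qed.

(** A submultiplicative norm with values in [R], whereas the modulus is an element of [R[i]]. *)
Definition norm1 (c : C) : R := `|complex.Re c| + `|complex.Im c|.

Lemma Re_add (a b : C) : complex.Re (a + b) = complex.Re a + complex.Re b.
Proof. by case: a; case: b. Qed.

Lemma Im_add (a b : C) : complex.Im (a + b) = complex.Im a + complex.Im b.
Proof. by case: a; case: b. Qed.

Lemma norm1D a b : norm1 (a + b) <= norm1 a + norm1 b.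
Proof. by rewrite /norm1 !raddfD /= addrACA lerD// ler_normD. Qed.

Lemma norm1M a b : norm1 (a * b) <= norm1 a * norm1 b.
Proof.
rewrite /norm1 Re_mul Im_mul; apply: (le_trans (lerD (ler_normB _ _) (ler_normD _ _))).
by rewrite !normrM le_eqVlt; apply/orP; left; apply/eqP; ring.
Qed.

Lemma norm1_ge0 c : 0 <= norm1 c.
Proof. by rewrite addr_ge0. Qed.

Lemma norm1_coord z j : norm1 (z ord0 j) <= 2 * (1 + sqnorm z).
Proof.
have H (a b s : R) : a ^+ 2 + b ^+ 2 <= s -> `|a| + `|b| <= 2 * (1 + s).
  rewrite -[a ^+ 2]real_normK ?num_real// -[b ^+ 2]real_normK ?num_real//.
  by move: `|a| `|b| => x y h; have := sqr_ge0 (x - 1); have := sqr_ge0 (y - 1); nra.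
exact/H/sqnorm_coord.
Qed.

Lemma growth_evalC Q : exists d (M : R), 0 <= M /\
  forall z, norm1 (evalC Q z) <= M * (1 + sqnorm z) ^+ d.
Proof.
have s1 z : 1 <= 1 + sqnorm z by rewrite lerDl sqnorm_ge0.
elim/(@Pnn_ind R n): Q => [c|k|p q [d1 [M1 [M10 h1]]] [d2 [M2 [M20 h2]]]
    |p q [d1 [M1 [M10 h1]]] [d2 [M2 [M20 h2]]]].
- exists 0%N, (norm1 c); split; first exact: norm1_ge0.
  by move=> z; rewrite evalC_cst mulr1.
- exists 1%N, 2; split=> // z; rewrite expr1; have [[j ->]|[j ->]] := coord_split k.
    by rewrite /evalC mevalXU (unsplitK (inl j)); exact: norm1_coord.
  rewrite /evalC mevalXU (unsplitK (inr j)) /norm1 Re_conj Im_conj normrN.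
  exact: norm1_coord.
- exists (d1 + d2)%N, (M1 + M2); split=> [|z]; first exact: addr_ge0.
  rewrite evalCD (le_trans (norm1D _ _))// mulrDl lerD//.
    by rewrite (le_trans (h1 z))// ler_wpM2l// ler_weXn2l// leq_addr.
  by rewrite (le_trans (h2 z))// ler_wpM2l// ler_weXn2l// leq_addl.
- exists (d1 + d2)%N, (M1 * M2); split=> [|z]; first exact: mulr_ge0.
  by rewrite evalCM (le_trans (norm1M _ _))// exprD mulrACA ler_pM// norm1_ge0.
Qed.

Definition gauss z : R := expR (- sqnorm z).

(** With [s = |z|^2] and [t = s / (d + 1)], one has [1 + s <= (d + 1) (1 + t) <= (d + 1) exp(t)].
    The power [d + 1] of this gives [(d + 1)^(d + 1) exp(s)]; the exponent is [d + 1] rather than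
    [d] to avoid division by zero. *)
Lemma gauss_bound Q : exists M : R, forall z, gauss z * norm1 (evalC Q z) <= M.
Proof.
have [d [M [M0 h]]] := growth_evalC Q; exists (M * d.+1%:R ^+ d.+1) => z.
rewrite /gauss expRN mulrC ler_pdivrMr ?expR_gt0//; apply: (le_trans (h z)).
rewrite -mulrA ler_wpM2l//; have s0 := sqnorm_ge0 z.
apply: (le_trans (y := (1 + sqnorm z) ^+ d.+1)); first by rewrite ler_weXn2l// lerDl.
have -> : sqnorm z = d.+1%:R * (sqnorm z / d.+1%:R) by rewrite mulrC divfK ?pnatr_eq0.
set t := sqnorm z / _; have t0 : 0 <= t by rewrite divr_ge0.
rewrite expRM_natl -exprMn ler_pXn2r ?nnegrE//; last by rewrite addr_ge0// mulr_ge0.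
apply: (le_trans (y := d.+1%:R * (1 + t))); last by rewrite ler_wpM2l// expR_ge1Dx.
by rewrite mulrDr mulr1 lerD2r ler1n.
Qed.

(** * A positive functional carried by a sequence of points *)

Section DiscreteFunctional.
Variable pt : nat -> Cn.

(** The Gaussian factor makes one sequence of weights summable against all polynomials, wherever the
    points lie. *)
Definition weight k : R := 2^-1 * 2^-1 ^+ k * gauss (pt k).

Lemma weight_gt0 k : 0 < weight k.
Proof. by rewrite !mulr_gt0 ?exprn_gt0 ?expR_gt0. Qed.

Lemma weighted_cvg Q (f : C -> R) : (forall c, `|f c| <= norm1 c) ->
  cvgn (series (fun k => weight k * f (evalC Q (pt k)))).
Proof.
move=> f1; have [M hM] := gauss_bound Q; apply: normed_cvg.
apply: (@series_le_cvg _ _ (geometric (2^-1 * M) 2^-1)) => [k|k|k|].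
- exact: normr_ge0.
- have M0 : 0 <= M by apply: le_trans (hM (pt k)); rewrite mulr_ge0 ?expR_ge0 ?norm1_ge0.
  by rewrite /geometric /= !mulr_ge0 ?exprn_ge0.
- rewrite /= normrM gtr0_norm ?weight_gt0// /weight /geometric /= -!mulrA ler_wpM2l//.
  rewrite [leRHS]mulrC ler_wpM2l ?exprn_ge0//; apply: le_trans (hM (pt k)).
  by rewrite ler_wpM2l ?expR_ge0.
- by apply: is_cvg_geometric_series; rewrite ger0_norm// invf_lt1 ?ltr1n.
Qed.

Lemma Re_norm1 c : `|complex.Re c| <= norm1 c. Proof. by rewrite lerDl. Qed.

Lemma Im_norm1 c : `|complex.Im c| <= norm1 c. Proof. by rewrite lerDr. Qed.

Definition discrete_functional Q : C :=
  (limn (series (fun k => weight k * complex.Re (evalC Q (pt k))))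
    +i* limn (series (fun k => weight k * complex.Im (evalC Q (pt k)))))%C.

Lemma discrete_linear (c : C) Q S :
  discrete_functional (c *: Q + S) = c * discrete_functional Q + discrete_functional S.
Proof.
have re T : series (fun k => weight k * complex.Re (evalC T (pt k))) @ \oo -->
    complex.Re (discrete_functional T).
  exact: weighted_cvg Re_norm1.
have im T : series (fun k => weight k * complex.Im (evalC T (pt k))) @ \oo -->
    complex.Im (discrete_functional T).
  exact: weighted_cvg Im_norm1.
apply/eqP; rewrite eq_complex Re_add Im_add Re_mul Im_mul; apply/andP; split; apply/eqP.
  apply: cvg_lim => //.
  have -> : series (fun k => weight k * complex.Re (evalC (c *: Q + S) (pt k))) =
      fun N => complex.Re c * series (fun k => weight k * complex.Re (evalC Q (pt k))) N -
        complex.Im c * series (fun k => weight k * complex.Im (evalC Q (pt k))) N +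
        series (fun k => weight k * complex.Re (evalC S (pt k))) N.
    apply/funext => N; rewrite /series /= !mulr_sumr -sumrB -big_split /=.
    apply: eq_bigr => k _; rewrite -mul_mpolyC evalCD evalCM evalC_cst Re_add Re_mul.
    by ring.
  exact: (cvgD (cvgB (cvgM (cvg_cst _) (re Q)) (cvgM (cvg_cst _) (im Q))) (re S)).
apply: cvg_lim => //.
have -> : series (fun k => weight k * complex.Im (evalC (c *: Q + S) (pt k))) =
    fun N => complex.Re c * series (fun k => weight k * complex.Im (evalC Q (pt k))) N +
      complex.Im c * series (fun k => weight k * complex.Re (evalC Q (pt k))) N +
      series (fun k => weight k * complex.Im (evalC S (pt k))) N.
  apply/funext => N; rewrite /series /= !mulr_sumr -!big_split /=.
  apply: eq_bigr => k _; rewrite -mul_mpolyC evalCD evalCM evalC_cst Im_add Im_mul.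
  by ring.
exact: (cvgD (cvgD (cvgM (cvg_cst _) (im Q)) (cvgM (cvg_cst _) (re Q))) (im S)).
Qed.

(** The terms [weight k * |Q(z_k)|^2] are nonnegative with positive weights, so the sum vanishes
    only if every term does. *)
Lemma discrete_sqr Q : 0 <= discrete_functional (star Q * Q) /\
  (discrete_functional (star Q * Q) = 0 <-> forall k, evalC Q (pt k) = 0).
Proof.
pose u k := weight k * complex.Re (evalC (star Q * Q) (pt k)).
have reE z : complex.Re (evalC (star Q * Q) z) = complex.Re (evalC Q z) ^+ 2 + complex.Im (evalC Q z) ^+ 2.
  by rewrite evalCM evalC_star Re_mul Re_conj Im_conj mulNr opprK.
have imE z : complex.Im (evalC (star Q * Q) z) = 0.
  by rewrite evalCM evalC_star Im_mul Re_conj Im_conj mulNr mulrC subrr.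
have u0 k : 0 <= u k by rewrite /u reE mulr_ge0 ?addr_ge0 ?sqr_ge0// ltW ?weight_gt0.
have cu : cvgn (series u) by exact: weighted_cvg Re_norm1.
have dE : discrete_functional (star Q * Q) = (limn (series u))%:C%C.
  rewrite /discrete_functional -/u; congr Complex; apply: cvg_lim => //.
  rewrite (_ : series _ = fun=> 0); first exact: cvg_cst.
  by apply/funext => N; rewrite /series /= big1// => k _; rewrite imE mulr0.
have nd : nondecreasing_seq (series u) by exact: nondecreasing_series.
have le N : series u N <= limn (series u) by exact: nondecreasing_cvgn_le.
split; first by rewrite dE lecR; apply: le_trans (le 0%N); rewrite /series /= big_geq.
rewrite dE; split=> [/(congr1 (@complex.Re R)) /= u_0 k|Q0].
  have : u k = 0.
    apply/eqP; rewrite eq_le u0 andbT -u_0; apply: le_trans (le k.+1).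
    by rewrite /series /= big_nat_recr//= lerDr sumr_ge0.
  rewrite /u reE => /eqP; rewrite mulf_eq0 gt_eqF ?weight_gt0//= paddr_eq0 ?sqr_ge0// !sqrf_eq0.
  by move=> /andP[a b]; apply/eqP; rewrite eq_complex a b.
congr (_%:C%C); apply: cvg_lim => //; rewrite (_ : series _ = fun=> 0); first exact: cvg_cst.
by apply/funext => N; rewrite /series /= big1// => k _; rewrite /u reE Q0 /= expr0n addr0 mulr0.
Qed.

End DiscreteFunctional.

Lemma floor_dist (N x y : R) : 0 < N -> Num.floor (N * x) = Num.floor (N * y) -> `|x - y| < N^-1.
Proof.
move=> N0 e; have := floor_itv (N * x); have := floor_itv (N * y).
rewrite e => /andP[a b] /andP[c d]; rewrite -(ltr_pM2l N0) divff ?gt_eqF//.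
rewrite -[X in X * `|_|]gtr0_norm// -normrM mulrBr ltr_norml; move: a b c d; rewrite intrD.
by lra.
Qed.

Definition cell k z : {ffun 'I_n -> int * int} :=
  [ffun j => (Num.floor (k.+1%:R * complex.Re (z ord0 j)), Num.floor (k.+1%:R * complex.Im (z ord0 j)))].

Lemma cell_dist k y z j : cell k y = cell k z -> `|z ord0 j - y ord0 j| < (2 / k.+1%:R)%:C%C.
Proof.
move=> /ffunP/(_ j); rewrite !ffunE => -[e1 e2]; apply: (le_lt_trans (normc_le _)).
rewrite ltcR (_ : 2 / _ = k.+1%:R^-1 + k.+1%:R^-1); last by ring.
by apply: ltrD; rewrite raddfB /= floor_dist// ltr0n.
Qed.

(* One point of [V] is chosen in each cell of the grids of mesh [1 / (k + 1)] that meets [V]. *)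
Lemma dense_sequence (V : set Cn) : V !=set0 -> exists pt : nat -> Cn,
  (forall k, V (pt k)) /\ forall Q, (forall k, evalC Q (pt k) = 0) -> vanishing_ideal V Q.
Proof.
move=> [v0 Vv0].
(* The default [v0] keeps the chosen point in [V] when the cell does not meet [V]. *)
pose pick (c : nat * {ffun 'I_n -> int * int}) : Cn := xget v0 [set z | V z /\ cell c.1 z = c.2].
have pickV c : V (pick c) by rewrite /pick; case: xgetP => [y -> []|].
exists (fun i => odflt v0 (omap pick (choice.unpickle i))); split=> [k|Q Q0 z Vz].
  by case: (choice.unpickle k) => /=.
have pick0 c : evalC Q (pick c) = 0 by have := Q0 (choice.pickle c); rewrite choice.pickleK.
have H (f : 'rV[C^o]_n -> R) : continuous f -> (forall c, f (pick c) = 0) -> f z = 0.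
  move=> cf f0; apply/eqP/negPn/negP => fz.
  have nfz : nbhs (f z) [set x : R | x != 0].
    by apply: open_nbhs_nbhs; split => //; exact: open_neq.
  have := cf z _ nfz.
  move=> /nbhs_ballP[[e e'] /= e0 sub].
  have e'0 : e' = 0 by move: e0; rewrite ltcE /= => /andP[/eqP].
  move: e0 sub; rewrite e'0 ltcR => e0 sub.
  (* As [2 / e < k + 1], two points of one cell differ by less than [e] in every coordinate. *)
  pose k := Num.bound (2 / e); pose y := pick (k, cell k z).
  have yz : cell k y = cell k z.
    by rewrite /y /pick; case: xgetP => [u _ []//|/(_ z)]; case.
  have /sub : ball (z : 'rV[C^o]_n) (e%:C)%C y.
    split=> [|i j]; first by rewrite ltcR.
    rewrite (ord1 i) -ball_normE /=; apply: (lt_trans (cell_dist j yz)).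
    rewrite ltcR ltr_pdivrMr// mulrC -ltr_pdivrMr//.
    have b0 : 0 <= 2 / e by rewrite divr_ge0// ltW.
    by apply: (lt_le_trans (archi_boundP b0)); rewrite ler_nat.
  by rewrite /= f0 eqxx.
apply/eqP; rewrite eq_complex; apply/andP; split; apply/eqP.
  by apply: (H _ (continuous_evalC_re_im Q).1) => c; rewrite pick0.
by apply: (H _ (continuous_evalC_re_im Q).2) => c; rewrite pick0.
Qed.

(** * Perturbed functionals and their limit *)

Section Perturbation.
Variables (L : {scalar P}) (e : R) (pt : nat -> Cn).

Definition perturbed Q : C := L Q + e%:C%C * discrete_functional pt Q.

Lemma perturbed_linear : scalar perturbed.
Proof.
move=> c Q S; rewrite /perturbed discrete_linear.
have -> : L (c *: Q + S) = c * L Q + L S by rewrite raddfD /= linearZ.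
by move: (L Q) (L S) (discrete_functional pt Q) (discrete_functional pt S) => a b x y; ring.
Qed.

HB.instance Definition _ := GRing.isLinear.Build C P C *%R perturbed perturbed_linear.

End Perturbation.

Lemma perturbed_positive L e pt : positive_definite L -> 0 < e ->
  positive_definite (perturbed L e pt).
Proof.
move=> Lpos e0 Q; rewrite /perturbed addr_ge0//; apply: mulr_ge0; first by rewrite lecR ltW.
exact: (discrete_sqr pt Q).1.
Qed.

Lemma perturbed_null L e pt (V : set Cn) : positive_definite L -> 0 < e ->
  vanishing_ideal V `<=` null_ideal L -> (forall k, V (pt k)) ->
  (forall Q, (forall k, evalC Q (pt k) = 0) -> vanishing_ideal V Q) ->
  vanishing_ideal V = null_ideal (perturbed L e pt).
Proof.
move=> Lpos e0 VL ptV ptQ; apply/seteqP; split=> Q.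
  move=> VQ; rewrite /null_ideal /= /perturbed [L _](VL _ VQ) add0r.
  by rewrite ((discrete_sqr pt Q).2.2 _) ?mulr0// => k; exact: VQ.
rewrite /null_ideal /= /perturbed => /eqP.
have ec : 0 < (e%:C)%C by rewrite ltcR.
rewrite paddr_eq0//; last by rewrite mulr_ge0// ?(ltW ec)// (discrete_sqr pt Q).1.
rewrite mulf_eq0 (gt_eqF ec) => /andP[_ /eqP /(discrete_sqr pt Q).2.1].
exact: ptQ.
Qed.

Lemma evalC_Icst S z : complex.Re (evalC (- Icst * S) z) = complex.Im (evalC S z).
Proof. by rewrite evalCM evalCN evalC_cst Re_mul /= oppr0 mul0r sub0r mulN1r opprK. Qed.

Lemma scalar_Icst (L : {scalar P}) S : complex.Re (L (- Icst * S)) = complex.Im (L S).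
Proof.
by rewrite /Icst -mpolyCN mul_mpolyC linearZ /= Re_mul /= oppr0 mul0r sub0r mulN1r opprK.
Qed.

(** The algebra to which [moment_limit] is applied. It contains the imaginary parts too, as real
    parts of [- i Q]. *)
Definition re_parts : set ('rV[C^o]_n -> R) :=
  [set f | exists Q, f = fun z => complex.Re (evalC Q z)].

(** [Re a * Re b = Re (a (b + conj b) / 2)], and the conjugate is the value of [star S]. *)
Lemma re_partsM f g : re_parts f -> re_parts g -> re_parts (fun z => f z * g z).
Proof.
move=> [Q ->] [S ->]; exists (half_cst * (Q * S + Q * star S)); apply/funext => z.
rewrite evalCM evalCD !evalCM evalC_cst evalC_star.
move: (evalC Q z) (evalC S z) => a b.
have -> : 2^-1 * (a * b + a * b^*%C) = a * (complex.Re b)%:C%C.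
  by rewrite -mulrDr ReJ_add mulrCA [_ / _]mulrC.
by rewrite Re_mul /= mulr0 subr0.
Qed.

Theorem type_C_type_A Q : type_C (zero_set Q) -> type_A Q.
Proof.
move=> VC L Lpos LQ; have VL := vanishing_ideal_null Lpos LQ.
(* An empty zero set carries no sequence of points. Its ideal is then the whole ring, hence equal to
   the null ideal, and type C applies to [L] itself. *)
have [/dense_sequence [pt [ptV ptQ]]|V0] := pselect (zero_set Q !=set0); last first.
  apply: VC => //; apply/seteqP; split=> // S _ z Vz.
  by exfalso; apply: V0; exists z.
have e0 k : 0 < k.+1%:R^-1 :> R by rewrite invr_gt0 ltr0n.
have H k : moment_functional (perturbed L k.+1%:R^-1 pt).
  apply: VC; first exact: perturbed_positive.
  exact: perturbed_null.
pose mu k := projT1 (cid (H k)); have muP k := projT2 (cid (H k)).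
(* [L] acts on polynomials, but [ell] has to act on functions; a limit of integrals depends on the
   function alone. *)
pose ell (f : 'rV[C^o]_n -> R) : R := limn (fun k => Rintegral (mu k) setT (f : @borelCn R n -> R)).
have cvg_re S : Rintegral (mu k) setT (fun z : @borelCn R n => complex.Re (evalC S z)) @[k --> \oo]
    --> complex.Re (L S).
  have -> : (fun k => Rintegral (mu k) setT (fun z : @borelCn R n => complex.Re (evalC S z))) =
      fun k => complex.Re (L S) + @harmonic R k * complex.Re (discrete_functional pt S).
    apply/funext => k; have [_ _ /(congr1 (@complex.Re R)) /= <-] := muP k S.
    by rewrite /perturbed Re_add Re_mul /= mul0r subr0.
  rewrite -[X in _ --> X]addr0 -[X in _ --> _ + X](mul0r (complex.Re (discrete_functional pt S))).
  exact: (cvgD (cvg_cst _) (cvgM cvg_harmonic (cvg_cst _))).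
have ellE S : ell (fun z => complex.Re (evalC S z)) = complex.Re (L S) by exact: cvg_lim (cvg_re S).
have [|||||||la laP] := @moment_limit R 'rV[C^o]_n uniform_regular Cn_hausdorff re_parts
  _ _ _ _ _ mu ell.
- by move=> _ [S ->]; exact: (continuous_evalC_re_im S).1.
- move=> _ _ [S ->] [S' ->]; exists (S + S'); apply/funext => z.
  by rewrite evalCD Re_add.
- exact: re_partsM.
- by move=> c; exists (mpolyC (n + n) c%:C%C); apply/funext => z; rewrite evalC_cst.
- exists (fun z => complex.Re (evalC sqnorm_poly z)); first by exists sqnorm_poly.
  exact: compact_sublevel.
- by move=> k _ [S ->]; have [] := muP k S.
- by move=> _ [S ->]; rewrite ellE; exact: cvg_re.
exists la => S.
have imE : (fun z : @borelCn R n => complex.Im (evalC S z)) =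
    (fun z : @borelCn R n => complex.Re (evalC (- Icst * S) z)).
  by apply/funext => z; rewrite evalC_Icst.
have [i1 r1] := laP _ (ex_intro _ S erefl).
have [i2 r2] := laP _ (ex_intro _ (- Icst * S) erefl).
split; first exact: i1.
  rewrite (_ : (fun z => _) =
      (fun z : @borelCn R n => (complex.Re (evalC (- Icst * S) z))%:E)); first exact: i2.
  by apply/funext => z; rewrite evalC_Icst.
rewrite imE r1 r2 !ellE scalar_Icst.
by case: (L S).
Qed.

End AffineSpace.

Theorem theorem8p2 (R : realType) (n : nat) (hn : (0 < n)%N) (P : Pnn R n) :
  type_A P <-> type_C (zero_set P).
Proof. by split; [exact: type_A_type_C|exact: type_C_type_A]. Qed.
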